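(* Let $0<T<\infty$ be arbitrary, and let $\epsilon,\mu,\sigma,\epsilon_0,\mu_0,\sigma_0$, $D$, $B$, $\boldsymbol{a}$, $f$, the fields $\boldsymbol{V}_e,\boldsymbol{V}_m$ and the indicator function $I(\tau)$ be as in the context (the background coefficients $\epsilon_0,\mu_0,\sigma_0$ are general, possibly non-constant, essentially bounded functions). For $\tau>0$ put $\tilde\epsilon=\epsilon+\frac{\sigma}{\tau}$ and $\tilde\epsilon_0=\epsilon_0+\frac{\sigma_0}{\tau}$. Then, as $\tau\to\infty$, $$I(\tau)\le \tau\int_{\mathbb R^3}\left\{\frac{\tilde\epsilon_0}{\tilde\epsilon}(\tilde\epsilon_0-\tilde\epsilon)|\boldsymbol V_e|^2+(\mu-\mu_0)|\boldsymbol V_m|^2\right\}dx+O(\tau^{-5/2}e^{-\tau T})$$ and $$I(\tau)\ge \tau\int_{\mathbb R^3}\left\{(\tilde\epsilon_0-\tilde\epsilon)|\boldsymbol V_e|^2+\frac{\mu_0}{\mu}(\mu-\mu_0)|\boldsymbol V_m|^2\right\}dx+O(\tau^{-5/2}e^{-\tau T}).$$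
   Context: Coefficients: $\epsilon,\mu,\sigma,\epsilon_0,\mu_0,\sigma_0$ are real-valued essentially bounded functions on $\mathbb R^3$ such that $\epsilon,\mu,\epsilon_0,\mu_0$ have strictly positive essential infimum and $\sigma,\sigma_0\ge 0$ a.e. $D\subset\mathbb R^3$ is a nonempty bounded open set with $\mathbb R^3\setminus\overline D$ connected, and $\epsilon=\epsilon_0$, $\mu=\mu_0$, $\sigma=\sigma_0$ a.e. on $\mathbb R^3\setminus D$. No further regularity of $\partial D$ or of the coefficients is assumed. Source: $B$ is the open ball with center $p$ and radius $\eta>0$, with $\overline B\cap\overline D=\emptyset$; $\boldsymbol a\in\mathbb R^3$ is a constant unit vector; $f\in H^1(0,T)$ is real-valued with $f(0)=0$; $\boldsymbol J(x,t)=f(t)\chi_B(x)\boldsymbol a$, where $\chi_B$ is the characteristic function of $B$. Fields: $(\boldsymbol E,\boldsymbol H)$ is the solution on $\mathbb R^3\times\,]0,T[$ of $$\epsilon\,\partial_t\boldsymbol E-\nabla\times\boldsymbol H=-\sigma\boldsymbol E+\boldsymbol J,\quad \mu\,\partial_t\boldsymbol H+\nabla\times\boldsymbol E=\boldsymbol 0,\quad \boldsymbol E|_{t=0}=\boldsymbol H|_{t=0}=\boldsymbol 0,$$ and $(\boldsymbol E_0,\boldsymbol H_0)$ is the solution of the same system with $(\epsilon,\mu,\sigma)$ replaced by $(\epsilon_0,\mu_0,\sigma_0)$ (same $\boldsymbol J$). Solutions are understood in the class $C^1([0,T];L^2(\mathbb R^3)^3)\cap C([0,T];H(\mathrm{curl};\mathbb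 R^3))$ for each of the two fields. For $\tau>0$: $$\boldsymbol W_e=\int_0^Te^{-\tau t}\boldsymbol E(\cdot,t)\,dt,\ \ \boldsymbol W_m=\int_0^Te^{-\tau t}\boldsymbol H(\cdot,t)\,dt,\ \ \boldsymbol V_e=\int_0^Te^{-\tau t}\boldsymbol E_0(\cdot,t)\,dt,\ \ \boldsymbol V_m=\int_0^Te^{-\tau t}\boldsymbol H_0(\cdot,t)\,dt,$$ $\tilde f(\tau)=\int_0^Te^{-\tau t}f(t)\,dt$ and $\boldsymbol f(x,\tau)=\int_0^Te^{-\tau t}\boldsymbol J(x,t)\,dt=\tilde f(\tau)\chi_B(x)\boldsymbol a$. The indicator function is $$I(\tau)=\int_{\mathbb R^3}\boldsymbol f\cdot(\boldsymbol W_e-\boldsymbol V_e)\,dx .$$ ''$I(\tau)\le X(\tau)+O(g(\tau))$ as $\tau\to\infty$'' means there are $C,\tau_0>0$ with $I(\tau)\le X(\tau)+C g(\tau)$ for $\tau\ge\tau_0$, and similarly for $\ge$ with $-Cg(\tau)$. *)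

(* Defs.v *)
From HB Require Import structures.
From mathcomp Require Import all_boot all_order all_algebra.
From mathcomp Require Import all_classical all_reals all_analysis.
From mathcomp Require Import measurable_realfun ess_sup_inf.

Set Implicit Arguments.
Unset Strict Implicit.
Unset Printing Implicit Defensive.

Import Order.TTheory GRing.Theory Num.Theory.
Import numFieldNormedType.Exports.

Local Open Scope classical_set_scope.
Local Open Scope ring_scope.

(* Points of R^3 are nested pairs, so that the library's product topology and
   product measure apply; values of vector fields are row vectors. *)
Notation R3 R := (R * R * R)%type.
Notation vfield R := (R3 R -> 'rV[R]_3).

Definition leb2 (R : realType) :
    set (measurableTypeR R * measurableTypeR R) -> \bar R :=
  (@lebesgue_measure R \x @lebesgue_measure R)%E.
Arguments leb2 : clear implicits.

HB.instance Definition _ (R : realType) := Measure.on (leb2 R).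

(* The instance of the library for products of sigma-finite measures is shadowed
   by the one for subprobabilities and is not found by inference. *)
Lemma product_sigma_finite (d1 d2 : measure_display) (T1 : measurableType d1)
    (T2 : measurableType d2) (R : realType)
    (m1 : {sigma_finite_measure set T1 -> \bar R})
    (m2 : {sigma_finite_measure set T2 -> \bar R}) :
  sigma_finite setT (m1 \x m2)%E.
Proof.
have /sigma_finiteP[F [TF ndF Foo]] := sigma_finiteT m1.
have /sigma_finiteP[G [TG ndG Goo]] := sigma_finiteT m2.
exists (fun n => F n `*` G n).
  rewrite -setXTT TF TG predeqE => -[x y]; split.
    move=> [/= [n _ Fnx] [k _ Gky]]; exists (maxn n k) => //; split.
    - by move: x Fnx; exact/subsetPset/ndF/leq_maxl.
    - by move: y Gky; exact/subsetPset/ndG/leq_maxr.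
  by move=> [n _ []/= ? ?]; split; exists n.
move=> k; have [? ?] := Foo k; have [? ?] := Goo k.
split; first exact: measurableX.
by rewrite product_measure1E// lte_mul_pinfty// ge0_fin_numE.
Qed.

HB.instance Definition _ (R : realType) :=
  Measure_isSigmaFinite.Build _ _ _ (leb2 R)
    (product_sigma_finite (@lebesgue_measure R) (@lebesgue_measure R)).

Definition leb3 (R : realType) :
    set (measurableTypeR R * measurableTypeR R * measurableTypeR R) -> \bar R :=
  (leb2 R \x @lebesgue_measure R)%E.
Arguments leb3 : clear implicits.

HB.instance Definition _ (R : realType) := Measure.on (leb3 R).

HB.instance Definition _ (R : realType) :=
  Measure_isSigmaFinite.Build _ _ _ (leb3 R)
    (product_sigma_finite (leb2 R) (@lebesgue_measure R)).

Definition dot (R : realType) (u v : 'rV[R]_3) : R :=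
  \sum_(i < 3) u ord0 i * v ord0 i.

Definition enorm (R : realType) (u : 'rV[R]_3) : R := Num.sqrt (dot u u).

(* The norm of the library on R * R * R is the sup norm, hence this explicit
   Euclidean ball. *)
Definition eball (R : realType) (p : R3 R) (r : R) : set (R3 R) :=
  [set x | Num.sqrt ((x.1.1 - p.1.1) ^+ 2 + (x.1.2 - p.1.2) ^+ 2
                     + (x.2 - p.2) ^+ 2) < r].

Definition basis3 (R : realType) (i : 'I_3) : R3 R :=
  ((i == 0)%:R, (i == 1)%:R, (i == 2)%:R).

Definition pderiv (R : realType) (i : 'I_3) (g : R3 R -> R) : R3 R -> R :=
  fun x => 'D_(basis3 R i) g x.

Definition smooth3 (R : realType) (g : R3 R -> R) : Prop :=
  forall s : seq 'I_3, let h := foldr (@pderiv R) g s in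
    continuous h /\ forall i x, derivable h x (basis3 R i).

(* C_c^oo(R^3; R^3) *)
Definition test_field (R : realType) (phi : vfield R) : Prop :=
  (forall i, smooth3 (fun x => phi x ord0 i)) /\
  exists K : set (R3 R), compact K /\ forall x, ~ K x -> phi x = 0.

(* Indices are taken modulo 3 in 'I_3. *)
Definition curl (R : realType) (phi : vfield R) : vfield R :=
  fun x => \row_(i < 3)
    (pderiv (i + 1) (fun y => phi y ord0 (i + 2%:R)) x
     - pderiv (i + 2%:R) (fun y => phi y ord0 (i + 1)) x).

Definition L2 (R : realType) (u : vfield R) : Prop :=
  forall i, (fun x => u x ord0 i) \in Lfun (leb3 R) 2%:E.

Definition L2norm (R : realType) (u : vfield R) : \bar R :=
  Lnorm (leb3 R) 2%:E (EFin \o (@enorm R \o u)).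

Definition L2dist (R : realType) (u v : vfield R) : \bar R :=
  L2norm (fun x => u x - v x).

(* u is in H(curl; R^3) and v is its distributional curl. *)
Definition Hcurl (R : realType) (u v : vfield R) : Prop :=
  [/\ L2 u, L2 v &
      forall phi, test_field phi ->
        \int[leb3 R]_x dot (u x) (curl phi x)
        = \int[leb3 R]_x dot (v x) (phi x)].

(* Curves in L^2(R^3)^3 are families of representatives, one for each time;
   only the times in [0, T] matter. *)
Definition C0_L2 (R : realType) (T : R) (F : R -> vfield R) : Prop :=
  (forall t, t \in `[0, T] -> L2 (F t)) /\
  forall t, t \in `[0, T] ->
    L2dist (F s) (F t) @[s --> within `[0, T] (nbhs t)] --> 0%E.

(* F is in C^1([0, T]; L^2(R^3)^3) with derivative dF, one-sided at 0 and T. *)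
Definition C1_L2 (R : realType) (T : R) (F dF : R -> vfield R) : Prop :=
  [/\ C0_L2 T F, C0_L2 T dF &
      forall t, t \in `[0, T] ->
        L2dist (fun x => (s - t)^-1 *: (F s x - F t x)) (dF t)
          @[s --> within `[0, T] t^'] --> 0%E].

(* F is in C([0, T]; H(curl; R^3)) and cF t is the curl of F t; continuity is
   that of the graph norm. *)
Definition C0_Hcurl (R : realType) (T : R) (F cF : R -> vfield R) : Prop :=
  [/\ C0_L2 T F, C0_L2 T cF & forall t, t \in `[0, T] -> Hcurl (F t) (cF t)].

Definition maxwell_solution (R : realType) (T : R) (eps mu sigma : R3 R -> R)
    (J E H : R -> vfield R) : Prop :=
  exists dE dH cE cH : R -> vfield R,
  [/\ C1_L2 T E dE /\ C1_L2 T H dH,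
      C0_Hcurl T E cE /\ C0_Hcurl T H cH,
      forall t, t \in `]0, T[ -> {ae leb3 R, forall x,
        eps x *: dE t x - cH t x = - (sigma x *: E t x) + J t x},
      forall t, t \in `]0, T[ -> {ae leb3 R, forall x,
        mu x *: dH t x + cE t x = 0} &
      {ae leb3 R, forall x, E 0 x = 0} /\ {ae leb3 R, forall x, H 0 x = 0}].

(* L^2-valued simple function of time with value u i on A i, i < m. *)
Definition simple_curve (R : realType) (m : nat) (A : nat -> set R)
    (u : nat -> vfield R) : R -> vfield R :=
  fun t x => \sum_(i < m) \1_(A i) t *: u i x.

Definition simple_curve_int (R : realType) (m : nat) (A : nat -> set R)
    (u : nat -> vfield R) : vfield R :=
  fun x => \sum_(i < m) fine (lebesgue_measure (A i)) *: u i x.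

(* W is the Bochner integral of F over [0, T] in L^2(R^3)^3. *)
Definition bochner_integral (R : realType) (T : R) (F : R -> vfield R)
    (W : vfield R) : Prop :=
  L2 W /\
  exists (m : nat -> nat) (A : nat -> nat -> set R) (u : nat -> nat -> vfield R),
  let S n := simple_curve (m n) (A n) (u n) in
  [/\ forall n i, (i < m n)%N ->
        [/\ measurable (A n i), A n i `<=` `[0, T] & L2 (u n i)],
      forall n, measurable_fun `[0, T] (fun t => L2dist (F t) (S n t)),
      (\int[lebesgue_measure]_(t in `[0%R, T]) L2dist (F t) (S n t))%E
        @[n --> \oo] --> 0%E &
      L2dist W (simple_curve_int (m n) (A n) (u n)) @[n --> \oo] --> 0%E].

Definition laplaceT (R : realType) (T : R) (F : R -> vfield R) (tau : R)
    (W : vfield R) : Prop :=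
  bochner_integral T (fun t x => expR (- (tau * t)) *: F t x) W.

(* C_c^oo(]0, T[) *)
Definition test_fun1 (R : realType) (T : R) (phi : R -> R) : Prop :=
  (forall n x, derivable (derive1n n phi) x 1) /\
  exists K : set R,
    [/\ compact K, K `<=` `]0, T[ & forall x, ~ K x -> phi x = 0].

(* f is the continuous representative on [0, T] of an element of H^1(0, T). *)
Definition H1 (R : realType) (T : R) (f : R -> R) : Prop :=
  [/\ {within `[0, T], continuous f},
      (f \_ `]0, T[) \in Lfun (@lebesgue_measure R) 2%:E &
      exists2 g : R -> R, (g \_ `]0, T[) \in Lfun (@lebesgue_measure R) 2%:E &
        forall phi, test_fun1 T phi ->
          \int[lebesgue_measure]_(t in `]0, T[) (f t * derive1 phi t)
          = - \int[lebesgue_measure]_(t in `]0, T[) (g t * phi t)].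

Definition ess_bounded (R : realType) (c : R3 R -> R) : Prop :=
  c \in Lfun (leb3 R) +oo%E.

Definition ess_inf_gt0 (R : realType) (c : R3 R -> R) : Prop :=
  (0 < ess_inf (leb3 R) (EFin \o c))%E.

Definition admissible_coefs (R : realType) (eps mu sigma : R3 R -> R) : Prop :=
  [/\ ess_bounded eps, ess_bounded mu, ess_bounded sigma,
      ess_inf_gt0 eps /\ ess_inf_gt0 mu &
      {ae leb3 R, forall x, 0 <= sigma x}].

Definition current (R : realType) (f : R -> R) (B : set (R3 R))
    (a : 'rV[R]_3) : R -> vfield R :=
  fun t x => (f t * \1_B x) *: a.

Definition ftilde (R : realType) (T : R) (f : R -> R) (tau : R) : R :=
  \int[lebesgue_measure]_(t in `[0, T]) (expR (- (tau * t)) * f t).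

Definition indicator (R : realType) (T : R) (f : R -> R) (B : set (R3 R))
    (a : 'rV[R]_3) (We Ve : R -> vfield R) (tau : R) : R :=
  \int[leb3 R]_x
    dot ((ftilde T f tau * \1_B x) *: a) (We tau x - Ve tau x).

Definition remainder (R : realType) (T tau : R) : R :=
  tau `^ (- (5%:R / 2%:R)) * expR (- (tau * T)).

(* Main.v *)
(** Write [e = exp (- tau T)].  Transforming the two systems in time gives
    [curl Xm = tau epst Xe - f + e eps E(T)] and [curl Xe = - tau mu Xm - e mu H(T)]
    for [X = W] (coefficients [eps, mu, sigma]) and for [X = V] (background).  As the
    distributional curl on [R^3] is symmetric, pairing system [X] with system [Y] yields
      [<f, Ye> = tau (<epst_X Xe, Ye> + <mu_Y Xm, Ym>)
                 + e (<eps_X E_X(T), Ye> + <mu_Y H_Y(T), Xm>)].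
    Calling this identity [P(X, Y)], the indicator [<f, We> - <f, Ve>] is both
    [P(V, V) + P(W, W) - 2 P(W, V)] and [2 P(V, W) - P(V, V) - P(W, W)]; completing
    squares in [We] and [Wm] gives the lower and the upper bound up to [e] times the
    norms of the transformed fields.  Those norms are [O(tau^(-5/2))] by the energy
    identity [P(X, X)] and [ftilde = O(tau^(-3/2))], a consequence of
    [|f(t)| <= C sqrt t].

    The curl is symmetric because double integrals of [u(x).v(y)] against mollifiers
    of [x - y] converge to [<u, v>].  The magnetic transform [Wm], which the statement
    does not mention, is obtained as a limit of Riemann sums. *)

Require Import Defs.
From mathcomp Require Import all_boot all_order all_algebra.
From mathcomp Require Import all_classical all_reals all_analysis.
From mathcomp Require Import measurable_realfun ess_sup_inf.
From mathcomp Require Import ring lra.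

Set Implicit Arguments.
Unset Strict Implicit.
Unset Printing Implicit Defensive.

Import Order.TTheory GRing.Theory Num.Theory.
Import numFieldNormedType.Exports.

Local Open Scope classical_set_scope.
Local Open Scope ring_scope.

(** * Smooth bump functions *)

(** The curls are only distributional and the transformed fields merely square integrable, so one
    field cannot directly serve as test field for the other. Two choices follow. Convergence of
    mollification rests on one quadratic quantity, the double integral of (a(x) - a(y))^2 against
    the kernel: it vanishes in the limit for indicators of open boxes, hence of measurable sets by
    Dynkin's theorem, hence for all of L^2. And a Laplace transform is handled through its pairings
    with fixed L^2 fields, so that the calculus in time concerns scalar functions only. The rate
    arises as follows. If c bounds the coefficients from below and N bounds the weighted fields at
    time T, the energy identity gives |Xe| + |Xm| <= 2 (|f| + e N) / (tau c). Here |f| =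
    O(tau^(-3/2)), the order of the integral of sqrt t exp(- tau t), and e = O(tau^(-2)) is smaller.
    As N does not depend on tau, multiplying by e N gives the remainder. *)

Section smooth_functions.
Context {R : realType}.
Implicit Types (f g : R -> R) (x : R).

(** The powers of [x^-1] make the family closed under differentiation: the derivative of [flat k] is
    a combination of [flat k.+2] and [flat k.+1]. *)
Definition flat (k : nat) (x : R) : R :=
  if 0 < x then x ^- k * expR (- x^-1) else 0.

Lemma flat_le0 k x : x <= 0 -> flat k x = 0.
Proof. by rewrite /flat leNgt => /negbTE ->. Qed.

Lemma flat_ge0 k x : 0 <= flat k x.
Proof.
rewrite /flat; case: ifPn => // x0.
by rewrite mulr_ge0 ?expR_ge0// invr_ge0 exprn_ge0// ltW.
Qed.

Lemma flat_gt0 k x : 0 < x -> 0 < flat k x.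
Proof.
by move=> x0; rewrite /flat x0 mulr_gt0 ?expR_gt0// invr_gt0 exprn_gt0.
Qed.

Lemma flatS k x : flat k.+1 x = x^-1 * flat k x.
Proof.
rewrite /flat; case: ifPn => _; last by rewrite mulr0.
by rewrite exprS invfM mulrA.
Qed.

(** The term of order [k.+1] in the exponential series at [x^-1] beats [x ^- k] with one factor [x]
    to spare; this linear bound makes the difference quotients at 0 vanish. *)
Lemma flat_le k x : 0 <= x -> flat k x <= k.+1`!%:R * x.
Proof.
rewrite le_eqVlt => /predU1P[<-|x0]; first by rewrite flat_le0// mulr0.
rewrite /flat x0 expRN ler_pdivrMr ?expR_gt0//.
have y0 : 0 <= x^-1 by rewrite invr_ge0 ltW.
have := expR_ge1Dxn k y0.
rewrite exprVn exprS invfM => H.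
have kf : 0 < k.+1`!%:R :> R by rewrite ltr0n fact_gt0.
rewrite -ler_pdivrMl ?mulr_gt0//.
apply: le_trans H; apply: ler_wpDl => //.
rewrite le_eqVlt; apply/orP; left; apply/eqP; rewrite invfM; ring.
Qed.

Lemma is_derive_flat k x :
  is_derive x 1 (flat k) (flat k.+2 x - k%:R * flat k.+1 x).
Proof.
have [x0|x0|x0] := ltgtP 0 x.
- have xn0 : x != 0 by rewrite gt_eqF.
  apply: (@near_eq_is_derive R R R (fun y : R => y ^- k * expR (- y^-1)) (flat k)).
    near=> y; rewrite /flat ifT//; near: y; exact: lt_nbhsr.
  have dV : is_derive x 1 (fun y : R => y^-1) (- x ^- 2).
    apply: is_derive_eq; first exact: (is_deriveV xn0 (is_derive_id x 1)).
    by rewrite /= scaler1.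
  have dX : is_derive x 1 (fun y : R => y ^- k) (- (k%:R * x ^- k.+1)).
    have -> : (fun y : R => y ^- k) = (fun y : R => y^-1) ^+ k.
      by apply/funext => y; rewrite -exprVn fctE.
    apply: (is_derive_eq (is_deriveX k dV)).
    rewrite /= scalerN; congr (- _); rewrite -[_ *: _]/(_ * _) -mulrA.
    case: k => [|k]; first by rewrite !mul0r.
    by rewrite /= exprVn -invfM -exprD addn2.
  have dE : is_derive x 1 (fun y : R => expR (- y^-1)) (expR (- x^-1) * x ^- 2).
    have -> : (fun y : R => expR (- y^-1)) = expR \o (- (fun y : R => y^-1)).
      by apply/funext => y; rewrite /= !fctE.
    apply: is_derive1_comp.
    by apply: (is_derive_eq (is_deriveN dV)); rewrite opprK.
  apply: (is_derive_eq (is_deriveM dX dE)).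
  rewrite /flat x0 /= -![_ *: _]/(_ * _).
  rewrite (exprS _ k.+1) (exprS _ k); field.
  by rewrite xn0 expf_neq0.
- have -> : flat k.+2 x - k%:R * flat k.+1 x = 0.
    by rewrite !flat_le0 ?ltW// mulr0 subrr.
  apply: (@near_eq_is_derive R R R (cst 0) (flat k)).
  near=> y; rewrite flat_le0// ltW//; near: y; exact: lt_nbhsl.
- rewrite -{x}x0 !flat_le0// mulr0 subrr.
  (* The difference quotient of [flat k] at 0 is [flat k.+1], which tends to 0 by [flat_le]. *)
  have H : h^-1 *: (flat k (h *: 1 + 0) - flat k 0) @[h --> 0^'] --> (0 : R).
    have -> : (fun h : R => h^-1 *: (flat k (h *: 1 + 0) - flat k 0)) = flat k.+1.
      apply/funext => h; rewrite (flat_le0 k (lexx 0)) subr0 addr0.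
      by rewrite flatS -[_ *: 1]/(_ * _) mulr1.
    apply: cvg_within_filter; apply/cvgr0Pnorm_le => e e0.
    near=> h; have [h0|h0] := leP h 0; first by rewrite flat_le0// normr0 ltW.
    rewrite ger0_norm ?flat_ge0//; apply: (le_trans (flat_le _ (ltW h0))).
    have kf : 0 < k.+2`!%:R :> R by rewrite ltr0n fact_gt0.
    rewrite -ler_pdivlMl// ltW//; near: h; apply: lt_nbhsl.
    by rewrite mulr_gt0 ?invr_gt0.
  split; first by apply/cvg_ex; exists 0.
  exact/cvg_lim.
Unshelve. all: by end_near. Qed.

(** Closure under a single differentiation yields all iterated derivatives by induction, without
    formulas for them. *)
Inductive smooth_class : (R -> R) -> Prop :=
| smooth_flat k : smooth_class (flat k)
| smooth_aff a c f : smooth_class f -> smooth_class (fun x => f (a * x + c))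
| smooth_scale a f : smooth_class f -> smooth_class (fun x => a * f x)
| smooth_add f g : smooth_class f -> smooth_class g ->
    smooth_class (fun x => f x + g x)
| smooth_mul f g : smooth_class f -> smooth_class g ->
    smooth_class (fun x => f x * g x)
| smooth_inv f : smooth_class f -> (forall x, f x != 0) ->
    smooth_class (fun x => (f x)^-1).

Lemma smooth_class_derive f : smooth_class f ->
  exists2 f', smooth_class f' & forall x, is_derive x 1 f (f' x).
Proof.
elim=> {f} [k|a c f _ [f' Sf' df]|a f _ [f' Sf' df]|f g _ [f' Sf' df] _ [g' Sg' dg]
  |f g Sf [f' Sf' df] Sg [g' Sg' dg]|f Sf [f' Sf' df] f0].
- exists (fun x => flat k.+2 x + (- k%:R) * flat k.+1 x).
    exact/(smooth_add (smooth_flat _))/smooth_scale/smooth_flat.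
  by move=> x; apply: (is_derive_eq (is_derive_flat k x)); rewrite mulNr.
- exists (fun x => a * f' (a * x + c)).
    exact/(smooth_scale a (f := fun x => f' (a * x + c)))/smooth_aff.
  move=> x; rewrite (_ : (fun x => _) = f \o (fun x => a * x + c))//.
  rewrite mulrC; apply: is_derive1_comp.
  rewrite (_ : (fun x => a * x + c) = (a \*: (id : R -> R)) + cst c); last first.
    by apply/funext => y.
  apply: is_derive_eq.
  by rewrite addr0 -[_ *: _]/(_ * _) mulr1.
- exists (fun x => a * f' x); first exact: smooth_scale.
  by move=> x; exact: (is_deriveZ a (df x)).
- exists (fun x => f' x + g' x); first exact: smooth_add.
  by move=> x; exact: (is_deriveD (df x) (dg x)).
- exists (fun x => f x * g' x + g x * f' x).
    by apply: smooth_add; exact: smooth_mul.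
  by move=> x; exact: (is_deriveM (df x) (dg x)).
- exists (fun x => (- 1) * ((f x)^-1 * (f x)^-1 * f' x)).
    apply/smooth_scale/smooth_mul => //; apply: smooth_mul; exact: smooth_inv.
  move=> x; apply: (is_derive_eq (is_deriveV (f0 x) (df x))).
  by rewrite -[_ *: _]/(_ * _) -invfM -expr2 mulN1r mulNr.
Qed.

Definition smooth1 f := forall n x, derivable (derive1n n f) x 1.

Lemma is_derive_derive1 f f' : (forall x, is_derive x 1 f (f' x)) ->
  f^`()%classic = f'.
Proof. by move=> df; apply/funext => x; rewrite derive1E derive_val. Qed.

Lemma smooth_class_smooth1 f : smooth_class f -> smooth1 f.
Proof.
move=> Sf n.
suff : smooth_class (derive1n n f).
  by case/smooth_class_derive => f' _ df x; exact: ex_derive.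
elim: n => [|n IH]; first by rewrite derive1n0.
rewrite derive1nS; have [f' Sf' df] := smooth_class_derive IH.
by rewrite (is_derive_derive1 df).
Qed.

Lemma smooth1_derive f : smooth1 f -> smooth1 f^`()%classic.
Proof. by move=> sf n x; rewrite -derive1Sn; exact: sf. Qed.

Lemma smooth1_derivable f x : smooth1 f -> derivable f x 1.
Proof. by move=> /(_ 0%N x); rewrite derive1n0. Qed.

Lemma smooth1_continuous f : smooth1 f -> continuous f.
Proof.
by move=> sf x; apply: differentiable_continuous; apply/derivable1_diffP;
  exact: smooth1_derivable.
Qed.

Lemma smooth1_primitive f f' : (forall x, is_derive x 1 f (f' x)) ->
  smooth1 f' -> smooth1 f.
Proof.
move=> df sf' [|n] x; first by rewrite derive1n0; exact: ex_derive.
by rewrite derive1Sn (is_derive_derive1 df); exact: sf'.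
Qed.

Definition step_den x := flat 0 (1 + x) + flat 0 (1 - x).

Definition step x := flat 0 (1 + x) / step_den x.

(** The derivative of [step], written out. Since [step] climbs from 0 to 1, the total mass is 1
    without a normalising constant, and the explicit form makes evenness visible. *)
Definition bump x :=
  (flat 2 (1 + x) * flat 0 (1 - x) + flat 0 (1 + x) * flat 2 (1 - x))
  / step_den x ^+ 2.

Lemma step_den_gt0 x : 0 < step_den x.
Proof.
rewrite /step_den; have [x1|x1] := leP x 0.
  by rewrite ltr_wpDl ?flat_ge0// flat_gt0//; lra.
by rewrite ltr_pwDl ?flat_ge0// flat_gt0//; lra.
Qed.

Lemma step_ge0 x : 0 <= step x.
Proof. by rewrite divr_ge0 ?flat_ge0// ltW// step_den_gt0. Qed.

Lemma step_le1 x : step x <= 1.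
Proof. by rewrite ler_pdivrMr ?step_den_gt0// mul1r lerDl flat_ge0. Qed.

Lemma step_left x : x <= -1 -> step x = 0.
Proof. by move=> x1; rewrite /step flat_le0 ?mul0r//; lra. Qed.

Lemma step_right x : 1 <= x -> step x = 1.
Proof.
move=> x1; have := step_den_gt0 x; rewrite /step /step_den.
by rewrite (@flat_le0 _ (1 - x)) ?addr0; [move=> ?; rewrite divff// gt_eqF|lra].
Qed.

Lemma bump_ge0 x : 0 <= bump x.
Proof.
by rewrite divr_ge0 ?addr_ge0 ?mulr_ge0 ?flat_ge0 ?exprn_ge0// ltW// step_den_gt0.
Qed.

Lemma bump_even x : bump (- x) = bump x.
Proof.
rewrite /bump /step_den opprK.
by rewrite addrC [in X in _ / X]addrC; congr (_ / _); rewrite mulrC [X in _ + X]mulrC.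
Qed.

Lemma bump_out x : 1 <= `|x| -> bump x = 0.
Proof.
rewrite ler_normr => /orP[x1|x1]; rewrite /bump.
  by rewrite !(@flat_le0 _ (1 - x)) ?mulr0 ?addr0 ?mul0r//; lra.
by rewrite !(@flat_le0 _ (1 + x)) ?mul0r ?addr0 ?mul0r//; lra.
Qed.

Let smooth_1Dx k : smooth_class (fun x => flat k (1 + x)).
Proof.
have -> : (fun x => flat k (1 + x)) = (fun x => flat k (1 * x + 1)).
  by apply/funext => x; rewrite mul1r addrC.
exact/smooth_aff/smooth_flat.
Qed.

Let smooth_1Bx k : smooth_class (fun x => flat k (1 - x)).
Proof.
have -> : (fun x => flat k (1 - x)) = (fun x => flat k (-1 * x + 1)).
  by apply/funext => x; rewrite mulN1r addrC.
exact/smooth_aff/smooth_flat.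
Qed.

Lemma smooth_bump : smooth_class bump.
Proof.
have sd : smooth_class (fun x => (step_den x)^-1).
  apply: smooth_inv; first exact: smooth_add.
  by move=> x; rewrite gt_eqF// step_den_gt0.
rewrite (_ : bump = fun x =>
  (flat 2 (1 + x) * flat 0 (1 - x) + flat 0 (1 + x) * flat 2 (1 - x))
  * ((step_den x)^-1 * (step_den x)^-1)).
  apply: smooth_mul; last exact: smooth_mul.
  by apply: smooth_add; apply: smooth_mul.
by apply/funext => x; rewrite /bump -invfM -expr2.
Qed.

Lemma is_derive_step x : is_derive x 1 step (bump x).
Proof.
have d1 : is_derive x 1 (fun y => flat 0 (1 + y)) (flat 2 (1 + x)).
  rewrite (_ : (fun x => _) = flat 0 \o (cst 1 + id)); last first.
    by apply/funext => y.
  apply: is_derive_eq; first apply: is_derive1_comp; first exact: is_derive_flat.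
  by rewrite add0r mulr1 mul0r subr0.
have d2 : is_derive x 1 (fun y => flat 0 (1 - y)) (- flat 2 (1 - x)).
  rewrite (_ : (fun x => _) = flat 0 \o (cst 1 - id)); last first.
    by apply/funext => y.
  apply: is_derive_eq; first apply: is_derive1_comp; first exact: is_derive_flat.
  by rewrite add0r mulrN1 mul0r subr0.
have d0 : step_den x != 0 by rewrite gt_eqF// step_den_gt0.
have dd := is_deriveV (f := step_den) d0 (is_deriveD d1 d2).
apply: (is_derive_eq (is_deriveM d1 dd)).
rewrite /= -![_ *: _]/(_ * _) /bump.
have E : step_den x = flat 0 (1 + x) + flat 0 (1 - x) by [].
by rewrite E in d0 *; field.
Qed.

Definition bumpn (n : nat) x := n.+1%:R * bump (n.+1%:R * x).

Lemma bumpn_ge0 n x : 0 <= bumpn n x.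
Proof. by rewrite mulr_ge0// bump_ge0. Qed.

Lemma bumpn_even n x : bumpn n (- x) = bumpn n x.
Proof. by rewrite /bumpn mulrN bump_even. Qed.

Lemma bumpn_out n x : n.+1%:R^-1 <= `|x| -> bumpn n x = 0.
Proof.
move=> nx; rewrite /bumpn bump_out ?mulr0// normrM ger0_norm//.
by rewrite -ler_pdivrMl// mulr1.
Qed.

Lemma smooth_bumpn n : smooth_class (bumpn n).
Proof.
rewrite (_ : bumpn n = fun x => n.+1%:R * bump (n.+1%:R * x + 0)); last first.
  by apply/funext => x; rewrite addr0.
exact/(smooth_scale n.+1%:R (f := fun x => bump (n.+1%:R * x + 0)))
  /smooth_aff/smooth_bump.
Qed.

Lemma is_derive_stepn n c x :
  is_derive x 1 (fun y => step (n.+1%:R * (y - c))) (bumpn n (x - c)).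
Proof.
rewrite (_ : (fun x => _) = step \o (n.+1%:R \*: ((id : R -> R) - cst c))); last first.
  by apply/funext => y.
apply: is_derive_eq; first apply: is_derive1_comp; first exact: is_derive_step.
by rewrite subr0 -[_ *: _]/(_ * _) mulr1 mulrC.
Qed.

End smooth_functions.

(** * Tensor-product test fields and their curl *)

Section tensor_fields.
Context {R : realType}.
Implicit Types (k : 'I_3 -> R -> R) (x y : R3 R) (i j : 'I_3).

Definition tens k x : R := k 0 x.1.1 * k 1 x.1.2 * k 2%:R x.2.

Definition tens_upd k i j : R -> R := if j == i then (k j)^`()%classic else k j.

Lemma is_derive_tens k i x : (forall j, smooth1 (k j)) ->
  is_derive x (basis3 R i) (tens k) (tens (tens_upd k i) x).
Proof.
move=> sk.
have dk j (s : R) : h^-1 *: (k j (h *: 1 + s) - k j s) @[h --> 0^'] --> (k j)^`()%classic s.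
  by rewrite derive1E; exact: smooth1_derivable.
suff H : h^-1 *: (tens k (h *: basis3 R i + x) - tens k x) @[h --> 0^']
    --> tens (tens_upd k i) x.
  split; first by apply/cvg_ex; eexists; exact: H.
  exact/cvg_lim.
have h1 (h : R) : h *: 1 = h by rewrite -[LHS]/(h * 1) mulr1.
case: i => [[|[|[|//]]] i3].
- have -> : tens (tens_upd k (Ordinal i3)) x =
      (k 0)^`()%classic x.1.1 * (k 1 x.1.2 * k 2%:R x.2).
    by rewrite /tens /tens_upd /= mulrA.
  have -> : (fun h : R => h^-1 *: (tens k (h *: basis3 R (Ordinal i3) + x) - tens k x)) =
      (fun h : R => h^-1 *: (k 0 (h *: 1 + x.1.1) - k 0 x.1.1) * (k 1 x.1.2 * k 2%:R x.2)).
    apply/funext => h; rewrite /tens /= !scaler0 !add0r -![_ *: (_ - _)]/(_ * _).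
    by ring.
  by apply: cvgMl; exact: dk.
- have -> : tens (tens_upd k (Ordinal i3)) x =
      (k 1)^`()%classic x.1.2 * (k 0 x.1.1 * k 2%:R x.2).
    by rewrite /tens /tens_upd /=; ring.
  have -> : (fun h : R => h^-1 *: (tens k (h *: basis3 R (Ordinal i3) + x) - tens k x)) =
      (fun h : R => h^-1 *: (k 1 (h *: 1 + x.1.2) - k 1 x.1.2) * (k 0 x.1.1 * k 2%:R x.2)).
    apply/funext => h; rewrite /tens /= !scaler0 !add0r -![_ *: (_ - _)]/(_ * _).
    by ring.
  by apply: cvgMl; exact: dk.
- have -> : tens (tens_upd k (Ordinal i3)) x =
      (k 2%:R)^`()%classic x.2 * (k 0 x.1.1 * k 1 x.1.2).
    by rewrite /tens /tens_upd /=; ring.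
  have -> : (fun h : R => h^-1 *: (tens k (h *: basis3 R (Ordinal i3) + x) - tens k x)) =
      (fun h : R => h^-1 *: (k 2%:R (h *: 1 + x.2) - k 2%:R x.2) * (k 0 x.1.1 * k 1 x.1.2)).
    apply/funext => h; rewrite /tens /= !scaler0 !add0r -![_ *: (_ - _)]/(_ * _).
    by ring.
  by apply: cvgMl; exact: dk.
Qed.

Lemma smooth1_tens_upd k i : (forall j, smooth1 (k j)) ->
  forall j, smooth1 (tens_upd k i j).
Proof.
by move=> sk j; rewrite /tens_upd; case: ifP => _ //; exact: smooth1_derive.
Qed.

Lemma is_derive_tensZ k i x c : (forall j, smooth1 (k j)) ->
  is_derive x (basis3 R i) (fun y => tens k y * c) (tens (tens_upd k i) x * c).
Proof.
move=> sk; have := is_deriveZ c (is_derive_tens i x sk).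
by rewrite (_ : (c \*: tens k) = fun y => tens k y * c);
  [rewrite -[c *: _]/(c * _) mulrC|apply/funext => y; exact: mulrC].
Qed.

Lemma pderiv_tensZ k i c : (forall j, smooth1 (k j)) ->
  pderiv i (fun y => tens k y * c) = fun x => tens (tens_upd k i) x * c.
Proof.
by move=> sk; apply/funext => x; rewrite /pderiv; have d := is_derive_tensZ i x c sk;
  rewrite derive_val.
Qed.

Lemma continuous_tens k : (forall j, continuous (k j)) -> continuous (tens k).
Proof.
move=> ck x; apply: cvgM; [apply: cvgM|].
- apply: (@continuous_comp _ _ _ (fun x : R3 R => x.1.1) (k 0)); last exact: ck.
  by apply: (@continuous_comp _ _ _ fst fst); exact: cvg_fst.
- apply: (@continuous_comp _ _ _ (fun x : R3 R => x.1.2) (k 1)); last exact: ck.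
  by apply: (@continuous_comp _ _ _ fst snd); [exact: cvg_fst|exact: cvg_snd].
- apply: (@continuous_comp _ _ _ snd (k 2%:R)); last exact: ck.
  exact: cvg_snd.
Qed.

(** A partial derivative acts on a single factor, so products of smooth factors are stable under any
    sequence of partial derivatives. *)
Lemma smooth3_tensZ k c : (forall j, smooth1 (k j)) ->
  smooth3 (fun y => tens k y * c).
Proof.
move=> sk s /=.
suff [k' sk' ->] : exists2 k', (forall j, smooth1 (k' j)) &
    foldr (@pderiv R) (fun y => tens k y * c) s = fun y => tens k' y * c.
  split; last by move=> i x; exact: (@ex_derive _ _ _ _ _ _ _ (is_derive_tensZ i x c sk')).
  move=> x; apply: cvgMl; apply: continuous_tens => j.
  exact: smooth1_continuous.
elim: s => [|i s [k' sk' /= ->]]; first by exists k.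
exists (tens_upd k' i); first exact: smooth1_tens_upd.
exact: pderiv_tensZ.
Qed.

Lemma test_field_tens k (w : 'rV[R]_3) (M : R) : (forall j, smooth1 (k j)) ->
  (forall j s, M <= `|s| -> k j s = 0) -> test_field (fun x => tens k x *: w).
Proof.
move=> sk k0; split.
  move=> i; rewrite (_ : (fun x => _) = fun x => tens k x * w ord0 i).
    exact: smooth3_tensZ.
  by apply/funext => x; rewrite mxE.
exists ((`[-M, M] `*` `[-M, M]) `*` `[-M, M])%classic; split.
  by apply: compact_setX; [apply: compact_setX|]; exact: segment_compact.
move=> x xM; rewrite /tens.
have [/(k0 0) ->|x1] := leP M `|x.1.1|; first by rewrite !mul0r scale0r.
have [/(k0 1) ->|x2] := leP M `|x.1.2|; first by rewrite mulr0 mul0r scale0r.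
have [/(k0 2%:R) ->|x3] := leP M `|x.2|; first by rewrite mulr0 scale0r.
exfalso; apply: xM; split => /=; last first.
  by rewrite in_itv/= -ler_norml ltW.
by split => /=; rewrite in_itv/= -ler_norml ltW.
Qed.

Definition cross (u v : 'rV[R]_3) : 'rV[R]_3 :=
  \row_(i < 3) (u ord0 (i + 1) * v ord0 (i + 2%:R) - u ord0 (i + 2%:R) * v ord0 (i + 1)).

Definition tens_grad k x : 'rV[R]_3 := \row_i tens (tens_upd k i) x.

Lemma curl_tens k (w : 'rV[R]_3) : (forall j, smooth1 (k j)) ->
  curl (fun x => tens k x *: w) = fun x => cross (tens_grad k x) w.
Proof.
move=> sk; apply/funext => x; apply/rowP => i; rewrite !mxE.
have E j l : pderiv j (fun y => (tens k y *: w) ord0 l) x =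
    tens (tens_upd k j) x * w ord0 l.
  rewrite (_ : (fun y => _) = fun y => tens k y * w ord0 l).
    by rewrite pderiv_tensZ.
  by apply/funext => y; rewrite mxE.
by rewrite !E.
Qed.

Lemma dot_crossC (u v g : 'rV[R]_3) : dot u (cross g v) = - dot v (cross g u).
Proof.
rewrite /dot !big_ord_recl !big_ord0 !mxE /=.
rewrite (_ : lift ord0 (ord0 : 'I_2) = 1); last exact/val_inj.
rewrite (_ : lift ord0 (lift ord0 (ord0 : 'I_1)) = 2%:R); last exact/val_inj.
rewrite (_ : ord0 + 1 = 1); last exact/val_inj.
rewrite (_ : ord0 + 2%:R = 2%:R); last exact/val_inj.
rewrite (_ : 1 + 1 = 2%:R); last exact/val_inj.
rewrite (_ : 1 + 2%:R = ord0); last exact/val_inj.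
rewrite (_ : 2%:R + 1 = ord0); last exact/val_inj.
rewrite (_ : 2%:R + 2%:R = 1); last exact/val_inj.
by ring.
Qed.

End tensor_fields.

(** * Mollification in L2 *)

Section square_integrable.
Context {d : measure_display} {T : measurableType d} {R : realType}.
Variable m : {measure set T -> \bar R}.
Implicit Types (f g : T -> R).

Definition sqint f :=
  measurable_fun setT f /\ (\int[m]_x (f x ^+ 2)%:E < +oo)%E.

Lemma measurable_EFin_sq f : measurable_fun setT f ->
  measurable_fun setT (fun x => (f x ^+ 2)%:E).
Proof. by move=> mf; apply/measurable_EFinP; exact: measurable_funX. Qed.

Lemma sqint_integrable f : sqint f -> m.-integrable setT (fun x => (f x ^+ 2)%:E).
Proof.
move=> [mf foo]; apply/integrableP; split; first exact: measurable_EFin_sq.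
by under eq_integral do rewrite gee0_abs ?lee_fin ?sqr_ge0//.
Qed.

Lemma sqintM_integrable f g : sqint f -> sqint g ->
  m.-integrable setT (fun x => (f x * g x)%:E).
Proof.
move=> sf sg; have [mf _] := sf; have [mg _] := sg.
apply: (le_integrable _ _ _ (integrableD _ (sqint_integrable sf) (sqint_integrable sg))) => //.
  by apply/measurable_EFinP; exact: measurable_funM.
move=> x _; rewrite /= lee_fin normrM.
rewrite [leRHS]ger0_norm ?addr_ge0 ?sqr_ge0//.
rewrite -(real_normK (num_real (f x))) -(real_normK (num_real (g x))).
have := sqr_ge0 (`|f x| - `|g x|); have := normr_ge0 (f x); have := normr_ge0 (g x).
nra.
Qed.

Lemma le_sqint f g : measurable_fun setT f -> sqint g ->
  (forall x, `|f x| <= `|g x|) -> sqint f.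
Proof.
move=> mf [mg goo] fg; split => //; apply: le_lt_trans goo.
apply: ge0_le_integral => //.
- by move=> x _; rewrite lee_fin sqr_ge0.
- exact: measurable_EFin_sq.
- exact: measurable_EFin_sq.
- move=> x _; rewrite lee_fin -(real_normK (num_real (f x))).
  rewrite -(real_normK (num_real (g x))).
  by rewrite lerXn2r// ?nnegrE.
Qed.

Lemma sqintZ c f : sqint f -> sqint (fun x => c * f x).
Proof.
move=> [mf foo]; split; first exact: measurable_funM.
under eq_integral do rewrite exprMn EFinM.
rewrite ge0_integralZl//.
- by rewrite lte_mul_pinfty// lee_fin sqr_ge0.
- exact: measurable_EFin_sq.
- by move=> x _; rewrite lee_fin sqr_ge0.
- by rewrite lee_fin sqr_ge0.
Qed.

Lemma sqintD f g : sqint f -> sqint g -> sqint (fun x => f x + g x).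
Proof.
move=> sf sg; have [mf _] := sf; have [mg _] := sg.
have mfg : measurable_fun setT (fun x => f x + g x) by exact: measurable_funD.
split => //.
have := integrableD measurableT (integrableZl measurableT 2 (sqint_integrable sf))
  (integrableZl measurableT 2 (sqint_integrable sg)).
move=> /integrableP[_]; apply: le_lt_trans.
apply: ge0_le_integral => //.
- by move=> x _; rewrite lee_fin sqr_ge0.
- exact: measurable_EFin_sq.
- apply: measurableT_comp => //; apply: emeasurable_funD;
    apply: measurable_funeM; exact: measurable_EFin_sq.
- move=> x _; rewrite /= lee_fin; apply: le_trans (ler_norm _).
  by have := sqr_ge0 (f x - g x); nra.
Qed.

Lemma sqintB f g : sqint f -> sqint g -> sqint (fun x => f x - g x).
Proof.
move=> sf sg; have := sqintD sf (sqintZ (-1) sg).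
by under [X in sqint X -> _]eq_fun do rewrite mulN1r.
Qed.

End square_integrable.

(** * Integral kernels with bounded marginals *)

Section schur_kernels.
Context {d : measure_display} {T : measurableType d} {R : realType}.
Variable m : {sigma_finite_measure set T -> \bar R}.
Implicit Types (a g : T -> R) (r : T * T -> R).

(** The hypothesis of Schur's test: both families of sections of a nonnegative kernel have mass at
    most [C]. *)
Definition marginals_le r (C : R) :=
  [/\ measurable_fun setT r, forall z, 0 <= r z,
      forall x, (\int[m]_y (r (x, y))%:E <= C%:E)%E &
      forall y, (\int[m]_x (r (x, y))%:E <= C%:E)%E].

Let measurable_a1 a r : measurable_fun setT a -> measurable_fun setT r ->
  measurable_fun setT (fun z => (a z.1 ^+ 2 * r z)%:E).
Proof.
move=> ma mr; apply/measurable_EFinP; apply: measurable_funM => //.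
by apply: measurable_funX; exact: measurableT_comp ma measurable_fst.
Qed.

Let measurable_a2 a r : measurable_fun setT a -> measurable_fun setT r ->
  measurable_fun setT (fun z => (a z.2 ^+ 2 * r z)%:E).
Proof.
move=> ma mr; apply/measurable_EFinP; apply: measurable_funM => //.
by apply: measurable_funX; exact: measurableT_comp ma measurable_snd.
Qed.

Lemma integral_sq1_le a r C : measurable_fun setT a -> marginals_le r C ->
  (\int[m \x m]_z (a z.1 ^+ 2 * r z)%:E <= C%:E * \int[m]_x (a x ^+ 2)%:E)%E.
Proof.
move=> ma [mr r0 r1 _].
have f0 z : (0 <= (a z.1 ^+ 2 * r z)%:E)%E by rewrite lee_fin mulr_ge0 ?sqr_ge0.
rewrite fubini_tonelli1//; last exact: measurable_a1.
have C0 : (0 <= C%:E)%E.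
  have := r1 point; apply: le_trans; apply: integral_ge0 => y _.
  by rewrite lee_fin.
rewrite -ge0_integralZl//; last 2 first.
- exact: measurable_EFin_sq.
- by move=> x _; rewrite lee_fin sqr_ge0.
apply: ge0_le_integral => //.
- by move=> x _; apply: integral_ge0.
- by apply: measurable_fun_fubini_tonelli_F => //; exact: measurable_a1.
- by apply: measurable_funeM; exact: measurable_EFin_sq.
- move=> x _; rewrite /fubini_F /=.
  under eq_integral do rewrite EFinM.
  rewrite ge0_integralZl//; last 3 first.
  + by apply/measurable_EFinP; exact: measurableT_comp mr (measurable_pair1 x).
  + by move=> y _; rewrite lee_fin.
  + by rewrite lee_fin sqr_ge0.
  by rewrite muleC lee_wpmul2r// lee_fin sqr_ge0.
Qed.

Lemma integral_sq2_le a r C : measurable_fun setT a -> marginals_le r C ->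
  (\int[m \x m]_z (a z.2 ^+ 2 * r z)%:E <= C%:E * \int[m]_x (a x ^+ 2)%:E)%E.
Proof.
move=> ma [mr r0 _ r2].
have f0 z : (0 <= (a z.2 ^+ 2 * r z)%:E)%E by rewrite lee_fin mulr_ge0 ?sqr_ge0.
rewrite fubini_tonelli2//; last exact: measurable_a2.
have C0 : (0 <= C%:E)%E.
  have := r2 point; apply: le_trans; apply: integral_ge0 => y _.
  by rewrite lee_fin.
rewrite -ge0_integralZl//; last 2 first.
- exact: measurable_EFin_sq.
- by move=> x _; rewrite lee_fin sqr_ge0.
apply: ge0_le_integral => //.
- by move=> x _; apply: integral_ge0.
- by apply: measurable_fun_fubini_tonelli_G => //; exact: measurable_a2.
- by apply: measurable_funeM; exact: measurable_EFin_sq.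
- move=> x _; rewrite /fubini_G /=.
  under eq_integral do rewrite EFinM.
  rewrite ge0_integralZl//; last 3 first.
  + by apply/measurable_EFinP; exact: measurableT_comp mr (measurable_pair2 x).
  + by move=> y _; rewrite lee_fin.
  + by rewrite lee_fin sqr_ge0.
  by rewrite muleC lee_wpmul2r// lee_fin sqr_ge0.
Qed.

Lemma integrable_sq1 a r C : sqint m a -> marginals_le r C ->
  (m \x m)%E.-integrable setT (fun z => (a z.1 ^+ 2 * r z)%:E).
Proof.
move=> [ma aoo] rC; have [mr r0 _ _] := rC; apply/integrableP; split.
  exact: measurable_a1.
rewrite (eq_integral (fun z => (a z.1 ^+ 2 * r z)%:E)); last first.
  by move=> z _; rewrite gee0_abs// lee_fin mulr_ge0 ?sqr_ge0.
apply: (le_lt_trans (integral_sq1_le ma rC)).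
rewrite lte_mul_pinfty//; have [_ _ + _] := rC => /(_ point).
by apply: le_trans; apply: integral_ge0 => y _; rewrite lee_fin.
Qed.

Lemma integrable_sq2 a r C : sqint m a -> marginals_le r C ->
  (m \x m)%E.-integrable setT (fun z => (a z.2 ^+ 2 * r z)%:E).
Proof.
move=> [ma aoo] rC; have [mr r0 _ _] := rC; apply/integrableP; split.
  exact: measurable_a2.
rewrite (eq_integral (fun z => (a z.2 ^+ 2 * r z)%:E)); last first.
  by move=> z _; rewrite gee0_abs// lee_fin mulr_ge0 ?sqr_ge0.
apply: (le_lt_trans (integral_sq2_le ma rC)).
rewrite lte_mul_pinfty//; have [_ _ + _] := rC => /(_ point).
by apply: le_trans; apply: integral_ge0 => y _; rewrite lee_fin.
Qed.

(** The product [|a g|] is at most [a ^+ 2 + g ^+ 2]; each square depends on one variable, and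
    integrating the kernel in the other one first costs only the factor [C]. *)
Lemma integrable_kernel a g r (k : T * T -> R) C : sqint m a -> sqint m g ->
  marginals_le r C -> measurable_fun setT k -> (forall z, `|k z| <= r z) ->
  (m \x m)%E.-integrable setT (fun z => (a z.1 * g z.2 * k z)%:E).
Proof.
move=> sa sg rC mk kr; have [ma _] := sa; have [mg _] := sg.
apply: (le_integrable _ _ _
  (integrableD measurableT (integrable_sq1 sa rC) (integrable_sq2 sg rC))) => //.
  apply/measurable_EFinP; apply: measurable_funM => //; apply: measurable_funM.
    exact: measurableT_comp ma measurable_fst.
  exact: measurableT_comp mg measurable_snd.
move=> z _; rewrite /= lee_fin; apply: le_trans (ler_norm _).
rewrite -mulrDl !normrM; apply: ler_pM => //.
rewrite -(real_normK (num_real (a z.1))) -(real_normK (num_real (g z.2))).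
have := sqr_ge0 (`|a z.1| - `|g z.2|).
have := normr_ge0 (a z.1); have := normr_ge0 (g z.2); nra.
Qed.

(** This quadratic form controls the mollification error: once it vanishes for [a], [cvg_kernel]
    gives the convergence against every square integrable [g]. *)
Definition oscillation r a : \bar R :=
  (\int[m \x m]_z ((a z.1 - a z.2) ^+ 2 * r z)%:E)%E.

Let measurable_osc a r : measurable_fun setT a -> measurable_fun setT r ->
  measurable_fun setT (fun z => ((a z.1 - a z.2) ^+ 2 * r z)%:E).
Proof.
move=> ma mr; apply/measurable_EFinP; apply: measurable_funM => //.
apply: measurable_funX; apply: measurable_funB.
  exact: measurableT_comp ma measurable_fst.
exact: measurableT_comp ma measurable_snd.
Qed.

Lemma oscillation_ge0 r a : (forall z, 0 <= r z) -> (0 <= oscillation r a)%E.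
Proof.
by move=> r0; apply: integral_ge0 => z _; rewrite lee_fin mulr_ge0 ?sqr_ge0.
Qed.

Lemma oscillationD r a b : measurable_fun setT r -> (forall z, 0 <= r z) ->
  measurable_fun setT a -> measurable_fun setT b ->
  (oscillation r (fun x => a x + b x)%R <=
   2%:E * oscillation r a + 2%:E * oscillation r b)%E.
Proof.
move=> mr r0 ma mb; rewrite /oscillation.
have f0 c z : (0 <= ((c z.1 - c z.2) ^+ 2 * r z)%:E)%E.
  by rewrite lee_fin mulr_ge0 ?sqr_ge0.
rewrite -!ge0_integralZl//; [|exact: measurable_osc..].
rewrite -ge0_integralD//; last 4 first.
- by move=> z _; apply: mule_ge0.
- by apply: measurable_funeM; exact: measurable_osc.
- by move=> z _; apply: mule_ge0.
- by apply: measurable_funeM; exact: measurable_osc.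
apply: ge0_le_integral => //.
- by move=> z _; rewrite lee_fin mulr_ge0 ?sqr_ge0.
- by apply: (@measurable_osc (fun x => a x + b x)) => //; exact: measurable_funD.
- apply: emeasurable_funD; apply: measurable_funeM; exact: measurable_osc.
- move=> z _; rewrite -!EFinM -EFinD lee_fin !mulrA -mulrDl ler_wpM2r//.
  by have := sqr_ge0 ((a z.1 - a z.2) - (b z.1 - b z.2)); nra.
Qed.

Lemma oscillationZ r c a : measurable_fun setT r -> (forall z, 0 <= r z) ->
  measurable_fun setT a ->
  oscillation r (fun x => c * a x) = ((c ^+ 2)%:E * oscillation r a)%E.
Proof.
move=> mr r0 ma; rewrite /oscillation -ge0_integralZl//.
- by apply: eq_integral => z _; rewrite -EFinM; congr EFin; ring.
- exact: measurable_osc.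
- by move=> z _; rewrite lee_fin mulr_ge0 ?sqr_ge0.
- by rewrite lee_fin sqr_ge0.
Qed.

Lemma oscillation_le r a : marginals_le r 1 -> measurable_fun setT a ->
  (oscillation r a <= 4%:E * \int[m]_x (a x ^+ 2)%:E)%E.
Proof.
move=> rC ma; have [mr r0 _ _] := rC.
have a0 : (0 <= \int[m]_x (a x ^+ 2)%:E)%E.
  by apply: integral_ge0 => x _; rewrite lee_fin sqr_ge0.
have := leeD (integral_sq1_le ma rC) (integral_sq2_le ma rC).
rewrite !mul1e => H.
apply: (@le_trans _ _ (2%:E * (\int[m \x m]_z (a z.1 ^+ 2 * r z)%:E +
  \int[m \x m]_z (a z.2 ^+ 2 * r z)%:E))%E); last first.
  rewrite (_ : 4 = 2 * 2)%R; last by ring.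
  rewrite EFinM -muleA lee_wpmul2l//; apply: (le_trans H).
  by rewrite mule_natl mule2n.
have f1 z : (0 <= (a z.1 ^+ 2 * r z)%:E)%E by rewrite lee_fin mulr_ge0 ?sqr_ge0.
have f2 z : (0 <= (a z.2 ^+ 2 * r z)%:E)%E by rewrite lee_fin mulr_ge0 ?sqr_ge0.
rewrite -ge0_integralD//; [|exact: measurable_a1|exact: measurable_a2].
rewrite -ge0_integralZl//; last 2 first.
- by apply: emeasurable_funD; [exact: measurable_a1|exact: measurable_a2].
- by move=> z _; exact: adde_ge0.
apply: ge0_le_integral => //.
- by move=> z _; rewrite lee_fin mulr_ge0 ?sqr_ge0.
- exact: measurable_osc.
- apply: measurable_funeM.
  by apply: emeasurable_funD; [exact: measurable_a1|exact: measurable_a2].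
- move=> z _; rewrite -EFinD -EFinM lee_fin -mulrDl mulrA ler_wpM2r//.
  by have := sqr_ge0 (a z.1 + a z.2); nra.
Qed.

(** Functions of vanishing oscillation form a closed set in L^2, because [oscillation_le] bounds the
    oscillation by the squared norm uniformly in the kernel. *)
Lemma cvg_oscillation_closure (r : nat -> T * T -> R) a :
  (forall n, marginals_le (r n) 1) -> measurable_fun setT a ->
  (forall e : R, 0 < e -> exists b, [/\ measurable_fun setT b,
     oscillation (r n) b @[n --> \oo] --> 0%E &
     (\int[m]_x ((a x - b x) ^+ 2)%:E <= e%:E)%E]) ->
  oscillation (r n) a @[n --> \oo] --> 0%E.
Proof.
move=> rC ma H.
suff K (e : R) : 0 < e -> \forall n \near \oo, (oscillation (r n) a <= e%:E)%E.
  have fo : \forall n \near \oo, oscillation (r n) a \is a fin_num.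
    have := K 1 ltr01; apply: filterS => n Hn.
    rewrite ge0_fin_numE; first exact: le_lt_trans Hn (ltry _).
    by apply: oscillation_ge0; have [] := rC n.
  apply/fine_cvgP; split => //; apply/cvgr0Pnorm_le => e e0.
  near=> n; rewrite /= ger0_norm ?fine_ge0//; last first.
    by apply: oscillation_ge0; have [] := rC n.
  rewrite -lee_fin fineK; last by near: n.
  by near: n; exact: K.
(* The factor 2 of [oscillationD] and 4 of [oscillation_le] turn [e / 16] into [e / 2]; the
   oscillation of [b] only meets the factor 2, hence [e / 4] below. *)
move=> e0; have e16 : 0 < e / 16 by rewrite divr_gt0.
have [b [mb cb ab]] := H _ e16.
have /fine_cvgP[fb /cvgr0Pnorm_le/(_ (e / 4))] := cb.
move=> /(_ _)[|N _ HN]; first by rewrite divr_gt0.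
near=> n; have [mr r0 _ _] := rC n.
have -> : a = (fun x => (a x - b x) + b x) by apply/funext => x; rewrite subrK.
have mab : measurable_fun setT (fun x => a x - b x) by exact: measurable_funB.
apply: (le_trans (oscillationD mr r0 mab mb)).
have -> : e%:E = ((e / 2)%:E + (e / 2)%:E)%E by rewrite -EFinD -splitr.
apply: leeD.
  apply: (@le_trans _ _ (2%:E * (4%:E * (e / 16)%:E))%E).
    rewrite lee_wpmul2l//; apply: (le_trans (oscillation_le (rC n) mab)).
    by rewrite lee_wpmul2l.
  by rewrite -!EFinM lee_fin; lra.
have fbn : oscillation (r n) b \is a fin_num by near: n.
rewrite -(fineK fbn) -EFinM lee_fin.
have : `|fine (oscillation (r n) b)| <= e / 4.
  by apply: HN; near: n; exists N.
by move=> /ler_normlW; lra.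
Unshelve. all: by end_near. Qed.

Definition marginals_eq1 r :=
  [/\ measurable_fun setT r, forall z, 0 <= r z,
      forall x, (\int[m]_y (r (x, y))%:E = 1)%E &
      forall y, (\int[m]_x (r (x, y))%:E = 1)%E].

Lemma marginals_eq1_le r : marginals_eq1 r -> marginals_le r 1.
Proof. by move=> [mr r0 r1 r2]; split => // ?; rewrite ?r1 ?r2. Qed.

(** Because the marginals are 1, the limit is itself the double integral of [a z.2 * g z.2] against
    the kernel. The difference then contains [a z.1 - a z.2], and a weighted Young inequality
    separates the oscillation of [a] from the norm of [g]. *)
Lemma cvg_kernel (r : nat -> T * T -> R) a g :
  (forall n, marginals_eq1 (r n)) -> sqint m a -> sqint m g ->
  oscillation (r n) a @[n --> \oo] --> 0%E ->
  \int[(m \x m)%E]_z (a z.1 * g z.2 * r n z) @[n --> \oo] -->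
  \int[m]_x (a x * g x).
Proof.
move=> r1 sa sg osc; have [ma _] := sa; have [mg goo] := sg.
have rC n := marginals_eq1_le (r1 n).
pose G := fine (\int[m]_x (g x ^+ 2)%:E).
have GE : (G%:E = \int[m]_x (g x ^+ 2)%:E)%E.
  rewrite fineK// ge0_fin_numE// integral_ge0// => x _.
  by rewrite lee_fin sqr_ge0.
have G0 : 0 <= G.
  by rewrite fine_ge0// integral_ge0// => x _; rewrite lee_fin sqr_ge0.
apply/cvgrPdist_le => e e0.
(* With this Young weight both halves are at most [e / 2]: [l / 2] times an oscillation at most
   [e / l], and [G / (2 l)]. Adding 1 keeps [l] positive when [G] is 0. *)
pose l := (G + 1) / e.
have l0 : 0 < l by rewrite divr_gt0// ltr_wpDl.
have /fine_cvgP[fo /cvgr0Pnorm_le/(_ (e / l))] := osc.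
move=> /(_ _)[|N _ HN]; first by rewrite divr_gt0.
near=> n; have [mr r0 rx ry] := r1 n.
have rabs z : `|r n z| <= r n z by rewrite ger0_norm.
have i1 := integrable_kernel sa sg (rC n) mr rabs.
have fon : oscillation (r n) a \is a fin_num by near: n.
have oscn : fine (oscillation (r n) a) <= e / l.
  have : `|fine (oscillation (r n) a)| <= e / l by apply: HN; near: n; exists N.
  exact: ler_normlW.
have mz2 : measurable_fun setT (fun z : T * T => a z.2 * g z.2 * r n z).
  apply: measurable_funM => //; apply: measurable_funM.
    exact: measurableT_comp ma measurable_snd.
  exact: measurableT_comp mg measurable_snd.
have i2 : (m \x m)%E.-integrable setT (fun z => (a z.2 * g z.2 * r n z)%:E).
  apply: (le_integrable _ _ _
    (integrableD measurableT (integrable_sq2 sa (rC n)) (integrable_sq2 sg (rC n)))) => //.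
    exact/measurable_EFinP.
  move=> z _; rewrite /= lee_fin; apply: le_trans (ler_norm _).
  rewrite -mulrDl !normrM; apply: ler_pM => //.
  rewrite -(real_normK (num_real (a z.2))) -(real_normK (num_real (g z.2))).
  have := sqr_ge0 (`|a z.2| - `|g z.2|).
  have := normr_ge0 (a z.2); have := normr_ge0 (g z.2); nra.
have E2 : \int[m]_x (a x * g x) = \int[(m \x m)%E]_z (a z.2 * g z.2 * r n z).
  rewrite /Rintegral; congr fine; rewrite -(integral21_prod_meas1 i2).
  apply: eq_integral => y _; rewrite /fubini_G /=.
  under eq_integral do rewrite EFinM.
  rewrite integralZl//; first by rewrite ry mule1.
  apply/integrableP; split.
    by apply/measurable_EFinP; exact: measurableT_comp mr (measurable_pair2 y).
  by under eq_integral do rewrite gee0_abs ?lee_fin//; rewrite ry ltry.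
rewrite E2 -RintegralB//.
have io : (m \x m)%E.-integrable setT
    (fun z => ((a z.1 - a z.2) ^+ 2 * r n z)%:E).
  apply/integrableP; split; first exact: measurable_osc.
  rewrite (eq_integral (fun z => ((a z.1 - a z.2) ^+ 2 * r n z)%:E)); last first.
    by move=> z _; rewrite gee0_abs// lee_fin mulr_ge0 ?sqr_ge0.
  by rewrite -/(oscillation (r n) a) -ge0_fin_numE// oscillation_ge0.
have ig := integrable_sq2 sg (rC n).
have Gn : \int[(m \x m)%E]_z (g z.2 ^+ 2 * r n z) <= G.
  rewrite -lee_fin /Rintegral fineK.
    by rewrite GE; have := integral_sq2_le mg (rC n); rewrite mul1e.
  exact: integrable_fin_num.
have idiff : (m \x m)%E.-integrable setT
    (EFin \o (fun z => a z.2 * g z.2 * r n z - a z.1 * g z.2 * r n z)).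
  exact: (integrableB measurableT i2 i1).
have iR : (m \x m)%E.-integrable setT (EFin \o (fun z =>
    (l / 2) * ((a z.1 - a z.2) ^+ 2 * r n z) + (l^-1 / 2) * (g z.2 ^+ 2 * r n z))).
  exact: (integrableD measurableT (integrableZl measurableT _ io)
    (integrableZl measurableT _ ig)).
apply: (le_trans (le_normr_Rintegral _ _)) => //.
apply: (@le_trans _ _ (\int[(m \x m)%E]_z (
    (l / 2) * ((a z.1 - a z.2) ^+ 2 * r n z) + (l^-1 / 2) * (g z.2 ^+ 2 * r n z)))).
  apply: le_Rintegral => //.
    exact: (integrable_norm idiff).
  move=> z _; rewrite -mulrBl -mulrBl normrM (ger0_norm (r0 z)).
  rewrite !mulrA -mulrDl ler_wpM2r//.
  set A := a z.1 - a z.2; set B := g z.2.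
  have -> : `|(a z.2 - a z.1) * B| = `|A * B| by rewrite -normrN -mulNr opprB.
  have P : 0 <= (l / 2) * A ^+ 2 + (l^-1 / 2) * B ^+ 2 + A * B.
    have -> : (l / 2) * A ^+ 2 + (l^-1 / 2) * B ^+ 2 + A * B =
        (l / 2) * (A + l^-1 * B) ^+ 2 by field; rewrite gt_eqF.
    by rewrite mulr_ge0 ?sqr_ge0// divr_ge0// ltW.
  have M : 0 <= (l / 2) * A ^+ 2 + (l^-1 / 2) * B ^+ 2 - A * B.
    have -> : (l / 2) * A ^+ 2 + (l^-1 / 2) * B ^+ 2 - A * B =
        (l / 2) * (A - l^-1 * B) ^+ 2 by field; rewrite gt_eqF.
    by rewrite mulr_ge0 ?sqr_ge0// divr_ge0// ltW.
  by rewrite ler_norml; apply/andP; split; lra.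
rewrite RintegralD//; [|exact: (integrableZl measurableT _ io)|
  exact: (integrableZl measurableT _ ig)].
rewrite !RintegralZl//.
have H1 : (l / 2) * \int[(m \x m)%E]_z ((a z.1 - a z.2) ^+ 2 * r n z) <= e / 2.
  apply: (@le_trans _ _ ((l / 2) * (e / l))).
    by rewrite ler_wpM2l// divr_ge0// ltW.
  by rewrite le_eqVlt; apply/orP; left; apply/eqP; field; rewrite gt_eqF.
have H2 : (l^-1 / 2) * \int[(m \x m)%E]_z (g z.2 ^+ 2 * r n z) <= e / 2.
  apply: (@le_trans _ _ ((l^-1 / 2) * (G + 1))).
    rewrite ler_wpM2l ?divr_ge0 ?invr_ge0 ?(ltW l0)//.
    by apply: (le_trans Gn); rewrite lerDl.
  rewrite /l le_eqVlt; apply/orP; left; apply/eqP; field.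
  by rewrite !gt_eqF// ltr_wpDl.
by rewrite [leRHS]splitr lerD.
Unshelve. all: by end_near. Qed.

End schur_kernels.

Import HBNNSimple.

Section oscillation_convergence.
Context {d : measure_display} {T : measurableType d} {R : realType}.
Variable m : {sigma_finite_measure set T -> \bar R}.
Variable r : nat -> T * T -> R.
Hypothesis r1 : forall n, marginals_eq1 m (r n).
Implicit Types (a b g : T -> R) (A E Q : set T).

Definition vanishing_osc a := measurable_fun setT a /\
  oscillation m (r n) a @[n --> \oo] --> 0%E.

Let rC n := marginals_eq1_le (r1 n).
Let mr n : measurable_fun setT (r n). Proof. by have [] := r1 n. Qed.
Let r0 n z : 0 <= r n z. Proof. by have [] := r1 n. Qed.

Lemma vanishing_oscZ c a : vanishing_osc a -> vanishing_osc (fun x => c * a x).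
Proof.
move=> [ma ca]; split; first exact: measurable_funM.
have E n := oscillationZ m c (mr n) (r0 n) ma.
by rewrite (funext E) -[X in _ --> X](mule0 (c ^+ 2)%:E); exact: cvgeZl.
Qed.

Lemma vanishing_oscD a b : vanishing_osc a -> vanishing_osc b ->
  vanishing_osc (fun x => a x + b x).
Proof.
move=> [ma ca] [mb cb]; split; first exact: measurable_funD.
apply: (@squeeze_cvge _ _ _ _ (cst 0%E) _
  (fun n => 2%:E * oscillation m (r n) a + 2%:E * oscillation m (r n) b)%E).
- by apply: nearW => n; rewrite oscillation_ge0//= oscillationD.
- exact: cvg_cst.
- rewrite -[X in _ --> X](adde0 0%E); apply: cvgeD => //.
    by rewrite -[X in _ --> X](mule0 2%:E); apply: cvgeZl.
  by rewrite -[X in _ --> X](mule0 2%:E); apply: cvgeZl.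
Qed.

Lemma vanishing_osc_sum (I : Type) (s : seq I) (h : I -> T -> R) :
  (forall i, vanishing_osc (h i)) -> vanishing_osc (fun x => \sum_(i <- s) h i x).
Proof.
move=> Hh; elim: s => [|i s IH].
  under eq_fun do rewrite big_nil.
  have := vanishing_oscZ 0 (a := cst 0); under [fun x => 0 * _]eq_fun do rewrite mul0r.
  apply; split => //; rewrite /oscillation.
  under eq_fun do under eq_integral do rewrite subrr expr0n/= mul0r.
  by under eq_fun do rewrite integral0; exact: cvg_cst.
by under eq_fun do rewrite big_cons; exact: vanishing_oscD.
Qed.

(** Dominated convergence, with majorant [4 g ^+ 2], turns pointwise into L^2 convergence, and the
    set of functions of vanishing oscillation is closed in L^2. *)
Lemma vanishing_osc_dominated a (b : nat -> T -> R) g : sqint m g ->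
  measurable_fun setT a -> (forall k, vanishing_osc (b k)) ->
  (forall x, b k x @[k --> \oo] --> a x) ->
  (forall x, `|a x| <= g x) -> (forall k x, `|b k x| <= g x) ->
  vanishing_osc a.
Proof.
move=> sg ma vb cb ag bg; split => //; have [mg goo] := sg.
apply: cvg_oscillation_closure => // e e0.
have mab k : measurable_fun setT (fun x => a x - b k x).
  by apply: measurable_funB => //; have [] := vb k.
have : (\int[m]_x ((a x - b k x) ^+ 2)%:E)%E @[k --> \oo] --> (\int[m]_x 0%R%:E)%E.
  apply: (@dominated_cvg _ _ _ m setT measurableT _ _
    (fun x => 4%:E * (g x ^+ 2)%:E)%E) => //.
  - by move=> k; exact: measurable_EFin_sq.
  - move=> x _; apply: cvg_EFin; first exact: nearW.
    rewrite -[X in _ --> X](expr0n R 2) -(subrr (a x)).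
    rewrite (_ : fine \o _ = (fun k => (a x - b k x) ^+ 2))//.
    have H : (a x - b k x) @[k --> \oo] --> a x - a x.
      by apply: cvgB => //; exact: cvg_cst.
    by rewrite subrr in H *; exact: (cvgM H H).
  - by apply: integrableZl => //; exact: sqint_integrable.
  - move=> k x _; rewrite /= lee_fin ger0_norm ?sqr_ge0//.
    have := ag x; have := bg k x; rewrite !ler_norml => /andP[? ?] /andP[? ?].
    nra.
rewrite integral0 => /fine_cvgP[fin /cvgr0Pnorm_le/(_ _ e0)[N _ HN]].
case: fin => N' _ HN'.
exists (b (maxn N N')); have [mb cbk] := vb (maxn N N'); split => //.
rewrite -(@fineK _ (\int[m]_x _)%E); last by apply: HN'; exact: leq_maxr.
rewrite lee_fin; apply: le_trans (ler_norm _) _; apply: HN; exact: leq_maxl.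
Qed.

(** The last hypothesis says that seen from a point of [A] the kernels eventually stay inside [A],
    as happens for open sets and kernels concentrating on the diagonal. The rate may depend on the
    point, so dominated convergence is used, with majorant the indicator of [A]. *)
Lemma vanishing_osc_indic A : measurable A -> (m A < +oo)%E ->
  (forall x, A x -> exists N, forall n y, (N <= n)%N -> ~ A y ->
     r n (x, y) = 0 /\ r n (y, x) = 0) ->
  vanishing_osc \1_A.
Proof.
move=> mA Aoo HA; split; first exact: measurable_indic.
pose h1 n (z : T * T) : R := \1_A z.1 * (1 - \1_A z.2) * r n z.
pose h2 n (z : T * T) : R := \1_A z.2 * (1 - \1_A z.1) * r n z.
have m1A : measurable_fun setT (\1_A : T -> R) by exact: measurable_indic.
have mh1 n : measurable_fun setT (h1 n).
  apply: measurable_funM => //; apply: measurable_funM.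
    exact: measurableT_comp m1A measurable_fst.
  by apply: measurable_funB => //; exact: measurableT_comp m1A measurable_snd.
have mh2 n : measurable_fun setT (h2 n).
  apply: measurable_funM => //; apply: measurable_funM.
    exact: measurableT_comp m1A measurable_snd.
  by apply: measurable_funB => //; exact: measurableT_comp m1A measurable_fst.
have i01 x : (0 <= \1_A x :> R) /\ (\1_A x <= 1 :> R).
  by rewrite indicE; case: (_ \in _).
have h10 n z : 0 <= h1 n z.
  have [? ?] := i01 z.1; have [? ?] := i01 z.2.
  by rewrite /h1 !mulr_ge0// subr_ge0.
have h20 n z : 0 <= h2 n z.
  have [? ?] := i01 z.1; have [? ?] := i01 z.2.
  by rewrite /h2 !mulr_ge0// subr_ge0.
have int1A : m.-integrable setT (fun x => (\1_A x)%:E : \bar R).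
  apply/integrableP; split; first exact/measurable_EFinP.
  under eq_integral do rewrite gee0_abs ?lee_fin//.
  by rewrite integral_indic// setIT.
(* The square of a difference of indicators is 1 exactly when one point lies in [A] and the other
   does not. Each of the two cases is integrated first over the point outside [A]. *)
have -> : (fun n => oscillation m (r n) \1_A) = (fun n =>
    \int[m]_x fubini_F m (EFin \o h1 n) x + \int[m]_y fubini_G m (EFin \o h2 n) y)%E.
  apply/funext => n.
  rewrite -fubini_tonelli1//; last 2 first.
  - exact/measurable_EFinP.
  - by move=> z; rewrite lee_fin.
  rewrite -fubini_tonelli2//; last 2 first.
  - exact/measurable_EFinP.
  - by move=> z; rewrite lee_fin.
  rewrite -ge0_integralD//; last 4 first.
  - by move=> z _; rewrite lee_fin.
  - exact/measurable_EFinP.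
  - by move=> z _; rewrite lee_fin.
  - exact/measurable_EFinP.
  apply: eq_integral => z _; rewrite /= -EFinD; congr EFin.
  rewrite /h1 /h2 !indicE.
  by case: (z.1 \in A); case: (z.2 \in A) => /=; ring.
rewrite -[X in _ --> X](adde0 0%E); apply: cvgeD => //.
- rewrite -(@integral0 _ _ _ m setT).
  apply: (@dominated_cvg _ _ _ m setT measurableT _ _ (fun x => (\1_A x)%:E)) => //.
  + move=> n; apply: measurable_fun_fubini_tonelli_F.
      exact/measurable_EFinP.
    by move=> z; rewrite lee_fin.
  + move=> x _; apply: cvg_near_cst.
    have [Ax|Ax] := pselect (A x); last first.
      apply: nearW => n; rewrite /fubini_F/= /h1 /= integral0_eq// => y _.
      by rewrite indicE memNset// !mul0r.
    have [N HN] := HA _ Ax; exists N => //= n Nn.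
    rewrite /fubini_F/= integral0_eq// => y _; rewrite /h1 /=.
    have [Ay|Ay] := pselect (A y); first by rewrite [\1_A y]indicE mem_set// subrr mulr0 mul0r.
    by have [-> _] := HN _ _ Nn Ay; rewrite mulr0.
  + move=> n x _; rewrite gee0_abs; last first.
      by apply: integral_ge0 => y _; rewrite lee_fin.
    have [_ _ rx _] := r1 n; have [x0 _] := i01 x.
    rewrite -[leRHS]mule1 -(rx x) -ge0_integralZl//; last 2 first.
    * by apply/measurable_EFinP; exact: measurableT_comp (mr n) (measurable_pair1 x).
    * by move=> y _; rewrite lee_fin.
    apply: ge0_le_integral => //.
    * by move=> y _; rewrite lee_fin.
    * by apply/measurable_EFinP; exact: measurableT_comp (mh1 n) (measurable_pair1 x).
    * apply: measurable_funeM.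
      by apply/measurable_EFinP; exact: measurableT_comp (mr n) (measurable_pair1 x).
    * move=> y _; rewrite /= -EFinM lee_fin /h1 /= ler_wpM2r//.
      by have [? ?] := i01 y; rewrite ler_piMr// gerBl.
- rewrite -(@integral0 _ _ _ m setT).
  apply: (@dominated_cvg _ _ _ m setT measurableT _ _ (fun x => (\1_A x)%:E)) => //.
  + move=> n; apply: measurable_fun_fubini_tonelli_G.
      exact/measurable_EFinP.
    by move=> z; rewrite lee_fin.
  + move=> x _; apply: cvg_near_cst.
    have [Ax|Ax] := pselect (A x); last first.
      apply: nearW => n; rewrite /fubini_G/= /h2 /= integral0_eq// => y _.
      by rewrite indicE memNset// !mul0r.
    have [N HN] := HA _ Ax; exists N => //= n Nn.
    rewrite /fubini_G/= integral0_eq// => y _; rewrite /h2 /=.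
    have [Ay|Ay] := pselect (A y); first by rewrite [\1_A y]indicE mem_set// subrr mulr0 mul0r.
    by have [_ ->] := HN _ _ Nn Ay; rewrite mulr0.
  + move=> n x _; rewrite gee0_abs; last first.
      by apply: integral_ge0 => y _; rewrite lee_fin.
    have [_ _ _ ry] := r1 n; have [x0 _] := i01 x.
    rewrite -[leRHS]mule1 -(ry x) -ge0_integralZl//; last 2 first.
    * by apply/measurable_EFinP; exact: measurableT_comp (mr n) (measurable_pair2 x).
    * by move=> y _; rewrite lee_fin.
    apply: ge0_le_integral => //.
    * by move=> y _; rewrite lee_fin.
    * by apply/measurable_EFinP; exact: measurableT_comp (mh2 n) (measurable_pair2 x).
    * apply: measurable_funeM.
      by apply/measurable_EFinP; exact: measurableT_comp (mr n) (measurable_pair2 x).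
    * move=> y _; rewrite /= -EFinM lee_fin /h2 /= ler_wpM2r//.
      by have [? ?] := i01 y; rewrite ler_piMr// gerBl.
Qed.

(** Cutting with [Q], later of finite measure, keeps the indicators square integrable, so that
    increasing unions can be treated by domination. *)
Definition vanishing_set Q : set (set T) :=
  [set E | measurable E /\ vanishing_osc \1_(E `&` Q)].

Lemma vanishing_setSD Q : setSD_closed (vanishing_set Q).
Proof.
move=> A B BA [mA vA] [mB vB]; split; first exact: measurableD.
have := vanishing_oscD vA (vanishing_oscZ (-1) vB).
congr vanishing_osc; apply/funext => x; rewrite !indicE.
rewrite [in RHS]in_setI [in RHS]classical_sets.in_setD !in_setI.
have : x \in B -> x \in A by rewrite !inE; exact: BA.
by case: (x \in A); case: (x \in B); case: (x \in Q) => //= H;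
  rewrite ?mulr0 ?mulr1 ?addr0 ?subrr//; have := H isT.
Qed.

Lemma vanishing_set_ndseq Q : measurable Q -> (m Q < +oo)%E ->
  ndseq_closed (vanishing_set Q).
Proof.
move=> mQ Qoo F ndF vF; split; first by apply: bigcupT_measurable => i; have [] := vF i.
have sQ : sqint m (\1_Q : T -> R).
  split; first exact: measurable_indic.
  rewrite (eq_integral (fun x => (\1_Q x)%:E)); last first.
    by move=> x _; rewrite indicE; case: (_ \in _) => /=; rewrite ?expr1n ?expr0n.
  by rewrite integral_indic// setIT.
apply: (vanishing_osc_dominated (b := fun k => \1_(F k `&` Q)) sQ).
- apply: measurable_indic; apply: measurableI => //.
  by apply: bigcupT_measurable => i; have [] := vF i.
- by move=> k; have [] := vF k.
- move=> x; apply: cvg_near_cst.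
  have [[k _ Fx]|nF] := pselect ((\bigcup_i F i) x).
    exists k => //= n kn; rewrite !indicE !in_setI; congr ((_ && _)%:R).
    rewrite [RHS]mem_set; last by exists k.
    by apply: mem_set; move: Fx; apply/subsetPset; exact: ndF.
  apply: nearW => n; rewrite !indicE !in_setI; congr ((_ && _)%:R).
  by rewrite !memNset// => Fn; apply: nF; exists n.
- move=> x; rewrite !indicE in_setI; case: (x \in Q); rewrite ?andbF ?andbT ?normr0//.
  by case: (_ \in _); rewrite ?normr0 ?normr1.
- move=> k x; rewrite !indicE in_setI; case: (x \in Q); rewrite ?andbF ?andbT ?normr0//.
  by case: (_ \in _); rewrite ?normr0 ?normr1.
Qed.

(** Positive and negative parts are increasing limits of simple functions; cutting these off by
    [Q k] leaves finite combinations of the indicators covered by the hypothesis. *)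
Lemma vanishing_osc_sqint (Q : nat -> set T) :
  (forall k, measurable (Q k)) -> (forall k E, measurable E -> vanishing_set (Q k) E) ->
  (forall x, \forall k \near \oo, Q k x) ->
  forall a, sqint m a -> vanishing_osc a.
Proof.
move=> mQ vQ Qx.
have pos a : sqint m a -> (forall x, 0 <= a x) -> vanishing_osc a.
  move=> sa a0; have [ma _] := sa.
  have mEa : measurable_fun setT (EFin \o a) by exact/measurable_EFinP.
  pose phi := nnsfun_approx measurableT mEa.
  have a0' x : setT x -> (0 <= (EFin \o a) x)%E by move=> _; rewrite lee_fin.
  have cphi x : phi k x @[k --> \oo] --> a x.
    have := @cvg_nnsfun_approx _ _ _ _ measurableT _ mEa a0' x I.
    by move/fine_cvg.
  have phile k x : phi k x <= a x.
    rewrite -(cvg_lim (@Rhausdorff R) (cphi x)); apply: nondecreasing_cvgn_le.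
      by move=> i j ij; exact/lefP/nd_nnsfun_approx.
    by apply/cvg_ex; exists (a x).
  apply: (vanishing_osc_dominated (b := fun k x => phi k x * \1_(Q k) x) sa) => //.
  - move=> k; rewrite (_ : (fun x => _) = fun x =>
        \sum_(y <- finmap.enum_fset (fset_set (range (phi k))))
          y * \1_(phi k @^-1` [set y] `&` Q k) x); last first.
      apply/funext => x; rewrite fimfunE fsbig_finite//= mulr_suml.
      by apply: eq_bigr => y _; rewrite indicI mulrA.
    apply: vanishing_osc_sum => y; apply: vanishing_oscZ.
    have mP : measurable (phi k @^-1` [set y]).
      exact: measurable_sfunP.
    by have [] := vQ k _ mP.
  - move=> x; rewrite -[X in _ --> X]mulr1; apply: cvgM => //.
    apply: cvg_near_cst; have := Qx x; apply: filterS => k Qk.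
    by rewrite indicE mem_set.
  - by move=> x; rewrite ger0_norm.
  - move=> k x; rewrite indicE; case: (_ \in _); rewrite ?mulr1 ?mulr0 ?normr0//.
    by rewrite ger0_norm.
move=> a sa; have [ma _] := sa.
have sp : sqint m (fun x => Num.max (a x) 0).
  apply: (le_sqint _ sa); first exact: measurable_maxr.
  by move=> x; rewrite maxEle; case: ifPn; rewrite ?normr0.
have sn : sqint m (fun x => Num.max (- a x) 0).
  apply: (le_sqint _ sa); first by apply: measurable_maxr => //; exact: measurable_funN.
  by move=> x; rewrite maxEle; case: ifPn; rewrite ?normr0 ?normrN.
have := vanishing_oscD (pos _ sp _) (vanishing_oscZ (-1) (pos _ sn _)).
move=> /(_ _ _)[||ma' ca].
- by move=> x; rewrite le_max lexx orbT.
- by move=> x; rewrite le_max lexx orbT.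
suff -> : a = (fun x => Num.max (a x) 0 + -1 * Num.max (- a x) 0) by split.
by apply/funext => x; case: (leP (a x) 0) => ax; case: (leP (- a x) 0) => nax; lra.
Qed.

End oscillation_convergence.

(** Dynkin's theorem pulled back along [Phi]. With [Phi] freezing all factors of a box but one, it
    upgrades that factor from a generating class to all measurable sets. *)
Lemma dynkin_lift (X : Type) (V : set (set X)) (d : measure_display)
    (S : measurableType d) (G : set (set S)) (Phi : set S -> set X) :
  setSD_closed V -> ndseq_closed V ->
  measurable = <<s G >> -> setI_closed G ->
  (forall A B, Phi (A `\` B) = Phi A `\` Phi B) ->
  (forall F : nat -> set S, Phi (\bigcup_i F i) = \bigcup_i Phi (F i)) ->
  (forall A B, A `<=` B -> Phi A `<=` Phi B) ->
  V (Phi setT) -> (forall A, G A -> V (Phi A)) ->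
  forall A, measurable A -> V (Phi A).
Proof.
move=> SD ND mG GI PD PU PS vT vG A; rewrite mG.
have := @lambda_system_subset _ G GI setT [set A | V (Phi A)]; apply => //.
split => //.
- by move=> A1 A2 A21 v1 v2; rewrite /= PD; apply: SD => //; exact: PS.
- move=> F ndF vF; rewrite /= PU; apply: ND => // i j ij.
  by apply/subsetPset/PS/subsetPset; exact: ndF.
Qed.

(** * Mollifiers on R^3 *)

Section kernels_on_R3.
Context {R : realType}.
Local Notation R1 := (measurableTypeR R).
Local Notation X3 := (R1 * R1 * R1)%type.
Local Notation mu := (@lebesgue_measure R).
Local Notation mu3 := (leb3 R).

Lemma integral_tens3 (k0 k1 k2 : R1 -> R) :
  measurable_fun setT k0 -> measurable_fun setT k1 -> measurable_fun setT k2 ->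
  (forall s, 0 <= k0 s) -> (forall s, 0 <= k1 s) -> (forall s, 0 <= k2 s) ->
  (\int[mu3]_x (k0 x.1.1 * k1 x.1.2 * k2 x.2)%:E =
   \int[mu]_s (k0 s)%:E * \int[mu]_s (k1 s)%:E * \int[mu]_s (k2 s)%:E)%E.
Proof.
move=> m0 m1 m2 p0 p1 p2.
have M0 : measurable_fun [set: R1 * R1] (fun x => k0 x.1).
  exact: measurableT_comp m0 measurable_fst.
have M1 : measurable_fun [set: R1 * R1] (fun x => k1 x.2).
  exact: measurableT_comp m1 measurable_snd.
have M01 : measurable_fun [set: R1 * R1] (fun x => k0 x.1 * k1 x.2).
  exact: measurable_funM.
have M : measurable_fun [set: X3] (fun x => k0 x.1.1 * k1 x.1.2 * k2 x.2).
  apply: measurable_funM.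
    exact: (measurableT_comp M01 measurable_fst).
  exact: measurableT_comp m2 measurable_snd.
have I2 : (0 <= \int[mu]_s (k2 s)%:E)%E.
  by apply: integral_ge0 => s _; rewrite lee_fin.
have I1 : (0 <= \int[mu]_s (k1 s)%:E)%E.
  by apply: integral_ge0 => s _; rewrite lee_fin.
rewrite /leb3 fubini_tonelli1; last 2 first.
- exact/measurable_EFinP.
- by move=> x; rewrite lee_fin !mulr_ge0.
transitivity (\int[leb2 R]_x ((k0 x.1 * k1 x.2)%:E * \int[mu]_s (k2 s)%:E))%E.
  apply: eq_integral => x _; rewrite /fubini_F /=.
  under eq_integral do rewrite EFinM.
  rewrite ge0_integralZl//.
  - exact/measurable_EFinP.
  - by move=> s _; rewrite lee_fin.
  - by rewrite lee_fin mulr_ge0.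
rewrite ge0_integralZr//; last 2 first.
- exact/measurable_EFinP.
- by move=> x _; rewrite lee_fin mulr_ge0.
congr (_ * _)%E.
rewrite /leb2 fubini_tonelli1; last 2 first.
- exact/measurable_EFinP.
- by move=> x; rewrite lee_fin !mulr_ge0.
transitivity (\int[mu]_x ((k0 x)%:E * \int[mu]_s (k1 s)%:E))%E.
  apply: eq_integral => x _; rewrite /fubini_F /=.
  under eq_integral do rewrite EFinM.
  rewrite ge0_integralZl//.
  - exact/measurable_EFinP.
  - by move=> s _; rewrite lee_fin.
  - by rewrite lee_fin.
rewrite ge0_integralZr//.
- exact/measurable_EFinP.
- by move=> x _; rewrite lee_fin.
Qed.

Lemma measurable_tens_sub (k : 'I_3 -> R -> R) :
  (forall j, measurable_fun setT (k j : R1 -> R)) ->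
  measurable_fun [set: X3 * X3] (fun z => tens k (z.1 - z.2)).
Proof.
move=> mk.
have m11 : measurable_fun [set: X3] (fun x => x.1.1 : R).
  exact: (measurableT_comp measurable_fst measurable_fst).
have m12 : measurable_fun [set: X3] (fun x => x.1.2 : R).
  exact: (measurableT_comp measurable_snd measurable_fst).
have m2 : measurable_fun [set: X3] (fun x => x.2 : R) by exact: measurable_snd.
have sub (p : X3 -> R) : measurable_fun setT p ->
    measurable_fun [set: X3 * X3] (fun z => p z.1 - p z.2).
  move=> mp; apply: measurable_funB.
    exact: (measurableT_comp mp measurable_fst).
  exact: (measurableT_comp mp measurable_snd).
rewrite /tens; apply: measurable_funM; first apply: measurable_funM.
- exact: (measurableT_comp (mk 0) (sub _ m11)).
- exact: (measurableT_comp (mk 1) (sub _ m12)).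
- exact: (measurableT_comp (mk 2%:R) (sub _ m2)).
Qed.

Lemma measurable_comp_subl (k : R1 -> R) (s : R) : measurable_fun setT k ->
  measurable_fun setT (fun t : R1 => k (s - t)).
Proof.
move=> mk; apply: (measurableT_comp mk).
by apply: measurable_funB => //; exact: measurable_id.
Qed.

Lemma measurable_comp_subr (k : R1 -> R) (s : R) : measurable_fun setT k ->
  measurable_fun setT (fun t : R1 => k (t - s)).
Proof.
move=> mk; apply: (measurableT_comp mk).
by apply: measurable_funB => //; exact: measurable_id.
Qed.

Lemma integral_le_support (q : R1 -> R) (a M C : R) : measurable_fun setT q ->
  0 <= M -> (forall s, 0 <= q s <= C) -> (forall s, M <= `|s - a| -> q s = 0) ->
  (\int[mu]_s (q s)%:E <= (C * (M *+ 2))%:E)%E.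
Proof.
move=> mq M0 qC q0.
have C0 : 0 <= C by have /andP[+ +] := qC 0; exact: le_trans.
apply: (@le_trans _ _ (\int[mu]_(s in `[(a - M)%R, (a + M)%R]) C%:E)%E).
  rewrite [leRHS]integral_mkcond; apply: ge0_le_integral => //.
  - by move=> s _; rewrite lee_fin; have /andP[] := qC s.
  - exact/measurable_EFinP.
  - by apply/(measurable_restrictT _ _).1 => //; exact: measurable_cst.
  - move=> s _; rewrite patchE; case: ifPn => [_|]; first by rewrite lee_fin; have /andP[] := qC s.
    rewrite notin_setE /= in_itv/= => /negP; rewrite -ler_distl -ltNge => /ltW Ms.
    by rewrite q0.
rewrite integral_cst//= lebesgue_measure_itv/= lte_fin.
case: ifPn => _; last by rewrite mule0 lee_fin mulr_ge0// mulrn_wge0.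
by rewrite -EFinB -EFinM lee_fin ler_wpM2l// (_ : _ - _ = M *+ 2)//; ring.
Qed.

Lemma marginals_le_tens (k : 'I_3 -> R -> R) (M C : R) : 0 <= M ->
  (forall j, measurable_fun setT (k j : R1 -> R)) ->
  (forall j s, 0 <= k j s <= C) -> (forall j s, M <= `|s| -> k j s = 0) ->
  marginals_le mu3 (fun z => tens k (z.1 - z.2)) ((C * (M *+ 2)) ^+ 3).
Proof.
move=> M0 mk kC k0.
have kp j s : 0 <= k j s by have /andP[] := kC j s.
have I0 (q : R1 -> R) : (forall s, 0 <= q s) -> (0 <= \int[mu]_s (q s)%:E)%E.
  by move=> q0; apply: integral_ge0 => s _; rewrite lee_fin.
split.
- exact: measurable_tens_sub.
- by move=> z; rewrite /tens !mulr_ge0.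
- move=> x; rewrite (_ : (\int[mu3]_y _)%E = (\int[mu3]_y (k 0 (x.1.1 - y.1.1) *
    k 1 (x.1.2 - y.1.2) * k 2%:R (x.2 - y.2))%:E)%E)//.
  rewrite (@integral_tens3 (fun t => k 0 (x.1.1 - t)) (fun t => k 1 (x.1.2 - t))
    (fun t => k 2%:R (x.2 - t)))//; try exact: measurable_comp_subl.
  have B j s : (\int[mu]_t (k j (s - t))%:E <= (C * (M *+ 2))%:E)%E.
    apply: (@integral_le_support _ s) => //; first exact: measurable_comp_subl.
    by move=> t Mt; apply: k0; rewrite distrC.
  rewrite exprSr expr2 !EFinM; apply: lee_pmul => //; rewrite ?mule_ge0 ?I0//.
  by apply: lee_pmul; rewrite ?I0.
- move=> y; rewrite (_ : (\int[mu3]_x _)%E = (\int[mu3]_x (k 0 (x.1.1 - y.1.1) *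
    k 1 (x.1.2 - y.1.2) * k 2%:R (x.2 - y.2))%:E)%E)//.
  rewrite (@integral_tens3 (fun t => k 0 (t - y.1.1)) (fun t => k 1 (t - y.1.2))
    (fun t => k 2%:R (t - y.2)))//; try exact: measurable_comp_subr.
  have B j s : (\int[mu]_t (k j (t - s))%:E <= (C * (M *+ 2))%:E)%E.
    apply: (@integral_le_support _ s) => //; first exact: measurable_comp_subr.
    by move=> t Mt; apply: k0.
  rewrite exprSr expr2 !EFinM; apply: lee_pmul => //; rewrite ?mule_ge0 ?I0//.
  by apply: lee_pmul; rewrite ?I0.
Qed.

Lemma measurable_bumpn n : measurable_fun setT (bumpn n : R1 -> R).
Proof.
apply: continuous_measurable_fun; apply: smooth1_continuous.
exact/smooth_class_smooth1/smooth_bumpn.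
Qed.

(** A rescaled [step] is a primitive and goes from 0 to 1 across the support. *)
Lemma integral_bumpn n (s : R) : (\int[mu]_t (bumpn n (t - s))%:E = 1)%E.
Proof.
have n0 : 0 < n.+1%:R^-1 :> R by rewrite invr_gt0.
pose a := s - n.+1%:R^-1; pose b := s + n.+1%:R^-1.
have ab : a < b by rewrite /a /b ltrBlDr -addrA ltrDl addr_gt0.
transitivity (\int[mu]_(t in `[a, b]) (bumpn n (t - s))%:E)%E.
  rewrite [RHS]integral_mkcond; apply: eq_integral => t _.
  rewrite patchE; case: ifPn => //.
  rewrite notin_setE /= in_itv/= => /negP; rewrite -ler_distl -ltNge => /ltW Ms.
  by rewrite bumpn_out.
have cb : continuous (fun t : R => bumpn n (t - s)).
  move=> t; apply: (@continuous_comp _ _ _ (fun t => t - s) (bumpn n)).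
    by apply: cvgB; [exact: cvg_id|exact: cvg_cst].
  exact/smooth1_continuous/smooth_class_smooth1/smooth_bumpn.
have dF t := is_derive_stepn n s t.
have cF : continuous (fun t : R => step (n.+1%:R * (t - s))).
  move=> t; apply: differentiable_continuous; apply/derivable1_diffP.
  exact: (@ex_derive _ _ _ _ _ _ _ (dF t)).
rewrite (@continuous_FTC2 _ _ (fun t => step (n.+1%:R * (t - s))))//.
- rewrite step_right ?step_left ?sube0//.
  + by rewrite /a addrAC subrr add0r mulrN divff// pnatr_eq0.
  + by rewrite /b addrC addKr divff// pnatr_eq0.
- exact: continuous_subspaceT.
- split.
  + by move=> t _; exact: (@ex_derive _ _ _ _ _ _ _ (dF t)).
  + exact/cvg_at_right_filter/cF.
  + exact/cvg_at_left_filter/cF.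
- by move=> t _; rewrite derive1E; exact: (@derive_val _ _ _ _ _ _ _ (dF t)).
Qed.

Definition mollifier n (z : X3 * X3) : R :=
  tens (fun _ => bumpn n) (z.1 - z.2).

Lemma mollifier_eq1 n : marginals_eq1 mu3 (mollifier n).
Proof.
have mb := measurable_bumpn n.
split.
- by apply: measurable_tens_sub => j.
- by move=> z; apply: mulr_ge0; [apply: mulr_ge0|]; exact: bumpn_ge0.
- move=> x; rewrite (_ : (\int[mu3]_y _)%E = (\int[mu3]_y (bumpn n (y.1.1 - x.1.1) *
    bumpn n (y.1.2 - x.1.2) * bumpn n (y.2 - x.2))%:E)%E); last first.
    by apply: eq_integral => y _; rewrite /mollifier /tens /= -!(bumpn_even n (_ - x.1.1))
      -(bumpn_even n (_ - x.1.2)) -(bumpn_even n (_ - x.2)) !opprB.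
  rewrite (@integral_tens3 (fun t => bumpn n (t - x.1.1)) (fun t => bumpn n (t - x.1.2))
    (fun t => bumpn n (t - x.2)))//; try exact: measurable_comp_subr.
  + by rewrite !integral_bumpn !mule1.
  + by move=> *; exact: bumpn_ge0.
  + by move=> *; exact: bumpn_ge0.
  + by move=> *; exact: bumpn_ge0.
- move=> y; rewrite (_ : (\int[mu3]_x _)%E = (\int[mu3]_x (bumpn n (x.1.1 - y.1.1) *
    bumpn n (x.1.2 - y.1.2) * bumpn n (x.2 - y.2))%:E)%E)//.
  rewrite (@integral_tens3 (fun t => bumpn n (t - y.1.1)) (fun t => bumpn n (t - y.1.2))
    (fun t => bumpn n (t - y.2)))//; try exact: measurable_comp_subr.
  + by rewrite !integral_bumpn !mule1.
  + by move=> *; exact: bumpn_ge0.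
  + by move=> *; exact: bumpn_ge0.
  + by move=> *; exact: bumpn_ge0.
Qed.

Local Notation vosc := (vanishing_osc mu3 mollifier).

Lemma mollifier_sym n x y : mollifier n (x, y) = mollifier n (y, x).
Proof.
rewrite /mollifier /tens /= -(bumpn_even n (x.1.1 - _)).
by rewrite -(bumpn_even n (x.1.2 - _)) -(bumpn_even n (x.2 - _)) !opprB.
Qed.

Lemma mollifier_neq0 n x y : mollifier n (x, y) != 0 ->
  [/\ `|x.1.1 - y.1.1| < n.+1%:R^-1, `|x.1.2 - y.1.2| < n.+1%:R^-1 &
      `|x.2 - y.2| < n.+1%:R^-1].
Proof.
move=> h; split; rewrite ltNge; apply/negP => H; move/negP: h; apply; apply/eqP;
  by rewrite /mollifier /tens /= (bumpn_out H) ?(mulr0, mul0r).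
Qed.

(** The intervals are open so that the intersection with an open box is again open, as
    [vanishing_open_box] requires. *)
Definition cube (k : nat) : set X3 :=
  (`]- k%:R, k%:R[ `*` `]- k%:R, k%:R[ `*` `]- k%:R, k%:R[)%classic.

Lemma measurable_cube k : measurable (cube k).
Proof. by apply: measurableX => //; exact: measurableX. Qed.

Lemma measure_cube k : (mu3 (cube k) < +oo)%E.
Proof.
pose i : set R1 := `]- k%:R, k%:R[%classic.
have -> : (mu3 (cube k) = mu i * mu i * mu i)%E.
  transitivity (leb2 R (i `*` i) * mu i)%E.
    by apply: product_measure1E; [apply: measurableX|]; exact: measurable_itv.
  have E2 : (leb2 R (i `*` i) = mu i * mu i)%E.
    by apply: product_measure1E; exact: measurable_itv.
  by rewrite E2.
have H : (mu i < +oo)%E.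
  by rewrite /i lebesgue_measure_itv/=; case: ifPn => _ //; rewrite -EFinB ltry.
by rewrite !lte_mul_pinfty// ?mule_ge0// ge0_fin_numE ?lte_mul_pinfty// ?mule_ge0// ge0_fin_numE.
Qed.

(** A point of an open box keeps a positive coordinatewise distance from the complement, and beyond
    some index the support of the mollifier is narrower than that. *)
Lemma vanishing_open_box (U1 U2 U3 : set R) k : open U1 -> open U2 -> open U3 ->
  measurable (U1 : set R1) -> measurable (U2 : set R1) -> measurable (U3 : set R1) ->
  vanishing_set mu3 mollifier (cube k) (U1 `*` U2 `*` U3).
Proof.
move=> o1 o2 o3 m1 m2 m3.
have mU : measurable (U1 `*` U2 `*` U3 : set X3).
  by apply: measurableX => //; exact: measurableX.
split => //; apply: vanishing_osc_indic.
- exact: mollifier_eq1.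
- by apply: measurableI => //; exact: measurable_cube.
- apply: le_lt_trans (measure_cube k); apply: le_measure; rewrite ?inE//.
  + by apply: measurableI => //; exact: measurable_cube.
  + exact: measurable_cube.
- move=> x [[[/= x1 x2] x3] [[/= q1 q2] q3]].
  have near1 (U : set R) (s : R) : open U -> U s -> `]- k%:R, k%:R[%classic s ->
      exists2 e : R, 0 < e & forall t, `|s - t| < e -> U t /\ `]- k%:R, k%:R[%classic t.
    move=> oU Us ks; have oUk : open (U `&` `]- k%:R, k%:R[%classic).
      by apply: openI => //; exact: interval_open.
    have /nbhs_ballP[e /= e0 He] : nbhs s (U `&` `]- k%:R, k%:R[%classic).
      by apply: open_nbhs_nbhs; split.
    by exists e => // t st; have := He t st.
  have [e1 e10 H1] := near1 _ _ o1 x1 q1.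
  have [e2 e20 H2] := near1 _ _ o2 x2 q2.
  have [e3 e30 H3] := near1 _ _ o3 x3 q3.
  pose e := Num.min (Num.min e1 e2) e3.
  have e0 : 0 < e by rewrite !lt_min e10 e20.
  have [N HN] : exists N : nat, N.+1%:R^-1 < e.
    by have := ltr_add_invr e0; move=> [N]; rewrite add0r => ?; exists N.
  exists N => n y Nn ny.
  have H : mollifier n (x, y) = 0.
    apply/eqP; apply: contrapT => /negP /mollifier_neq0[h1 h2 h3]; apply: ny.
    have ne : n.+1%:R^-1 < e.
      by apply: le_lt_trans HN; rewrite lef_pV2 ?posrE// ler_nat ltnS.
    have [] := (lt_trans h1 ne, lt_trans h2 ne, lt_trans h3 ne).
    rewrite !lt_min => -[/andP[/andP[g1 _] _] /andP[/andP[_ g2] _]] /andP[_ g3].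
    have [? ?] := H1 _ g1; have [? ?] := H2 _ g2; have [? ?] := H3 _ g3.
    by split; split => //; split.
  by split => //; rewrite mollifier_sym.
Qed.

(** Starting from open boxes, the three factors are made measurable one after the other ([st1] to
    [st3]); the two product sigma-algebras nested in R^3 are then treated in turn. *)
Lemma vanishing_measurable k E : measurable E ->
  vanishing_set mu3 mollifier (cube k) E.
Proof.
have SD := vanishing_setSD mollifier_eq1 (Q := cube k).
have ND := vanishing_set_ndseq mollifier_eq1 (measurable_cube k) (measure_cube k).
pose vs := vanishing_set mu3 mollifier (cube k).
(* Open sets rather than open intervals serve as generators: they are stable under intersection and
   contain the whole line. *)
have mR : (measurable : set (set R1)) = <<s [set A : set R | open A /\ measurable (A : set R1)] >>.
  apply/seteqP; split; last first.
    by apply: smallest_sub; [exact: sigma_algebra_measurable|move=> A []].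
  rewrite [X in X `<=` _]RGenOpens.measurableE; apply: sub_sigma_algebra2.
  by move=> A [x [y ->]]; split; [exact: interval_open|exact: measurable_itv].
have GI : setI_closed [set A : set R | open A /\ measurable (A : set R1)].
  by move=> A B [oA mA] [oB mB]; split; [exact: openI|exact: measurableI].
have st1 (A U2 U3 : set R1) : measurable A -> open (U2 : set R) -> open (U3 : set R) ->
    measurable U2 -> measurable U3 -> vs (A `*` U2 `*` U3).
  move=> mA o2 o3 m2 m3.
  apply: (dynkin_lift SD ND (S := R1) (Phi := fun A => A `*` U2 `*` U3) mR GI) => //.
  - move=> C B; apply/seteqP; split => x /=; first tauto.
    by move=> [[[? ?] ?] n]; split => //; split => //; split => // ?; apply: n.
  - move=> F; apply/seteqP; split => x /=; first by move=> [[[i _ ?] ?] ?]; exists i.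
    by move=> [i _ [[? ?] ?]]; split => //; split => //; exists i.
  - by move=> C B CB x [[/CB ? ?] ?].
  - by apply: vanishing_open_box => //; exact: openT.
  - by move=> C [oC mC]; exact: vanishing_open_box.
have st2 (A B U3 : set R1) : measurable A -> measurable B -> open (U3 : set R) ->
    measurable U3 -> vs (A `*` B `*` U3).
  move=> mA mB o3 m3.
  apply: (dynkin_lift SD ND (S := R1) (Phi := fun B => A `*` B `*` U3) mR GI) => //.
  - move=> C D; apply/seteqP; split => x /=; first tauto.
    by move=> [[[? ?] ?] n]; split => //; split => //; split => // ?; apply: n.
  - move=> F; apply/seteqP; split => x /=; first by move=> [[? [i _ ?]] ?]; exists i.
    by move=> [i _ [[? ?] ?]]; split => //; split => //; exists i.
  - by move=> C D CB x [[? /CB ?] ?].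
  - by apply: st1 => //; exact: openT.
  - by move=> C [oC mC]; exact: st1.
have st3 (A B C : set R1) : measurable A -> measurable B -> measurable C ->
    vs (A `*` B `*` C).
  move=> mA mB mC.
  apply: (dynkin_lift SD ND (S := R1) (Phi := fun C => A `*` B `*` C) mR GI) => //.
  - move=> D F; apply/seteqP; split => x /=; first tauto.
    by move=> [[[? ?] ?] n]; split => //; split => // ?; apply: n.
  - move=> F; apply/seteqP; split => x /=; first by move=> [[? ?] [i _ ?]]; exists i.
    by move=> [i _ [[? ?] ?]]; split => //; exists i.
  - by move=> D F DF x [[? ?] /DF ?].
  - by apply: st2 => //; exact: openT.
  - by move=> D [oD mD]; exact: st2.
have XI (d1 d2 : measure_display) (S1 : measurableType d1) (S2 : measurableType d2) :
    setI_closed [set A `*` B | A in (measurable : set (set S1)) &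
      B in (measurable : set (set S2))].
  move=> _ _ [A1 mA1 [B1 mB1 <-]] [A2 mA2 [B2 mB2 <-]].
  exists (A1 `&` A2); first exact: measurableI.
  by exists (B1 `&` B2); [exact: measurableI|rewrite setXI].
(* The same argument on the plane, whose sigma-algebra is generated by the measurable rectangles
   settled in [st3]. *)
have st4 (A : set (R1 * R1)) (C : set R1) : measurable A -> measurable C ->
    vs (A `*` C).
  move=> mA mC.
  apply: (dynkin_lift SD ND (Phi := fun A => A `*` C)
    (measurable_prod_measurableType _ _) (XI _ _ R1 R1)) => //.
  - move=> D F; apply/seteqP; split => x /=; first tauto.
    by move=> [[? ?] n]; split => //; split => // ?; apply: n.
  - move=> F; apply/seteqP; split => x /=; first by move=> [[i _ ?] ?]; exists i.
    by move=> [i _ [? ?]]; split => //; exists i.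
  - by move=> D F DF x [/DF ? ?].
  - by rewrite -setXTT; exact: st3.
  - by move=> _ [D mD [F mF <-]]; exact: st3.
move=> mE.
apply: (dynkin_lift SD ND (Phi := id) (measurable_prod_measurableType _ _)
  (XI _ _ (R1 * R1)%type R1)) => //.
- by rewrite -setXTT; exact: st4.
- by move=> _ [D mD [F mF <-]]; exact: st4.
Qed.

Lemma sqint_vanishing_osc a : sqint mu3 a -> vosc a.
Proof.
apply: (vanishing_osc_sqint mollifier_eq1 measurable_cube).
  by move=> k E; exact: vanishing_measurable.
move=> x.
near=> k; split; first split; rewrite /= in_itv/= -ltr_norml; near: k.
- exact: nbhs_infty_gtr.
- exact: nbhs_infty_gtr.
- exact: nbhs_infty_gtr.
Unshelve. all: by end_near. Qed.

Lemma cvg_mollifier a g : sqint mu3 a -> sqint mu3 g ->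
  \int[(mu3 \x mu3)%E]_z (a z.1 * g z.2 * mollifier n z) @[n --> \oo] -->
  \int[mu3]_x (a x * g x).
Proof.
move=> sa sg; apply: cvg_kernel => //; first exact: mollifier_eq1.
by have [] := sqint_vanishing_osc sa.
Qed.

End kernels_on_R3.

(** * Euclidean and L^2 inner products of vector fields *)

Section dot_product.
Context {R : realType}.
Implicit Types (u v w : 'rV[R]_3) (c : R).

Lemma dotC u v : dot u v = dot v u.
Proof. by apply: eq_bigr => i _; rewrite mulrC. Qed.

Lemma dotDl u v w : dot (u + v) w = dot u w + dot v w.
Proof. by rewrite -big_split; apply: eq_bigr => i _; rewrite mxE mulrDl. Qed.

Lemma dotZl c u v : dot (c *: u) v = c * dot u v.
Proof. by rewrite mulr_sumr; apply: eq_bigr => i _; rewrite mxE mulrA. Qed.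

Lemma dotNl u v : dot (- u) v = - dot u v.
Proof. by rewrite -scaleN1r dotZl mulN1r. Qed.

Lemma dotBl u v w : dot (u - v) w = dot u w - dot v w.
Proof. by rewrite dotDl dotNl. Qed.

Lemma dotDr u v w : dot w (u + v) = dot w u + dot w v.
Proof. by rewrite dotC dotDl !(dotC w). Qed.

Lemma dotZr c u v : dot u (c *: v) = c * dot u v.
Proof. by rewrite dotC dotZl dotC. Qed.

Lemma dotNr u v : dot u (- v) = - dot u v.
Proof. by rewrite dotC dotNl dotC. Qed.

Lemma dotBr u v w : dot w (u - v) = dot w u - dot w v.
Proof. by rewrite dotDr dotNr. Qed.

Lemma dot0l v : dot 0 v = 0.
Proof. by rewrite -(scale0r 0) dotZl mul0r. Qed.

Lemma dot_ge0 u : 0 <= dot u u.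
Proof. by apply: sumr_ge0 => i _; rewrite -expr2 sqr_ge0. Qed.

Lemma enorm_sq u : enorm u ^+ 2 = dot u u.
Proof. by rewrite sqr_sqrtr// dot_ge0. Qed.

End dot_product.

Lemma Lfun2P {d : measure_display} {T : measurableType d} {R : realType}
    (m : {measure set T -> \bar R}) (f : T -> R) :
  (f \in Lfun m 2%:E) <-> sqint m f.
Proof.
have E : ('N[m]_2%:E[EFin \o f] = (\int[m]_x (f x ^+ 2)%:E) `^ 2^-1)%E.
  rewrite unlock; congr (_ `^ _)%E; apply: eq_integral => x _ /=.
  by rewrite powR_mulrn// real_normK// num_real.
split.
  move=> /andP[]; rewrite inE/= => mf; rewrite inE/= /finite_norm E => Hf.
  by split => //; apply: lty_poweRy Hf; rewrite invr_neq0.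
move=> [mf foo]; apply/andP; split; rewrite inE//= /finite_norm E.
exact: poweR_lty.
Qed.

Section vector_L2.
Context {R : realType}.
Local Notation R1 := (measurableTypeR R).
Local Notation X3 := (R1 * R1 * R1)%type.
Local Notation mu3 := (leb3 R).
Implicit Types (u v w : vfield R) (c : R3 R -> R).

Lemma ae_imp (P Q : R3 R -> Prop) : (forall x, P x -> Q x) ->
  {ae mu3, forall x, P x} -> {ae mu3, forall x, Q x}.
Proof. by move=> PQ; apply: (@filterS _ _ (ae_filter_ringOfSetsType mu3)). Qed.

Lemma ae_and (P Q : R3 R -> Prop) : {ae mu3, forall x, P x} ->
  {ae mu3, forall x, Q x} -> {ae mu3, forall x, P x /\ Q x}.
Proof. exact: (@filterI _ _ (ae_filter_ringOfSetsType mu3)). Qed.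

Lemma L2P u : L2 u <-> forall i, sqint mu3 (fun x => u x ord0 i).
Proof. by split => H i; apply/Lfun2P; exact: H. Qed.

(** An explicit almost everywhere bound, rather than an essential supremum, is easily propagated
    through sums, products and inverses of coefficients. *)
Definition bounded_coef c := measurable_fun setT (c : X3 -> R) /\
  exists C : R, {ae mu3, forall x, `|c x| <= C}.

Lemma L2_scale k u : L2 u -> L2 (fun x => k *: u x).
Proof.
move/L2P => Hu; apply/L2P => i; have := sqintZ k (Hu i).
by congr sqint; apply/funext => x; rewrite mxE.
Qed.

Lemma L2_add u v : L2 u -> L2 v -> L2 (fun x => u x + v x).
Proof.
move=> /L2P Hu /L2P Hv; apply/L2P => i; have := sqintD (Hu i) (Hv i).
by congr sqint; apply/funext => x; rewrite mxE.
Qed.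

Lemma L2_opp u : L2 u -> L2 (fun x => - u x).
Proof.
by move=> /(L2_scale (-1)); congr L2; apply/funext => x; rewrite scaleN1r.
Qed.

Lemma L2_sub u v : L2 u -> L2 v -> L2 (fun x => u x - v x).
Proof. by move=> Hu /L2_opp; exact: L2_add. Qed.

Lemma L2_0 : L2 (fun=> 0 : 'rV[R]_3).
Proof.
apply/L2P => i; split.
  by under eq_fun do rewrite mxE; exact: measurable_cst.
by under eq_integral do rewrite mxE expr0n/=; rewrite integral0.
Qed.

Lemma L2_sum (I : Type) (s : seq I) (h : I -> vfield R) :
  (forall i, L2 (h i)) -> L2 (fun x => \sum_(i <- s) h i x).
Proof.
move=> Hh; elim: s => [|i s IH].
  by under eq_fun do rewrite big_nil; exact: L2_0.
by under eq_fun do rewrite big_cons; exact: L2_add.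
Qed.

Lemma L2_mul c u : bounded_coef c -> L2 u -> L2 (fun x => c x *: u x).
Proof.
move=> [mc [C cC]] /L2P Hu; apply/L2P => i; have [mu_ uoo] := Hu i.
have mcu : measurable_fun setT (fun x : X3 => (c x *: u x) ord0 i).
  under eq_fun do rewrite mxE; exact: measurable_funM.
split => //; apply: (@le_lt_trans _ _
    (\int[mu3]_x ((C ^+ 2)%:E * (u x ord0 i ^+ 2)%:E))%E); last first.
  rewrite ge0_integralZl//.
  - by rewrite lte_mul_pinfty// lee_fin sqr_ge0.
  - exact: measurable_EFin_sq.
  - by move=> x _; rewrite lee_fin sqr_ge0.
  - by rewrite lee_fin sqr_ge0.
apply: ae_ge0_le_integral => //.
- by move=> x _; rewrite lee_fin sqr_ge0.
- exact: measurable_EFin_sq.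
- by move=> x _; rewrite mule_ge0// lee_fin sqr_ge0.
- by apply: measurable_funeM; exact: measurable_EFin_sq.
- apply: ae_imp cC => x cx _; rewrite mxE -EFinM lee_fin exprMn.
  rewrite ler_wpM2r ?sqr_ge0// -(real_normK (num_real (c x))).
  by rewrite lerXn2r// nnegrE (le_trans _ cx).
Qed.

Lemma integrable_dot u v : L2 u -> L2 v ->
  mu3.-integrable setT (EFin \o (fun x => dot (u x) (v x))).
Proof.
move=> /L2P Hu /L2P Hv.
have := @integrable_sum _ _ _ mu3 setT measurableT _ (enum 'I_3) xpredT
  (fun i x => (u x ord0 i * v x ord0 i)%:E) (fun i _ => sqintM_integrable (Hu i) (Hv i)).
apply: eq_integrable => // x _.
by rewrite /= sumEFin /dot big_enum.
Qed.

Definition ip u v : R := \int[mu3]_x dot (u x) (v x).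

Lemma ipC u v : ip u v = ip v u.
Proof. by apply: eq_Rintegral => x _; rewrite dotC. Qed.

Lemma ipDl u v w : L2 u -> L2 v -> L2 w ->
  ip (fun x => u x + v x) w = ip u w + ip v w.
Proof.
move=> Lu Lv Lw; rewrite /ip; under eq_Rintegral do rewrite dotDl.
by rewrite RintegralD//; exact: integrable_dot.
Qed.

Lemma ipZl k u w : L2 u -> L2 w -> ip (fun x => k *: u x) w = k * ip u w.
Proof.
move=> Lu Lw; rewrite /ip; under eq_Rintegral do rewrite dotZl.
by rewrite RintegralZl//; exact: integrable_dot.
Qed.

Lemma ipNl u w : L2 u -> L2 w -> ip (fun x => - u x) w = - ip u w.
Proof.
move=> Lu Lw; rewrite -mulN1r -ipZl//; congr ip.
by apply/funext => x; rewrite scaleN1r.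
Qed.

Lemma ipBl u v w : L2 u -> L2 v -> L2 w ->
  ip (fun x => u x - v x) w = ip u w - ip v w.
Proof. by move=> Lu Lv Lw; rewrite ipDl ?ipNl//; exact: L2_opp. Qed.

Lemma ipBr u v w : L2 u -> L2 v -> L2 w ->
  ip w (fun x => u x - v x) = ip w u - ip w v.
Proof. by move=> *; rewrite ipC ipBl// !(ipC w). Qed.

Lemma ip_ge0 u : 0 <= ip u u.
Proof. by apply: Rintegral_ge0 => x _; exact: dot_ge0. Qed.

Lemma ip_suml (I : Type) (s : seq I) (h : I -> vfield R) w :
  (forall i, L2 (h i)) -> L2 w ->
  ip (fun x => \sum_(i <- s) h i x) w = \sum_(i <- s) ip (h i) w.
Proof.
move=> Hh Lw; elim: s => [|i s IH].
  rewrite big_nil /ip; under eq_Rintegral do rewrite big_nil dot0l.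
  by rewrite Rintegral_cst// mul0r.
rewrite big_cons -IH -ipDl//; last exact: L2_sum.
by congr ip; apply/funext => x; rewrite big_cons.
Qed.

Lemma ip_mulC c u v : ip (fun x => c x *: u x) v = ip u (fun x => c x *: v x).
Proof. by apply: eq_Rintegral => x _; rewrite dotZl dotZr. Qed.

Lemma ae_ip u u' w : L2 u -> L2 u' -> L2 w -> {ae mu3, forall x, u x = u' x} ->
  ip u w = ip u' w.
Proof.
move=> Lu Lu' Lw uu'; rewrite /ip /Rintegral; congr fine.
apply: ae_eq_integral => //.
- exact: measurable_int (integrable_dot Lu Lw).
- exact: measurable_int (integrable_dot Lu' Lw).
- by apply: ae_imp uu' => x ux _; rewrite ux.
Qed.

Lemma ip_young (l : R) u v : 0 < l -> L2 u -> L2 v ->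
  ip u v <= (l * ip u u + l^-1 * ip v v) / 2.
Proof.
move=> l0 Lu Lv.
have L : L2 (fun x => l *: u x - v x) by apply: L2_sub => //; exact: L2_scale.
have := ip_ge0 (fun x => l *: u x - v x).
rewrite ipBl//; [|exact: L2_scale].
rewrite !ipBr//; [|exact: L2_scale..].
rewrite !ipZl//; [|exact: L2_scale..].
rewrite !(ipC _ (fun x => l *: u x)) !ipZl//.
move=> H.
have -> : (l * ip u u + l^-1 * ip v v) / 2 =
  ip u v + (l * (l * ip u u) - l * ip u v - (l * ip u v - ip v v)) / (2 * l).
  by field; rewrite gt_eqF.
by rewrite lerDl divr_ge0// mulr_ge0// ltW.
Qed.

(** Cauchy-Schwarz, from Young's inequality with a free weight. *)
Lemma ip_sq_le u v : L2 u -> L2 v -> ip u v ^+ 2 <= ip u u * ip v v.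
Proof.
move=> Lu Lv.
have Y l : 0 < l -> `|ip u v| <= (l * ip u u + l^-1 * ip v v) / 2.
  move=> l0; rewrite ler_norml; apply/andP; split; last exact: ip_young.
  rewrite lerNl -ipNl//; apply: (le_trans (ip_young l0 (L2_opp Lu) Lv)).
  rewrite ipNl//; last exact: L2_opp.
  by rewrite ipC ipNl// opprK.
move: Y; have := ip_ge0 u; have := ip_ge0 v; rewrite -(real_normK (num_real (ip u v))).
set A := ip u u; set B := `|ip u v|; set C := ip v v => C0 A0 Y.
have B0 : 0 <= B by exact: normr_ge0.
(* If [u] has norm 0, a large weight makes the other term arbitrarily small. *)
have [A00|An] := eqVneq A 0.
  suff -> : B = 0 by rewrite expr0n/= A00 mul0r.
  apply/eqP; rewrite eq_le B0 andbT; apply/ler_addgt0Pr => e e0; rewrite add0r.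
  have l0 : 0 < (C + 1) / e by rewrite divr_gt0// ltr_wpDl.
  apply: (le_trans (Y _ l0)); rewrite A00 mulr0 add0r invf_div.
  rewrite ler_pdivrMr// -mulrA ler_wpM2l ?(ltW e0)//.
  rewrite mulrC ler_pdivrMr ?ltr_wpDl//; lra.
have Ap : 0 < A by rewrite lt_def An.
have [B00|Bn] := eqVneq B 0; first by rewrite B00 expr0n/= mulr_ge0.
have Bp : 0 < B by rewrite lt_def Bn.
(* This weight turns [l * A] into [B], so half of the left-hand side is absorbed and
   [B <= A / B * C] remains. *)
have l0 : 0 < B / A by rewrite divr_gt0.
have := Y _ l0; rewrite -mulrA mulVf// mulr1 invf_div => H.
have : B <= A / B * C by lra.
by rewrite mulrAC ler_pdivlMr// -expr2.
Qed.

Definition nrm u : R := Num.sqrt (ip u u).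

Lemma nrm_ge0 u : 0 <= nrm u. Proof. exact: sqrtr_ge0. Qed.

Lemma nrm_sq u : nrm u ^+ 2 = ip u u.
Proof. by rewrite sqr_sqrtr// ip_ge0. Qed.

Lemma ip_nrm u v : L2 u -> L2 v -> `|ip u v| <= nrm u * nrm v.
Proof.
move=> Lu Lv; rewrite -sqrtrM ?ip_ge0// -sqrtr_sqr ler_sqrt.
  exact: ip_sq_le.
by rewrite mulr_ge0 ?ip_ge0.
Qed.

Lemma L2normE u : L2 u -> L2norm u = (nrm u)%:E.
Proof.
move=> Lu; rewrite /L2norm unlock.
have -> : (\int[mu3]_x `|(EFin \o (@enorm R \o u)) x| `^ 2 = (ip u u)%:E)%E.
  rewrite /ip /Rintegral fineK; last exact: (integrable_fin_num _ (integrable_dot Lu Lu)).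
  apply: eq_integral => x _; rewrite /= powR_mulrn//.
  by rewrite ger0_norm ?sqrtr_ge0// enorm_sq.
by rewrite poweR_EFin /nrm -powR12_sqrt// ip_ge0.
Qed.

End vector_L2.

(** * Symmetry of the curl *)

Section fubini_R.
Context {d : measure_display} {T : measurableType d} {R : realType}.
Variable m : {sigma_finite_measure set T -> \bar R}.
Implicit Type h : T * T -> R.

Lemma Rintegral12 h : (m \x m)%E.-integrable setT (EFin \o h) ->
  (forall x, m.-integrable setT (EFin \o (fun y => h (x, y)))) ->
  \int[m]_x (\int[m]_y h (x, y)) = \int[(m \x m)%E]_z h z.
Proof.
move=> ih hx; rewrite /Rintegral; congr fine; rewrite -(integral12_prod_meas1 ih).
apply: eq_integral => x _; rewrite /fubini_F /= fineK//.
exact: integrable_fin_num (hx x).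
Qed.

Lemma Rintegral21 h : (m \x m)%E.-integrable setT (EFin \o h) ->
  (forall y, m.-integrable setT (EFin \o (fun x => h (x, y)))) ->
  \int[m]_y (\int[m]_x h (x, y)) = \int[(m \x m)%E]_z h z.
Proof.
move=> ih hx; rewrite /Rintegral; congr fine; rewrite -(integral21_prod_meas1 ih).
apply: eq_integral => y _; rewrite /fubini_G /= fineK//.
exact: integrable_fin_num (hx y).
Qed.

End fubini_R.

Lemma integrable_sum_ord {d : measure_display} {T : measurableType d} {R : realType}
    (m : {measure set T -> \bar R}) (n : nat) (h : 'I_n -> T -> R) :
  (forall i, m.-integrable setT (EFin \o h i)) ->
  m.-integrable setT (EFin \o (fun x => \sum_(i < n) h i x)).
Proof.
move=> ih; have := @integrable_sum _ _ _ m setT measurableT _ (index_enum 'I_n) xpredT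
  (fun i x => (h i x)%:E) (fun i _ => ih i).
by apply: eq_integrable => // x _; rewrite /= sumEFin.
Qed.

Lemma Rintegral_sum {d : measure_display} {T : measurableType d} {R : realType}
    (m : {measure set T -> \bar R}) (D : set T) (I : Type) (s : seq I) (h : I -> T -> R) :
  measurable D -> (forall i, m.-integrable D (EFin \o h i)) ->
  \int[m]_(x in D) (\sum_(i <- s) h i x) = \sum_(i <- s) \int[m]_(x in D) h i x.
Proof.
move=> mD ih; elim: s => [|i s IH].
  under eq_Rintegral do rewrite big_nil.
  by rewrite big_nil Rintegral_cst// mul0r.
under eq_Rintegral do rewrite big_cons.
rewrite big_cons RintegralD// ?IH//.
have := @integrable_sum _ _ _ m D mD _ s xpredT
  (fun i x => (h i x)%:E) (fun i _ => ih i).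
by apply: eq_integrable => // x _; rewrite /= sumEFin.
Qed.

Lemma ipE {R : realType} (u v : vfield R) : L2 u -> L2 v ->
  ip u v = \sum_(i < 3) \int[leb3 R]_x (u x ord0 i * v x ord0 i).
Proof.
move=> /L2P Hu /L2P Hv; rewrite /ip /dot.
exact: (Rintegral_sum _ measurableT (fun i => sqintM_integrable (Hu i) (Hv i))).
Qed.

Section curl_symmetry.
Context {R : realType}.
Local Notation R1 := (measurableTypeR R).
Local Notation X3 := (R1 * R1 * R1)%type.
Local Notation mu3 := (leb3 R).
Implicit Types (u v : vfield R).

Lemma continuous_support_bounded (q : R -> R) (M : R) : 0 <= M -> continuous q ->
  (forall s, M <= `|s| -> q s = 0) -> exists C : R, forall s, `|q s| <= C.
Proof.
move=> M0 cq q0.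
have cn : {within `[- M, M], continuous (fun s => `|q s|)}.
  apply: continuous_subspaceT => s.
  by apply: (continuous_comp (cq s)); exact: norm_continuous.
have MM : - M <= M by lra.
have [c _ Hc] := EVT_max MM cn.
exists `|q c| => s; have [Ms|sM] := leP M `|s|; first by rewrite q0// normr0.
by apply: Hc; rewrite in_itv/= -ler_norml ltW.
Qed.

Definition admissible_kernel (k : 'I_3 -> R -> R) := [/\
  (forall j, continuous (k j)) &
  exists2 M, 0 <= M & forall j s, M <= `|s| -> k j s = 0].

Lemma admissible_marginals k : admissible_kernel k ->
  exists C, marginals_le mu3 (fun z => `|tens k (z.1 - z.2)|) C.
Proof.
move=> [ck [M M0 kM]].
have [C0 H0] := continuous_support_bounded M0 (ck 0) (kM 0).
have [C1 H1] := continuous_support_bounded M0 (ck 1) (kM 1).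
have [C2 H2] := continuous_support_bounded M0 (ck 2%:R) (kM 2%:R).
pose C := C0 + C1 + C2.
have C00 : 0 <= C0 by exact: le_trans (H0 0).
have C10 : 0 <= C1 by exact: le_trans (H1 0).
have C20 : 0 <= C2 by exact: le_trans (H2 0).
have HC j s : 0 <= `|k j s| <= C.
  rewrite normr_ge0 /=; case: j => [[|[|[|//]]] j3].
  - rewrite (_ : Ordinal j3 = 0); last exact/val_inj.
    by apply: (le_trans (H0 s)); rewrite /C -addrA lerDl addr_ge0.
  - rewrite (_ : Ordinal j3 = 1); last exact/val_inj.
    by apply: (le_trans (H1 s)); rewrite /C addrAC lerDr addr_ge0.
  - rewrite (_ : Ordinal j3 = 2%:R); last exact/val_inj.
    by apply: (le_trans (H2 s)); rewrite /C lerDr addr_ge0.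
exists ((C * (M *+ 2)) ^+ 3).
have := @marginals_le_tens _ (fun j s => `|k j s|) M C M0 _ HC _.
rewrite /tens /=; under [X in _ -> _ -> marginals_le _ X _]eq_fun do rewrite -!normrM.
apply.
- move=> j; apply: measurableT_comp => //; exact: continuous_measurable_fun.
- by move=> j s Ms; rewrite kM// normr0.
Qed.

Lemma measurable_admissible k : admissible_kernel k ->
  measurable_fun [set: X3 * X3] (fun z => tens k (z.1 - z.2)).
Proof.
by move=> [ck _]; apply: measurable_tens_sub => j; exact: continuous_measurable_fun.
Qed.

Lemma admissible_sq k : admissible_kernel k -> admissible_kernel (fun j s => k j s ^+ 2).
Proof.
move=> [ck [M M0 kM]]; split.
  by move=> j s; apply: (cvgM (ck j s) (ck j s)).
by exists M => // j s Ms; rewrite kM// expr0n.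
Qed.

(** The square of a section is a section of the kernel with squared factors, to which the marginal
    bound applies. *)
Lemma sqint_slice1 k (x : X3) : admissible_kernel k ->
  sqint mu3 (fun y : X3 => tens k (x - y)).
Proof.
move=> ak; have [C [_ _ H _]] := admissible_marginals (admissible_sq ak).
split; first exact: (measurableT_comp (measurable_admissible ak) (measurable_pair1 x)).
apply: (le_lt_trans _ (ltry C)); apply: le_trans (H x).
rewrite le_eqVlt; apply/orP; left; apply/eqP; apply: eq_integral => y _.
congr EFin; rewrite /tens /= -!exprMn ger0_norm// sqr_ge0//.
Qed.

Lemma sqint_slice2 k (y : X3) : admissible_kernel k ->
  sqint mu3 (fun x : X3 => tens k (x - y)).
Proof.
move=> ak; have [C [_ _ _ H]] := admissible_marginals (admissible_sq ak).
split; first exact: (measurableT_comp (measurable_admissible ak) (measurable_pair2 y)).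
apply: (le_lt_trans _ (ltry C)); apply: le_trans (H y).
rewrite le_eqVlt; apply/orP; left; apply/eqP; apply: eq_integral => x _.
congr EFin; rewrite /tens /= -!exprMn ger0_norm// sqr_ge0//.
Qed.

Lemma integrable_admissible k a g : admissible_kernel k ->
  sqint mu3 a -> sqint mu3 g ->
  (mu3 \x mu3)%E.-integrable setT (EFin \o (fun z => a z.1 * g z.2 * tens k (z.1 - z.2))).
Proof.
move=> ak sa sg; have [C HC] := admissible_marginals ak.
exact: (integrable_kernel sa sg HC (measurable_admissible ak)).
Qed.

(* Tensor fields [tens k *: w] are the only test fields that the mollification
   argument for [wcurl_sym] needs. *)
Definition wcurl u v := [/\ L2 u, L2 v &
  forall (k : 'I_3 -> R -> R) (w : 'rV[R]_3), (forall j, smooth1 (k j)) ->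
    (exists M, forall j s, M <= `|s| -> k j s = 0) ->
    \int[mu3]_x dot (u x) (cross (tens_grad k x) w) =
    \int[mu3]_x dot (v x) (tens k x *: w)].

Lemma Hcurl_wcurl u v : Hcurl u v -> wcurl u v.
Proof.
move=> [Lu Lv H]; split => // k w sk [M kM].
by rewrite -H; [under [RHS]eq_Rintegral do rewrite curl_tens//|exact: test_field_tens kM].
Qed.

Let bk n : 'I_3 -> R -> R := fun _ => bumpn n.
Let gk n i := tens_upd (bk n) i.

Let smooth_bk n j : smooth1 (bk n j).
Proof. exact/smooth_class_smooth1/smooth_bumpn. Qed.

Let db_out n s : 2 <= `|s| -> (bumpn n)^`()%classic s = 0 :> R.
Proof.
move=> s2.
have n1 : n.+1%:R^-1 <= 1 :> R by rewrite invf_le1// ler1n.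
(* The distance 2 leaves room for the unit ball around [s], on which [|t|] still exceeds 1. *)
have H : \forall t \near s, bumpn n t = cst 0 t.
  near=> t; rewrite bumpn_out//; apply: (le_trans n1).
  have : ball s 1 t by near: t; exact: nbhsx_ballx.
  rewrite /ball /= => st.
  have := ler_normD (s - t) t; rewrite subrK; lra.
by rewrite derive1E (near_eq_derive _ H) derive_cst.
Unshelve. all: by end_near. Qed.

Let adm_bk n : admissible_kernel (bk n).
Proof.
split; first by move=> j; exact: smooth1_continuous.
by exists n.+1%:R^-1 => // j s; exact: bumpn_out.
Qed.

Let adm_gk n i : admissible_kernel (gk n i).
Proof.
split; first by move=> j; apply: smooth1_continuous; exact: smooth1_tens_upd.
exists 2 => // j s s2; rewrite /gk /tens_upd /bk; case: ifPn => _; first exact: db_out.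
have n1 : n.+1%:R^-1 <= 1 :> R by rewrite invf_le1// ler1n.
by apply: bumpn_out; apply: (le_trans n1); apply: le_trans s2; rewrite ler1n.
Qed.

Let pr (x : R3 R) (j : 'I_3) : R := if j == 0 then x.1.1 else if j == 1 then x.1.2 else x.2.

(** With [y] frozen the mollifier is again a tensor product in [x], hence an allowed test function
    in [wcurl]. *)
Let shk n (y : R3 R) : 'I_3 -> R -> R := fun j s => bumpn n (s - pr y j).

Let is_derive_shift (f : R -> R) (c s : R) : derivable f (s - c) 1 ->
  is_derive s 1 (fun t : R => f (t - c)) (f^`()%classic (s - c)).
Proof.
move=> df.
have -> : (fun t : R => f (t - c)) = f \o (fun t => t - c) by [].
have d1 : is_derive (s - c) 1 f (f^`()%classic (s - c)).
  by rewrite derive1E; exact: derivableP.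
have d2 : is_derive s 1 (fun t : R => t - c) 1.
  apply: (is_derive_eq (is_deriveB (is_derive_id s 1) (is_derive_cst c s 1))).
  by rewrite subr0.
by have := @is_derive1_comp _ f (fun t : R => t - c) s _ _ d1 d2; rewrite mulr1.
Qed.

Let smooth_shk n y j : smooth1 (shk n y j).
Proof.
apply: smooth_class_smooth1; have := smooth_aff 1 (- pr y j) (smooth_bumpn (R := R) n).
by congr smooth_class; apply/funext => s; rewrite mul1r.
Qed.

Let supp_shk n y : exists M, forall j s, M <= `|s| -> shk n y j s = 0.
Proof.
exists (1 + `|y.1.1| + `|y.1.2| + `|y.2|) => j s Ms; apply: bumpn_out.
have n1 : n.+1%:R^-1 <= 1 :> R by rewrite invf_le1// ler1n.
apply: (le_trans n1); have := ler_normD (s - pr y j) (pr y j); rewrite subrK.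
have := normr_ge0 y.1.1; have := normr_ge0 y.1.2; have := normr_ge0 y.2.
by rewrite /pr; case: ifPn => _; [|case: ifPn => _]; lra.
Qed.

Let tens_shk n x y : tens (shk n y) x = mollifier n (x, y).
Proof. by []. Qed.

Let G n x y : 'rV[R]_3 := \row_i tens (gk n i) (x - y).

Let grad_shk n x y : tens_grad (shk n y) x = G n x y.
Proof.
apply/rowP => i; rewrite !mxE.
have E j : tens_upd (shk n y) i j = fun s => gk n i j (s - pr y j).
  rewrite /tens_upd /gk /tens_upd; case: ifPn => _; last by [].
  apply/funext => s; rewrite derive1E; apply: derive_val.
  exact/is_derive_shift/smooth1_derivable/smooth_bk.
by rewrite /tens !E.
Qed.

(** The bump is even and its derivative odd, and each component of the gradient contains exactly one
    differentiated factor. *)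
Let G_anti n x y : G n y x = - G n x y.
Proof.
apply/rowP => i; rewrite !mxE.
have dodd s : (bumpn n)^`()%classic (- s) = - (bumpn n)^`()%classic s :> R.
  have db : derivable (bumpn n : R -> R) (- s) 1.
    exact/smooth1_derivable/smooth_class_smooth1/smooth_bumpn.
  have d1 : is_derive (- s) 1 (bumpn n : R -> R) ((bumpn n)^`()%classic (- s)).
    by rewrite derive1E; exact: derivableP.
  have d2 : is_derive s 1 (-%R : R -> R) (-1) by exact: is_deriveNid.
  have := @is_derive1_comp _ (bumpn n) -%R s _ _ d1 d2.
  have -> : bumpn n \o -%R = (bumpn n : R -> R).
    by apply/funext => t /=; exact: bumpn_even.
  by move=> d; rewrite [in RHS]derive1E derive_val mulrN1 opprK.
have E j s : gk n i j (- s) = (if j == i then -1 else 1) * gk n i j s.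
  rewrite /gk /tens_upd /bk; case: ifPn => _; first by rewrite dodd mulN1r.
  by rewrite bumpn_even mul1r.
rewrite /tens -(opprB x y) /= !E.
case: i E => [[|[|[|//]]] i3] E /=; ring.
Qed.

(* Both sides are limits of integrals against [mollifier n (x, y)]; testing the curl
   of [u] in [x] and that of [v] in [y] yields the same double integral, because the
   gradient [G n] is antisymmetric in [x] and [y]. *)
Lemma wcurl_sym u cu v cv : wcurl u cu -> wcurl v cv -> ip cu v = ip u cv.
Proof.
move=> [Lu Lcu Hu] [Lv Lcv Hv].
pose h n (z : X3 * X3) := dot (u z.1) (cross (G n z.1 z.2) (v z.2)).
pose S1 n := \int[(mu3 \x mu3)%E]_z (dot (cu z.1) (v z.2) * mollifier n z).
pose S2 n := \int[(mu3 \x mu3)%E]_z (dot (u z.1) (cv z.2) * mollifier n z).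
have su := (L2P u).1 Lu.
have scu := (L2P cu).1 Lcu.
have sv := (L2P v).1 Lv.
have scv := (L2P cv).1 Lcv.
have dm (a b : vfield R) n z : dot (a z.1) (b z.2) * mollifier n z =
    \sum_(i < 3) (a z.1 ord0 i * b z.2 ord0 i * tens (bk n) (z.1 - z.2)).
  by rewrite /dot mulr_suml.
have cvgS (a b : vfield R) : L2 a -> L2 b ->
    \int[(mu3 \x mu3)%E]_z (dot (a z.1) (b z.2) * mollifier n z) @[n --> \oo] --> ip a b.
  move=> La Lb; rewrite ipE//.
  have sa := (L2P a).1 La.
  have sb := (L2P b).1 Lb.
  have E n : \int[(mu3 \x mu3)%E]_z (dot (a z.1) (b z.2) * mollifier n z) =
      \sum_(i < 3) \int[(mu3 \x mu3)%E]_z (a z.1 ord0 i * b z.2 ord0 i * mollifier n z).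
    under eq_Rintegral do rewrite dm.
    exact: (Rintegral_sum _ measurableT (fun i => integrable_admissible (adm_bk n) (sa i) (sb i))).
  rewrite (funext E); elim: (index_enum _) => [|i s IH].
    by rewrite big_nil; under eq_fun do rewrite big_nil; exact: cvg_cst.
  rewrite big_cons; under eq_fun do rewrite big_cons.
  by apply: cvgD => //; exact: cvg_mollifier.
have hE n z : h n z = \sum_(i < 3) (
    u z.1 ord0 i * v z.2 ord0 (i + 2%:R) * tens (gk n (i + 1)) (z.1 - z.2) -
    u z.1 ord0 i * v z.2 ord0 (i + 1) * tens (gk n (i + 2%:R)) (z.1 - z.2)).
  rewrite /h /dot; apply: eq_bigr => i _; rewrite !mxE; ring.
have ih n : (mu3 \x mu3)%E.-integrable setT (EFin \o h n).
  have := @integrable_sum_ord _ _ _ (mu3 \x mu3)%E _ _ (fun i => integrableB measurableT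
    (integrable_admissible (adm_gk n (i + 1)) (su i) (sv (i + 2%:R)))
    (integrable_admissible (adm_gk n (i + 2%:R)) (su i) (sv (i + 1)))).
  by apply: eq_integrable => // z _; rewrite /= hE.
have slice1 (a : vfield R) (w : 'I_3 -> R) (kk : 'I_3 -> 'I_3 -> R -> R) x :
    L2 a -> (forall i, admissible_kernel (kk i)) ->
    mu3.-integrable setT (EFin \o (fun y : X3 =>
      \sum_(i < 3) (w i * (a y ord0 i * tens (kk i) (x - y))))).
  move=> /L2P sa ak.
  apply: integrable_sum_ord => i.
  exact: (integrableZl measurableT (w i) (sqintM_integrable (sa i) (sqint_slice1 x (ak i)))).
have slice2 (a : vfield R) (w : 'I_3 -> R) (kk : 'I_3 -> 'I_3 -> R -> R) y :
    L2 a -> (forall i, admissible_kernel (kk i)) ->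
    mu3.-integrable setT (EFin \o (fun x : X3 =>
      \sum_(i < 3) (w i * (a x ord0 i * tens (kk i) (x - y))))).
  move=> /L2P sa ak.
  apply: integrable_sum_ord => i.
  exact: (integrableZl measurableT (w i) (sqintM_integrable (sa i) (sqint_slice2 y (ak i)))).
have hx n x : mu3.-integrable setT (EFin \o (fun y => h n (x, y))).
  have := integrableB measurableT
    (slice1 v (fun i => u x ord0 (i - 2%:R)) (fun i => gk n (i - 2%:R + 1)) x Lv
      (fun i => adm_gk n _))
    (slice1 v (fun i => u x ord0 (i - 1)) (fun i => gk n (i - 1 + 2%:R)) x Lv
      (fun i => adm_gk n _)).
  (* The sum defining [h] runs over the components of [u], whereas [slice1] wants those of [v]; the
     indices are shifted by 2 and by 1 modulo 3. *)
  apply: eq_integrable => // y _; rewrite /= -EFinB hE; congr EFin.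
  rewrite sumrB; congr (_ - _).
    rewrite (reindex_inj (addIr (2%:R : 'I_3))) /=.
    by apply: eq_bigr => i _; rewrite addrK; ring.
  rewrite (reindex_inj (addIr (1 : 'I_3))) /=.
  by apply: eq_bigr => i _; rewrite addrK; ring.
have hy n y : mu3.-integrable setT (EFin \o (fun x => h n (x, y))).
  have := integrableB measurableT
    (slice2 u (fun i => v y ord0 (i + 2%:R)) (fun i => gk n (i + 1)) y Lu
      (fun i => adm_gk n _))
    (slice2 u (fun i => v y ord0 (i + 1)) (fun i => gk n (i + 2%:R)) y Lu
      (fun i => adm_gk n _)).
  apply: eq_integrable => // x _; rewrite /= -EFinB hE; congr EFin.
  by rewrite sumrB; congr (_ - _); apply: eq_bigr => i _; ring.
have E1 n : \int[(mu3 \x mu3)%E]_z h n z = S1 n.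
  rewrite -(Rintegral21 (ih n) (hy n)) /S1 -Rintegral21.
  - apply: eq_Rintegral => y _; rewrite /h /=.
    under eq_Rintegral do rewrite -grad_shk.
    rewrite Hu//; apply: eq_Rintegral => x _.
    by rewrite dotZr tens_shk mulrC.
  - have := integrable_sum_ord (fun i => integrable_admissible (adm_bk n) (scu i) (sv i)).
    by apply: eq_integrable => // z _; rewrite /= dm.
  - move=> y; have := slice2 cu (fun i => v y ord0 i) (fun i => bk n) y Lcu
      (fun i => adm_bk n).
    apply: eq_integrable => // x _; rewrite /= (dm cu v n (x, y)); congr EFin.
    by apply: eq_bigr => i _ /=; ring.
have E2 n : \int[(mu3 \x mu3)%E]_z h n z = S2 n.
  rewrite -(Rintegral12 (ih n) (hx n)) /S2 -Rintegral12.
  - apply: eq_Rintegral => x _; rewrite /h /=.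
    (* Two signs cancel: [u.(G(x,y) x v) = - v.(G(x,y) x u) = v.(G(y,x) x u)], and [G(y,x)] is the
       gradient in [y] of the mollifier. *)
    under eq_Rintegral do rewrite dot_crossC -(opprK (G n x _)) -G_anti
      -dotNr.
    transitivity (\int[mu3]_y dot (v y) (cross (G n y x) (u x))).
      apply: eq_Rintegral => y _; congr dot; apply/rowP => i; rewrite !mxE.
      ring.
    under eq_Rintegral do rewrite -grad_shk.
    rewrite Hv//; apply: eq_Rintegral => y _.
    by rewrite dotZr tens_shk mulrC mollifier_sym dotC.
  - have := integrable_sum_ord (fun i => integrable_admissible (adm_bk n) (su i) (scv i)).
    by apply: eq_integrable => // z _; rewrite /= dm.
  - move=> x; have := slice1 cv (fun i => u x ord0 i) (fun i => bk n) x Lcv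
      (fun i => adm_bk n).
    apply: eq_integrable => // y _; rewrite /= (dm u cv n (x, y)); congr EFin.
    by apply: eq_bigr => i _ /=; ring.
have S12 : S1 = S2 by apply/funext => n; rewrite -E1 E2.
have c1 : S1 n @[n --> \oo] --> ip cu v by exact: cvgS.
have c2 : S2 n @[n --> \oo] --> ip u cv by exact: cvgS.
by move: c2; rewrite -S12 => c2; exact: (cvg_unique _ c1 c2).
Qed.

End curl_symmetry.

(** * Laplace transforms of L2-valued curves *)

Lemma cvg_div_exp2 {R : realType} (c : R) : c / 2 ^+ n @[n --> \oo] --> 0.
Proof.
rewrite (_ : (fun n => _) = (fun n => c * 2^-1 ^+ n)); last first.
  by apply/funext => n; rewrite exprVn.
rewrite -[X in _ --> X](mulr0 c); apply: cvgMr; apply: cvg_expr.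
by rewrite ger0_norm ?invr_ge0// invf_lt1// ltr1n.
Qed.

Section riesz_fischer.
Context {d : measure_display} {T : measurableType d} {R : realType}.
Variable m : {measure set T -> \bar R}.

Let half_pow (n : nat) : 0 < (2 ^+ n)^-1 :> R.
Proof. by rewrite invr_gt0 exprn_gt0. Qed.

(** Cauchy-Schwarz with geometric weights. In the induction [(p + q) ^+ 2 <= 2 p ^+ 2 + 2 q ^+ 2]
    loses a factor 2, which the passage from [N] to [N.+1] gives back. *)
Lemma sq_telescope_le (u : nat -> R) k N :
  (u (N + k)%N - u N) ^+ 2 <= 2 / 2 ^+ N *
  \sum_(i < k) 2 ^+ (N + i) * (u (N + i).+1 - u (N + i)%N) ^+ 2.
Proof.
elim: k N => [|k IH] N; first by rewrite addn0 subrr expr0n/= big_ord0 mulr0.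
rewrite big_ord_recl /= addn0 mulrDr.
have := IH N.+1.
have -> : \sum_(i < k) 2 ^+ (N.+1 + i) * (u (N.+1 + i).+1 - u (N.+1 + i)%N) ^+ 2 =
    \sum_(i < k) 2 ^+ (N + fintype.bump 0 i) * (u (N + fintype.bump 0 i).+1 - u (N + fintype.bump 0 i)%N) ^+ 2.
  by apply: eq_bigr => i _; rewrite /fintype.bump /= add1n addnS addSn.
set S := \sum_(i < k) _; rewrite addSnnS.
set a := u (N + k.+1)%N; set b := u N.+1; set c := u N => H.
have -> : 2 / 2 ^+ N * (2 ^+ N * (b - c) ^+ 2) = 2 * (b - c) ^+ 2 :> R.
  by rewrite mulrA divfK// expf_neq0.
have -> : 2 / 2 ^+ N * S = 2 * (2 / 2 ^+ N.+1 * S).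
  by rewrite exprS invfM; field; rewrite expf_neq0.
apply: (@le_trans _ _ (2 * (b - c) ^+ 2 + 2 * (a - b) ^+ 2)).
  by have := sqr_ge0 ((a - b) - (b - c)); nra.
by rewrite lerD2l ler_wpM2l.
Qed.

(** The series [G] of squared increments weighted by [2 ^+ n] has integral at most [2 * C], and
    [2 / 2 ^+ N * G] dominates every [(s n - s N) ^+ 2] with [n >= N]. The same function thus gives
    pointwise convergence where it is finite and, after integration, the explicit rate. *)
Lemma riesz_fischer (s : nat -> T -> R) (C : R) : 0 <= C ->
  (forall n, measurable_fun setT (s n)) ->
  (forall n, (\int[m]_x ((s n.+1 x - s n x) ^+ 2)%:E <= (C / 4 ^+ n)%:E)%E) ->
  exists w : T -> R, measurable_fun setT w /\
    forall N, (\int[m]_x ((w x - s N x) ^+ 2)%:E <= (C * 4 / 2 ^+ N)%:E)%E.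
Proof.
move=> C0 ms ds.
pose t n x : R := 2 ^+ n * (s n.+1 x - s n x) ^+ 2.
have t0 n x : 0 <= t n x by apply: mulr_ge0; rewrite ?sqr_ge0 ?exprn_ge0.
have md n : measurable_fun setT (fun x => s n.+1 x - s n x) by exact: measurable_funB.
have mt n : measurable_fun setT (fun x => (t n x)%:E).
  by apply/measurable_EFinP; apply: measurable_funM => //; exact: measurable_funX.
pose G x : \bar R := (\sum_(0 <= n <oo) (t n x)%:E)%E.
have G0 x : (0 <= G x)%E by apply: nneseries_ge0 => n _ _; rewrite lee_fin.
have mG : measurable_fun setT G.
  by apply: ge0_emeasurable_sum => // n x _ _; rewrite lee_fin.
have iG : (\int[m]_x G x <= (2 * C)%:E)%E.
  rewrite integral_nneseries//; last by move=> n x _; rewrite lee_fin.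
  have C2 : 0 <= 2 * C by rewrite mulr_ge0.
  (* The terms [2 ^+ n * (C / 4 ^+ n)] equal [2 * C / 2 ^+ n.+1], the geometric series summed by
     this lemma. *)
  have := @epsilon_trick R (fun=> 0%E) (2 * C) xpredT (fun=> lexx _) C2.
  rewrite [X in (_ <= X + _)%E]eseries0// add0e; apply: le_trans.
  apply: lee_nneseries.
    by move=> n _ _; apply: integral_ge0 => x _; rewrite lee_fin.
  move=> n _; rewrite add0e.
  under eq_integral do rewrite /t EFinM.
  rewrite ge0_integralZl//; last 2 first.
  - exact: measurable_EFin_sq.
  - by move=> x _; rewrite lee_fin sqr_ge0.
  apply: (@le_trans _ _ ((2 ^+ n)%:E * (C / 4 ^+ n)%:E)%E).
    by rewrite lee_wpmul2l// lee_fin exprn_ge0.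
  rewrite -EFinM lee_fin le_eqVlt; apply/orP; left; apply/eqP.
  rewrite natrX exprS (_ : 4 = 2 * 2 :> R); last by ring.
  by rewrite exprMn; field; rewrite expf_neq0.
have bnd x N n : (N <= n)%N -> (((s n x - s N x) ^+ 2)%:E <= (2 / 2 ^+ N)%:E * G x)%E.
  move=> Nn; have := sq_telescope_le (fun k => s k x) (n - N) N; rewrite subnKC// => H.
  apply: (@le_trans _ _ ((2 / 2 ^+ N)%:E * (\sum_(i < n - N) t (N + i)%N x)%:E)%E).
    by rewrite -EFinM lee_fin.
  rewrite lee_wpmul2l ?lee_fin ?mulr_ge0 ?(ltW (half_pow _))//.
  apply: (@le_trans _ _ (\sum_(0 <= i < n) (t i x)%:E)%E); last first.
    by apply: nneseries_lim_ge => i _ _; rewrite lee_fin.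
  rewrite sumEFin lee_fin (@big_cat_nat _ _ _ N)//=.
  have -> : \sum_(N <= i < n) t i x = \sum_(i < n - N) t (N + i)%N x.
    rewrite -{1}(add0n N) big_addn big_mkord.
    by apply: eq_bigr => i _; rewrite addnC.
  by rewrite lerDr sumr_ge0.
(* Off this set the limit is put to 0 through the indicator, and the final pointwise bound is
   trivial there, its right-hand side being infinite. *)
pose A := [set x | (G x < +oo)%E].
have mA : measurable A by rewrite -[A]setTI; exact: emeasurable_fun_infty_o.
have cA x : exists l : R, s n x * \1_A x @[n --> \oo] --> l.
  have [Ax|Ax] := pselect (A x); last first.
    exists 0; apply: cvg_near_cst; apply: nearW => n.
    by rewrite indicE memNset// mulr0.
  suff : cvg (s n x @[n --> \oo]).
    move=> /cvg_ex[l Hl]; exists l; rewrite indicE mem_set//=.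
    by under eq_fun do rewrite mulr1.
  apply/cauchy_cvgP; apply: cauchy_exP => e e0.
  have GE : (G x = (fine (G x))%:E)%E by rewrite fineK// ge0_fin_numE.
  have g0 : 0 <= fine (G x) by exact: fine_ge0.
  have c0 : 2 / 2 ^+ n * fine (G x) @[n --> \oo] --> (0 : R).
    rewrite (_ : (fun n => _) = (fun n => 2 * fine (G x) / 2 ^+ n)).
      exact: cvg_div_exp2.
    by apply/funext => n; rewrite mulrAC.
  have /cvgr0Pnorm_lt/(_ (e ^+ 2))[|N _ HN] := c0; first by rewrite exprn_gt0.
  exists (s N x); exists N => // n /= Nn; rewrite /ball /=.
  have := bnd x N n Nn; rewrite GE -EFinM lee_fin => H.
  have := HN N (leqnn N) => /=; rewrite ger0_norm; last first.
    by rewrite mulr_ge0// mulr_ge0// ltW.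
  move=> /(le_lt_trans H); rewrite -(real_normK (num_real (_ - _))).
  by rewrite ltr_sqr ?nnegrE ?(ltW e0)// distrC.
have [w cw] := choice cA.
have mw : measurable_fun setT w.
  apply: (@measurable_fun_cvg _ _ _ _ (fun n x => s n x * \1_A x)) => //.
  by move=> n; apply: measurable_funM => //; exact: measurable_indic.
exists w; split => // N.
have mwN : measurable_fun setT (fun x => w x - s N x) by exact: measurable_funB.
apply: (@le_trans _ _ (\int[m]_x ((2 / 2 ^+ N)%:E * G x))%E); last first.
  rewrite ge0_integralZl ?lee_fin ?mulr_ge0 ?(ltW (half_pow _))//.
  apply: (@le_trans _ _ ((2 / 2 ^+ N)%:E * (2 * C)%:E)%E).
    by rewrite lee_wpmul2l ?lee_fin ?mulr_ge0 ?(ltW (half_pow _)).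
  by rewrite -EFinM lee_fin le_eqVlt; apply/orP; left; apply/eqP; ring.
apply: ge0_le_integral => //.
- by move=> x _; rewrite lee_fin sqr_ge0.
- exact: measurable_EFin_sq.
- exact: measurable_funeM.
move=> x _; have [Ax|Ax] := pselect (A x); last first.
  move: Ax; rewrite /A /= => /negP; rewrite -leNgt leye_eq => /eqP ->.
  by rewrite gt0_muley ?leey// lte_fin mulr_gt0.
have GE : (G x = (fine (G x))%:E)%E by rewrite fineK// ge0_fin_numE.
rewrite GE -EFinM lee_fin.
have c : (s n x - s N x) ^+ 2 @[n --> \oo] --> (w x - s N x) ^+ 2.
  have c1 : s n x - s N x @[n --> \oo] --> w x - s N x.
    apply: cvgB; last exact: cvg_cst.
    have := cw x; rewrite indicE mem_set//=.
    by under [fun n => s n x * _]eq_fun do rewrite mulr1.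
  exact: (cvgM c1 c1).
rewrite -(cvg_lim (@Rhausdorff R) c); apply: limr_le.
  by apply/cvg_ex; eexists; exact: c.
exists N => // n /= Nn; have := bnd x N n Nn; rewrite GE -EFinM lee_fin.
by [].
Qed.

End riesz_fischer.

Section norm_triangle.
Context {R : realType}.
Implicit Types u v : vfield R.

Lemma nrmD u v : L2 u -> L2 v -> nrm (fun x => u x + v x) <= nrm u + nrm v.
Proof.
move=> Lu Lv; have Luv := L2_add Lu Lv.
rewrite -ler_sqr ?nnegrE ?addr_ge0 ?nrm_ge0// nrm_sq ipDl//.
rewrite !(ipC _ (fun x => u x + v x)) !ipDl// sqrrD !nrm_sq (ipC v u).
have := ler_norm (ip u v); have := ip_nrm Lu Lv; nra.
Qed.

Lemma nrm_dist u v : L2 u -> L2 v -> `|nrm u - nrm v| <= nrm (fun x => u x - v x).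
Proof.
have half u1 v1 : L2 u1 -> L2 v1 -> nrm u1 - nrm v1 <= nrm (fun x => u1 x - v1 x).
  move=> L1 L2'; rewrite lerBlDr; apply: le_trans (nrmD (L2_sub L1 L2') L2').
  by rewrite (_ : (fun x => u1 x - v1 x + v1 x) = u1)//; apply/funext => x; rewrite subrK.
move=> Lu Lv; rewrite ler_norml; apply/andP; split; last exact: half.
rewrite lerNl opprB; apply: (le_trans (half _ _ Lv Lu)).
rewrite le_eqVlt; apply/orP; left; apply/eqP; rewrite /nrm; congr Num.sqrt.
by apply: eq_Rintegral => x _; rewrite -opprB dotNl dotNr opprK.
Qed.

(** Duality, by testing against [u] itself; it converts bounds on pairings into norm bounds. *)
Lemma nrm_le_of_ip u (c : R) : L2 u -> 0 <= c ->
  (forall v, L2 v -> `|ip u v| <= c * nrm v) -> nrm u <= c.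
Proof.
move=> Lu c0 H; have := le_trans (ler_norm _) (H u Lu); rewrite -nrm_sq expr2.
have [->|n0] := eqVneq (nrm u) 0; first by [].
by rewrite ler_pM2r// lt_def n0 nrm_ge0.
Qed.

Lemma integral_comp_le u i : L2 u ->
  (\int[leb3 R]_x (u x ord0 i ^+ 2)%:E <= (ip u u)%:E)%E.
Proof.
move=> Lu; have su := (L2P u).1 Lu; rewrite /ip /Rintegral fineK; last first.
  exact: (integrable_fin_num _ (integrable_dot Lu Lu)).
apply: ge0_le_integral => //.
- by move=> x _; rewrite lee_fin sqr_ge0.
- by apply: measurable_EFin_sq; have [] := su i.
- exact: measurable_int (integrable_dot Lu Lu).
- move=> x _; rewrite lee_fin /dot (bigD1 i)//= -expr2 lerDl.
  by apply: sumr_ge0 => j _; rewrite -expr2 sqr_ge0.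
Qed.

Lemma row_subE (a b : 'rV[R]_3) i : (a - b) ord0 i = a ord0 i - b ord0 i.
Proof. by rewrite !mxE. Qed.

Lemma ip_le_comp u (c : R) : L2 u ->
  (forall i, (\int[leb3 R]_x (u x ord0 i ^+ 2)%:E <= c%:E)%E) -> ip u u <= c *+ 3.
Proof.
move=> Lu H; have -> : c *+ 3 = \sum_(i < 3) c by rewrite sumr_const card_ord.
rewrite ipE//; apply: ler_sum => i _.
rewrite -lee_fin /Rintegral fineK; first exact: H.
apply: integrable_fin_num => //; apply: sqintM_integrable; exact: (L2P u).1.
Qed.

End norm_triangle.

(** * Integration of weakly Lipschitz curves by dyadic Riemann sums *)

Section weak_integral.
Context {R : realType}.
Local Notation mu := (@lebesgue_measure R).
Variables (K : R -> vfield R) (A B L : R).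
Hypothesis L0 : 0 <= L.
Hypothesis LK : forall t, t \in `[A, B] -> L2 (K t).
Hypothesis lipK : forall phi, L2 phi -> forall s t, s \in `[A, B] -> t \in `[A, B] ->
  `|ip (K s) phi - ip (K t) phi| <= L * `|s - t| * nrm phi.

(** The left Riemann sum over [2 ^+ n] equal pieces. Recursive bisection lets the estimates pass
    from two half intervals to the whole. *)
Fixpoint riem (n : nat) (a b : R) : vfield R :=
  if n is n'.+1 then
    (fun x => riem n' a ((a + b) / 2) x + riem n' ((a + b) / 2) b x)
  else (fun x => (b - a) *: K a x).

Let mid a b : A <= a -> a <= b -> b <= B -> [/\ A <= (a + b) / 2, a <= (a + b) / 2,
  (a + b) / 2 <= b & (a + b) / 2 <= B].
Proof. by move=> *; split; lra. Qed.

Lemma L2_riem n a b : A <= a -> a <= b -> b <= B -> L2 (riem n a b).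
Proof.
elim: n a b => [|n IH] a b Aa ab bB /=.
  by apply/L2_scale/LK; rewrite in_itv/= Aa (le_trans ab).
by have [? ? ? ?] := mid Aa ab bB; apply: L2_add; apply: IH.
Qed.

Let ip_riemS n a b phi : L2 phi -> A <= a -> a <= b -> b <= B ->
  ip (riem n.+1 a b) phi =
  ip (riem n a ((a + b) / 2)) phi + ip (riem n ((a + b) / 2) b) phi.
Proof.
move=> Lp Aa ab bB; have [? ? ? ?] := mid Aa ab bB.
by rewrite /= ipDl//; apply: L2_riem.
Qed.

Let ip_riem0 a b phi : L2 phi -> A <= a -> a <= b -> b <= B ->
  ip (riem 0 a b) phi = (b - a) * ip (K a) phi.
Proof.
move=> Lp Aa ab bB; rewrite /= ipZl//.
by apply: LK; rewrite in_itv/= Aa (le_trans ab).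
Qed.

(** Bisecting an interval of length [h] changes the sum by at most [L h ^+ 2]. Two halves together
    contribute [2 (h / 2) ^+ 2 = h ^+ 2 / 2], hence a factor 1/2 per level. *)
Lemma riem_step n a b phi : L2 phi -> A <= a -> a <= b -> b <= B ->
  `|ip (riem n.+1 a b) phi - ip (riem n a b) phi| <=
  L * (b - a) ^+ 2 / 2 ^+ n * nrm phi.
Proof.
move=> Lp; have p0 := nrm_ge0 phi.
elim: n a b => [|n IH] a b Aa ab bB; have [m1 m2 m3 m4] := mid Aa ab bB.
  rewrite ip_riemS// !ip_riem0//; set m := (a + b) / 2.
  have -> : (m - a) * ip (K a) phi + (b - m) * ip (K m) phi - (b - a) * ip (K a) phi =
      (b - m) * (ip (K m) phi - ip (K a) phi) by rewrite /m; field.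
  rewrite normrM expr0 divr1.
  have H := lipK Lp (s := m) (t := a); rewrite !in_itv/= in H.
  have {H} := H _ _; rewrite m1 m4 Aa (le_trans ab bB) => /(_ isT isT) H.
  rewrite ger0_norm ?subr_ge0//.
  apply: (le_trans (ler_wpM2l _ H)); first by rewrite subr_ge0.
  rewrite (ger0_norm (_ : 0 <= m - a)) ?subr_ge0//.
  have -> : (b - m) * (L * (m - a) * nrm phi) = L * ((b - m) * (m - a)) * nrm phi by ring.
  rewrite ler_wpM2r// ler_wpM2l//.
  have : 0 <= b - a by rewrite subr_ge0.
  by rewrite /m => ba; nra.
rewrite (ip_riemS n.+1 Lp Aa ab bB) (ip_riemS n Lp Aa ab bB).
set m := (a + b) / 2.
have H1 := IH _ _ Aa m2 m4; have H2 := IH _ _ m1 m3 bB.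
rewrite -/m in H1 H2.
have -> : ip (riem n.+1 a m) phi + ip (riem n.+1 m b) phi -
   (ip (riem n a m) phi + ip (riem n m b) phi) =
   (ip (riem n.+1 a m) phi - ip (riem n a m) phi) +
   (ip (riem n.+1 m b) phi - ip (riem n m b) phi) by ring.
apply: (le_trans (ler_normD _ _)); apply: (le_trans (lerD H1 H2)).
rewrite -mulrDl ler_wpM2r// le_eqVlt; apply/orP; left; apply/eqP.
by rewrite (exprS (2 : R) n) /m; field; rewrite expf_neq0.
Qed.

Let cont_k phi : L2 phi -> {within `[A, B], continuous (fun t => ip (K t) phi)}.
Proof.
move=> Lp; apply/subspace_continuousP => t tAB; apply/cvgrPdist_le => e e0.
have c0 : 0 < L * nrm phi + 1 by rewrite ltr_wpDl// mulr_ge0// nrm_ge0.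
near=> s.
have sAB : s \in `[A, B] by near: s; exact: withinT.
have st : `|t - s| <= e / (L * nrm phi + 1).
  near: s; apply: (cvg_within (F := nbhs t)).
  have : ball t (e / (L * nrm phi + 1)) = [set s | `|t - s| < e / (L * nrm phi + 1)] by [].
  move=> Hb; apply: filterS (nbhsx_ballx t (e / (L * nrm phi + 1)) _).
    by move=> s; rewrite Hb /= => /ltW.
  by rewrite divr_gt0.
apply: (le_trans (lipK Lp tAB sAB)); rewrite mulrAC.
apply: (@le_trans _ _ ((L * nrm phi + 1) * `|t - s|)).
  by rewrite ler_wpM2r// lerDl.
by rewrite mulrC -ler_pdivlMr.
Unshelve. all: by end_near. Qed.

Let int_k a b phi : L2 phi -> A <= a -> b <= B ->
  mu.-integrable `[a, b] (EFin \o (fun t => ip (K t) phi)).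
Proof.
move=> Lp Aa bB; apply: continuous_compact_integrable; first exact: segment_compact.
apply: continuous_subspaceW (cont_k Lp) => t /=; rewrite !in_itv/= => /andP[h1 h2].
by rewrite (le_trans Aa h1) (le_trans h2 bB).
Qed.

Lemma riem_int n a b phi : L2 phi -> A <= a -> a <= b -> b <= B ->
  `|ip (riem n a b) phi - \int[mu]_(t in `[a, b]) ip (K t) phi| <=
  L * (b - a) ^+ 2 / 2 ^+ n * nrm phi.
Proof.
move=> Lp; have p0 := nrm_ge0 phi.
elim: n a b => [|n IH] a b Aa ab bB; have [m1 m2 m3 m4] := mid Aa ab bB.
  rewrite ip_riem0//.
  have muab : fine (mu `[a, b]) = b - a.
    rewrite lebesgue_measure_itv/= lte_fin; case: ifPn => [_|]//; rewrite -leNgt => ba /=.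
    by rewrite (_ : b = a) ?subrr//; apply/eqP; rewrite eq_le ba.
  have -> : (b - a) * ip (K a) phi = \int[mu]_(t in `[a, b]) (ip (K a) phi).
    by rewrite Rintegral_cst// muab mulrC.
  have icst (c : R) : mu.-integrable `[a, b] (EFin \o (fun=> c)).
    apply: continuous_compact_integrable; first exact: segment_compact.
    by apply: continuous_subspaceT => ?; exact: cvg_cst.
  have ik := int_k Lp Aa bB.
  have iB : mu.-integrable `[a, b] (EFin \o (fun t => ip (K a) phi - ip (K t) phi)).
    have mab : measurable (`[a, b]%classic : set (measurableTypeR R)) by exact: measurable_itv.
    exact: (integrableB mab (icst (ip (K a) phi)) ik).
  rewrite -RintegralB//.
  apply: (le_trans (le_normr_Rintegral _ _)) => //.
  apply: (@le_trans _ _ (\int[mu]_(t in `[a, b]) (L * (b - a) * nrm phi))).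
    apply: le_Rintegral => //.
      exact: (integrable_norm iB).
    move=> t /=; rewrite in_itv/= => /andP[at1 tb].
    apply: (le_trans (lipK Lp _ _)).
    - by rewrite in_itv/= Aa (le_trans ab).
    - by rewrite in_itv/= (le_trans Aa at1) (le_trans tb).
    - rewrite ler_wpM2r// ler_wpM2l// distrC ger0_norm ?subr_ge0//.
      by rewrite lerB.
  rewrite Rintegral_cst// muab expr0 divr1 le_eqVlt; apply/orP; left; apply/eqP.
  ring.
rewrite ip_riemS//; set m := (a + b) / 2.
have H1 := IH _ _ Aa m2 m4; have H2 := IH _ _ m1 m3 bB.
rewrite -/m in H1 H2.
have -> : \int[mu]_(t in `[a, b]) ip (K t) phi =
    \int[mu]_(t in `[a, m]) ip (K t) phi + \int[mu]_(t in `[m, b]) ip (K t) phi.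
  have ik := int_k Lp Aa bB.
  have := @Rintegral_itvB R (fun t => ip (K t) phi) (BLeft a) (BRight b) m ik.
  rewrite !bnd_simp => /(_ m2 m3) H.
  rewrite -(@Rintegral_itv_obnd_cbnd R m (BRight b)) -?H; first by ring.
  by apply: integrableS (int_k Lp m1 bB) => //; exact: subset_itv_oc_cc.
rewrite opprD addrACA; apply: (le_trans (ler_normD _ _)); apply: (le_trans (lerD H1 H2)).
rewrite -mulrDl ler_wpM2r// le_eqVlt; apply/orP; left; apply/eqP.
by rewrite (exprS (2 : R) n) /m; field; rewrite expf_neq0.
Qed.

(** By duality [riem_step] bounds the norms of the increments by [C / 2 ^+ n], as [riesz_fischer]
    requires componentwise; [riem_int] then identifies the pairings of the limit. *)
Lemma weak_integral_exists : A <= B -> exists2 W, L2 W &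
  forall phi, L2 phi -> ip W phi = \int[mu]_(t in `[A, B]) ip (K t) phi.
Proof.
move=> AB; pose S n := riem n A B; pose C := L * (B - A) ^+ 2.
have C0 : 0 <= C by rewrite mulr_ge0// sqr_ge0.
have LS n : L2 (S n) by exact: L2_riem.
have LD n : L2 (fun x => S n.+1 x - S n x) by exact: L2_sub.
have ND n : nrm (fun x => S n.+1 x - S n x) <= C / 2 ^+ n.
  apply: nrm_le_of_ip => //; first by rewrite divr_ge0// exprn_ge0.
  by move=> v Lv; rewrite ipBl//; exact: riem_step.
have sS n := (L2P (S n)).1 (LS n).
have RF i : exists w : R3 R -> R, measurable_fun setT (w : (measurableTypeR R *
      measurableTypeR R * measurableTypeR R)%type -> R) /\
    forall N, (\int[leb3 R]_x ((w x - S N x ord0 i) ^+ 2)%:E <= (C ^+ 2 * 4 / 2 ^+ N)%:E)%E.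
  apply: (@riesz_fischer _ _ _ (leb3 R) (fun n x => S n x ord0 i)); first exact: sqr_ge0.
    by move=> n; have [] := sS n i.
  move=> n; have := integral_comp_le i (LD n).
  under [X in (X <= _)%E -> _]eq_integral do rewrite row_subE.
  move=> /le_trans; apply; rewrite lee_fin -nrm_sq.
  have -> : C ^+ 2 / 4 ^+ n = (C / 2 ^+ n) ^+ 2.
    rewrite (_ : 4 = 2 * 2 :> R); last by ring.
    by rewrite (exprMn n (2 : R) 2); field; rewrite expf_neq0.
  by rewrite ler_sqr// ?nnegrE ?nrm_ge0// divr_ge0// exprn_ge0.
have [w Hw] := choice RF.
pose W x : 'rV[R]_3 := \row_i w i x.
have sw N i : sqint (leb3 R) (fun x => w i x - S N x ord0 i).
  have [mw Hwi] := Hw i; split.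
    by apply: measurable_funB => //; have [] := sS N i.
  by apply: (le_lt_trans (Hwi N)); exact: ltry.
have LWS N : L2 (fun x => W x - S N x).
  by apply/L2P => i; have := sw N i; congr sqint; apply/funext => x; rewrite row_subE mxE.
have LW : L2 W.
  have := L2_add (LWS 0%N) (LS 0%N); congr L2.
  by apply/funext => x; rewrite subrK.
exists W => // phi Lp; set J := \int[mu]_(t in _) _.
(* The constant is [2 * (4 * 3) + 2]: three components with the Riesz-Fischer constant 4, plus the
   Riemann sum error, each doubled by the square of a sum. *)
have bound n : (ip W phi - J) ^+ 2 <= 26 * C ^+ 2 * ip phi phi / 2 ^+ n.
  have h1 : (ip W phi - ip (S n) phi) ^+ 2 <= (C ^+ 2 * 4 / 2 ^+ n *+ 3) * ip phi phi.
    rewrite -ipBl//; apply: (le_trans (ip_sq_le (LWS n) Lp)).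
    rewrite ler_wpM2r ?ip_ge0//; apply: ip_le_comp => // i.
    have [_ Hwi] := Hw i; apply: le_trans (Hwi n).
    by under eq_integral do rewrite row_subE mxE.
  have h2 : (ip (S n) phi - J) ^+ 2 <= C ^+ 2 / 2 ^+ n * ip phi phi.
    have h3 := riem_int n Lp (lexx A) AB (lexx B).
    rewrite -(real_normK (num_real (_ - J))).
    have h4 : `|ip (S n) phi - J| ^+ 2 <= (C / 2 ^+ n * nrm phi) ^+ 2.
      by rewrite ler_sqr// ?nnegrE// mulr_ge0 ?nrm_ge0// divr_ge0// exprn_ge0.
    apply: (le_trans h4); rewrite exprMn nrm_sq ler_wpM2r ?ip_ge0//.
    rewrite expr_div_n ler_wpM2l ?sqr_ge0// lef_pV2 ?posrE ?exprn_gt0//.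
    by rewrite expr2 ler_peMr ?exprn_ge0// exprn_ege1// ler1n.
  apply: (@le_trans _ _ (2 * (ip W phi - ip (S n) phi) ^+ 2 + 2 * (ip (S n) phi - J) ^+ 2)).
    by have := sqr_ge0 ((ip W phi - ip (S n) phi) - (ip (S n) phi - J)); nra.
  apply: (le_trans (lerD (ler_wpM2l _ h1) (ler_wpM2l _ h2))) => //.
  by rewrite le_eqVlt; apply/orP; left; apply/eqP; ring.
apply/eqP; rewrite -subr_eq0 -sqrf_eq0 eq_le sqr_ge0 andbT.
have c := cvg_div_exp2 (26 * C ^+ 2 * ip phi phi).
rewrite -(cvg_lim (@Rhausdorff R) c); apply: limr_ge.
  by apply/cvg_ex; eexists; exact: c.
exact: nearW.
Qed.

End weak_integral.

(** * Curves in L^2 and their transforms through scalar pairings *)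

Section curves.
Context {R : realType}.
Variable T : R.
Local Notation mu := (@lebesgue_measure R).
Implicit Types (F dF : R -> vfield R) (phi : vfield R).

Lemma C0_near F t (e : R) : C0_L2 T F -> t \in `[0, T] -> 0 < e ->
  \forall s \near within `[0, T] (nbhs t), nrm (fun x => F s x - F t x) <= e.
Proof.
move=> [LF cF] tT e0.
have /fine_cvgP[_ /cvgrPdist_le/(_ e e0) H] := cF t tT.
near=> s.
have sT : s \in `[0, T] by near: s; exact: withinT.
have : `|0 - fine (L2dist (F s) (F t))| <= e by near: s; exact: H.
rewrite sub0r normrN /L2dist L2normE; last by apply: L2_sub; exact: LF.
by rewrite /= ger0_norm// nrm_ge0.
Unshelve. all: by end_near. Qed.

Lemma C0_ip_continuous F phi : C0_L2 T F -> L2 phi ->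
  {within `[0, T], continuous (fun t => ip (F t) phi)}.
Proof.
move=> cF Lp; have [LF _] := cF.
apply/subspace_continuousP => t tT; apply/cvgrPdist_le => e e0.
have c0 : 0 < nrm phi + 1 by rewrite ltr_wpDl// nrm_ge0.
near=> s.
have sT : s \in `[0, T] by near: s; exact: withinT.
rewrite distrC -ipBl; [|exact: LF..|exact: Lp].
apply: (le_trans (ip_nrm (L2_sub (LF _ sT) (LF _ tT)) Lp)).
have H : nrm (fun x => F s x - F t x) <= e / (nrm phi + 1).
  by near: s; apply: C0_near => //; exact: divr_gt0.
apply: (le_trans (ler_wpM2r (nrm_ge0 _) H)).
rewrite mulrAC ler_pdivrMr// ler_wpM2l ?(ltW e0)//.
by rewrite lerDl.
Unshelve. all: by end_near. Qed.

Lemma C0_bounded F : 0 <= T -> C0_L2 T F ->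
  exists2 M, 0 <= M & forall t, t \in `[0, T] -> nrm (F t) <= M.
Proof.
move=> T0 cF; have [LF _] := cF.
have cn : {within `[0, T], continuous (fun t => nrm (F t))}.
  apply/subspace_continuousP => t tT; apply/cvgrPdist_le => e e0.
  near=> s.
  have sT : s \in `[0, T] by near: s; exact: withinT.
  rewrite distrC; apply: (le_trans (nrm_dist (LF _ sT) (LF _ tT))).
  by near: s; exact: C0_near.
have [c _ Hc] := EVT_max T0 cn.
by exists (nrm (F c)); [exact: nrm_ge0|exact: Hc].
Unshelve. all: by end_near. Qed.

Lemma C1_is_derive F dF t phi : C1_L2 T F dF -> L2 phi -> t \in `]0, T[ ->
  is_derive t 1 (fun s => ip (F s) phi) (ip (dF t) phi).
Proof.
move=> [[LF _] [LdF _] dlim] Lp t0T.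
have tT : t \in `[0, T] by move: t0T; rewrite !in_itv/= => /andP[/ltW -> /ltW ->].
suff H : h^-1 *: (ip (F (h *: 1 + t)) phi - ip (F t) phi) @[h --> 0^'] --> ip (dF t) phi.
  split; first by apply/cvg_ex; eexists; exact: H.
  exact/cvg_lim.
apply/cvgrPdist_le => e e0.
have c0 : 0 < nrm phi + 1 by rewrite ltr_wpDl// nrm_ge0.
have /fine_cvgP[_ /cvgrPdist_le/(_ (e / (nrm phi + 1)))] := dlim t tT.
move=> /(_ (divr_gt0 e0 c0)); rewrite near_withinE near_withinE => /nbhs_ballP[d1 /= d10 H1].
have /nbhs_ballP[d2 /= d20 H2] : nbhs t `]0, T[%classic.
  by apply: open_nbhs_nbhs; split => //; exact: interval_open.
rewrite near_withinE; apply/nbhs_ballP; exists (Num.min d1 d2) => /=.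
  by rewrite lt_min d10.
move=> h; rewrite /ball /= sub0r normrN lt_min => /andP[hd1 hd2] hn0.
have -> : h *: 1 + t = t + h by rewrite -[h *: 1]/(h * 1) mulr1 addrC.
have bh : `|t - (t + h)| = `|h| by rewrite opprD addrA subrr add0r normrN.
have sT : t + h \in `[0, T].
  have := H2 (t + h); rewrite /ball /= bh => /(_ hd2).
  by rewrite !in_itv/= => /andP[/ltW -> /ltW ->].
have := H1 (t + h); rewrite /ball /= bh => /(_ hd1) /=.
have hne : t + h != t by rewrite -subr_eq0 addrAC subrr add0r.
move=> /(_ hne sT); rewrite (_ : t + h - t = h); last by rewrite addrAC subrr add0r.
have LQ : L2 (fun x => h^-1 *: (F (t + h) x - F t x)).
  by apply/L2_scale/L2_sub; exact: LF.
rewrite sub0r normrN /L2dist L2normE; last by apply: L2_sub => //; exact: LdF.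
rewrite /= ger0_norm ?nrm_ge0// => Hn.
have -> : h^-1 *: (ip (F (t + h)) phi - ip (F t) phi) =
    ip (fun x => h^-1 *: (F (t + h) x - F t x)) phi.
  rewrite ipZl//; last by apply: L2_sub; exact: LF.
  by rewrite ipBl//; exact: LF.
rewrite distrC -ipBl//; last exact: LdF.
apply: (le_trans (ip_nrm (L2_sub LQ (LdF _ tT)) Lp)).
apply: (le_trans (ler_wpM2r (nrm_ge0 _) Hn)).
rewrite mulrAC ler_pdivrMr// ler_wpM2l ?(ltW e0)//.
by rewrite lerDl.
Qed.

Definition lap (tau : R) (g : R -> R) : R :=
  \int[mu]_(t in `[0, T]) (expR (- (tau * t)) * g t).

Lemma is_derive_expRM (tau t : R) :
  is_derive t 1 (fun s : R => expR (- (tau * s))) (- tau * expR (- (tau * t))).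
Proof.
have d : is_derive t 1 (fun s : R => - (tau * s)) (- tau).
  rewrite (_ : (fun s : R => - (tau * s)) = (- tau) \*: (id : R -> R)); last first.
    by apply/funext => s; rewrite /= -[_ *: _]/(_ * _) mulNr.
  apply: (is_derive_eq (is_deriveZ (- tau) (is_derive_id t 1))).
  by rewrite -[_ *: _]/(_ * _) mulr1.
have := @is_derive1_comp _ expR (fun s : R => - (tau * s)) t _ _ (is_derive_expR _) d.
by rewrite mulrC.
Qed.

Lemma continuous_expRM (tau : R) : continuous (fun s : R => expR (- (tau * s))).
Proof.
move=> t; apply: differentiable_continuous; apply/derivable1_diffP.
exact: (@ex_derive _ _ _ _ _ _ _ (is_derive_expRM tau t)).
Qed.

Lemma integrable_lap (tau : R) (g : R -> R) : {within `[0, T], continuous g} ->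
  mu.-integrable `[0, T] (EFin \o (fun t => expR (- (tau * t)) * g t)).
Proof.
move=> cg; apply: continuous_compact_integrable; first exact: segment_compact.
move=> t; apply: (@cvgM _ _ (nbhs (t : subspace `[0, T]))); last exact: cg.
by apply: (@continuous_subspaceT _ _ `[0, T]%classic); exact: continuous_expRM.
Qed.

Lemma lap_ext (tau : R) (g h : R -> R) : (forall t, t \in `[0, T] -> g t = h t) ->
  lap tau g = lap tau h.
Proof. by move=> gh; apply: eq_Rintegral => t; rewrite inE => /gh ->. Qed.

Lemma lapD (tau : R) (g h : R -> R) : {within `[0, T], continuous g} ->
  {within `[0, T], continuous h} -> lap tau (fun t => g t + h t) = lap tau g + lap tau h.
Proof.
move=> cg ch; rewrite /lap -RintegralD//; [|exact: integrable_lap..].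
by apply: eq_Rintegral => t _; rewrite mulrDr.
Qed.

Lemma lapZ (tau c : R) (g : R -> R) : {within `[0, T], continuous g} ->
  lap tau (fun t => c * g t) = c * lap tau g.
Proof.
move=> cg; rewrite /lap -RintegralZl//; last exact: integrable_lap.
by apply: eq_Rintegral => t _; rewrite mulrCA.
Qed.

Lemma lap_derive F dF tau phi : 0 < T -> C1_L2 T F dF -> L2 phi ->
  lap tau (fun t => ip (dF t) phi) =
  expR (- (tau * T)) * ip (F T) phi - ip (F 0) phi + tau * lap tau (fun t => ip (F t) phi).
Proof.
move=> T0 C1 Lp; have [cF cdF _] := C1.
have dG t : t \in `]0, T[ -> is_derive t 1 (fun s => ip (F s) phi) (ip (dF t) phi).
  exact: C1_is_derive.
have cG := C0_ip_continuous cF Lp.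
rewrite /lap (@Rintegration_by_parts _ (fun t => expR (- (tau * t)))
  (fun t => ip (F t) phi) (fun t => - tau * expR (- (tau * t))))//.
- rewrite mulr0 oppr0 expR0 mul1r; congr (_ + _).
  rewrite -RintegralZl//; last exact: integrable_lap.
  rewrite -[LHS]mulN1r -RintegralZl//.
    by apply: eq_Rintegral => t _; ring.
  have := integrableZl (measurable_itv `[0, T] : measurable
    (`[0, T]%classic : set (measurableTypeR R))) (- tau) (integrable_lap tau cG).
  by apply: eq_integrable => // t _; rewrite /= -EFinM mulrA.
- apply: continuous_subspaceT => t; apply: cvgM; first exact: cvg_cst.
  exact: continuous_expRM.
- split.
  + by move=> t _; exact: (@ex_derive _ _ _ _ _ _ _ (is_derive_expRM tau t)).
  + exact/cvg_at_right_filter/continuous_expRM.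
  + exact/cvg_at_left_filter/continuous_expRM.
- by move=> t _; rewrite derive1E; exact: (@derive_val _ _ _ _ _ _ _ (is_derive_expRM tau t)).
- exact: C0_ip_continuous.
- have [_ h1 h2] := (continuous_within_itvP _ T0).1 cG; split => //.
  by move=> t tT; exact: (@ex_derive _ _ _ _ _ _ _ (dG t tT)).
- by move=> t tT; rewrite derive1E; exact: (@derive_val _ _ _ _ _ _ _ (dG t tT)).
Qed.

(** The weak form of the transform. It can be verified for a given candidate field, such as the
    right-hand side of a Maxwell equation, with scalar calculus alone. *)
Definition wlap (tau : R) F (W : vfield R) :=
  L2 W /\ forall phi, L2 phi -> ip W phi = lap tau (fun t => ip (F t) phi).

Lemma ip_expRM F (tau t : R) phi : L2 (F t) -> L2 phi ->
  ip (fun x => expR (- (tau * t)) *: F t x) phi = expR (- (tau * t)) * ip (F t) phi.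
Proof. by move=> LF Lp; rewrite ipZl. Qed.

(** A C^1 curve times the exponential is weakly Lipschitz by the mean value theorem, with constant
    [M1 + tau * M0] from the bounds on the derivative and on the curve. *)
Lemma wlap_exists F dF tau : 0 < T -> 0 < tau -> C1_L2 T F dF ->
  exists W, wlap tau F W.
Proof.
move=> T0 tau0 C1; have [cF cdF _] := C1; have [LF _] := cF; have [LdF _] := cdF.
have [M0 M00 HM0] := C0_bounded (ltW T0) cF.
have [M1 M10 HM1] := C0_bounded (ltW T0) cdF.
pose K (t : R) x := expR (- (tau * t)) *: F t x.
have LK t : t \in `[0, T] -> L2 (K t) by move=> tT; apply/L2_scale/LF.
have lip phi : L2 phi -> forall s t : R, s \in `[0, T] -> t \in `[0, T] ->
    `|ip (K s) phi - ip (K t) phi| <= (M1 + tau * M0) * `|s - t| * nrm phi.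
  move=> Lp s t sT tT.
  wlog st : s t sT tT / s <= t.
    move=> H; have [/H|/ltW/H] := leP s t; first exact.
    by rewrite distrC (distrC s); exact.
  pose k (r : R) := expR (- (tau * r)) * ip (F r) phi.
  rewrite /K !ip_expRM; [|exact: LF|by []|exact: LF|by []].
  rewrite -!/(k _) distrC (distrC s).
  have dk r : r \in `]0, T[ -> is_derive r 1 k
      (expR (- (tau * r)) * ip (dF r) phi + ip (F r) phi * (- tau * expR (- (tau * r)))).
    move=> rT; exact: (is_deriveM (is_derive_expRM tau r) (C1_is_derive C1 Lp rT)).
  have ck : {within `[0, T], continuous k}.
    move=> r; apply: (@cvgM _ _ (nbhs (r : subspace `[0, T]))); last exact: C0_ip_continuous.
    by apply: (@continuous_subspaceT _ _ `[0, T]%classic); exact: continuous_expRM.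
  move: sT tT; rewrite !in_itv/= => /andP[s0 sT] /andP[t0 tT].
  pose dk' (r : R) := expR (- (tau * r)) * ip (dF r) phi +
    ip (F r) phi * (- tau * expR (- (tau * r))).
  have dks r : r \in `]s, t[ -> is_derive r 1 k (dk' r).
    rewrite in_itv/= => /andP[sr rt]; apply: dk.
    by rewrite in_itv/= (le_lt_trans s0 sr) (lt_le_trans rt tT).
  have cks : {within `[s, t], continuous k}.
    apply: continuous_subspaceW ck => r /=; rewrite !in_itv/= => /andP[sr rt].
    by rewrite (le_trans s0 sr) (le_trans rt tT).
  have [c cst E] := MVT_segment st dks cks.
  rewrite E /dk'.
  have cT : c \in `[0, T].
    move: cst; rewrite !in_itv/= => /andP[sc ct].
    by rewrite (le_trans s0 sc) (le_trans ct tT).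
  have e1 : expR (- (tau * c)) <= 1.
    rewrite -[leRHS]expR0 ler_expR lerNl oppr0 mulr_ge0 ?(ltW tau0)//.
    by move: cT; rewrite in_itv/= => /andP[].
  have e0 := expR_ge0 (- (tau * c)).
  rewrite normrM mulrAC ler_wpM2r// mulrDl.
  apply: (le_trans (ler_normD _ _)); apply: lerD.
    rewrite normrM ger0_norm// -[leRHS]mul1r; apply: ler_pM => //.
    apply: (le_trans (ip_nrm (LdF _ cT) Lp)); rewrite ler_wpM2r ?nrm_ge0//.
    exact: HM1.
  rewrite !normrM normrN (ger0_norm (ltW tau0)) (ger0_norm e0).
  have : `|ip (F c) phi| <= M0 * nrm phi.
    apply: (le_trans (ip_nrm (LF _ cT) Lp)); rewrite ler_wpM2r ?nrm_ge0//.
    exact: HM0.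
  have := normr_ge0 (ip (F c) phi); set P := `|ip (F c) phi|; set Q := M0 * _.
  move=> P0 PQ; rewrite -mulrA -/Q.
  apply: (@le_trans _ _ (Q * (tau * 1))); last by rewrite mulr1 mulrC.
  apply: ler_pM => //; first by rewrite mulr_ge0// ltW.
  by rewrite ler_wpM2l// ltW.
have L0 : 0 <= M1 + tau * M0 by rewrite addr_ge0// mulr_ge0// ltW.
have [W LW HW] := weak_integral_exists L0 LK lip (ltW T0).
exists W; split => // phi Lp; rewrite HW//.
apply: eq_Rintegral => t; rewrite inE => tT.
by rewrite /K ip_expRM//; exact: LF.
Qed.

(** Pairing with [phi] commutes with the integral of simple curves and is controlled by [nrm phi]
    times the L^2 distance, so the identity survives the limit that defines the Bochner integral. *)
Lemma laplaceT_wlap F tau W : 0 < T -> C0_L2 T F -> laplaceT T F tau W -> wlap tau F W.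
Proof.
move=> T0 cF [LW [m [A [u [HA mS cS cW]]]]]; have [LF _] := cF; split => // phi Lp.
have mI : measurable (`[0, T]%classic : set (measurableTypeR R)) by exact: measurable_itv.
(* Square integrability of [u n i] is granted only for [i < m n], while the summation lemmas ask for
   it at every index. *)
pose u' n i : vfield R := if (i < m n)%N then u n i else (fun=> 0).
have Lu' n i : L2 (u' n i).
  by rewrite /u'; case: ifPn => [im|_]; [have [] := HA n i im|exact: L2_0].
pose S n (t : R) : vfield R := simple_curve (m n) (A n) (u n) t.
pose SI n : vfield R := simple_curve_int (m n) (A n) (u n).
have LS n t : L2 (S n t).
  rewrite (_ : S n t = fun x => \sum_(i <- index_enum 'I_(m n)) (\1_(A n i) t *: u' n i x)).
    by apply: L2_sum => i; exact: L2_scale.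
  by apply/funext => x; apply: eq_bigr => i _; rewrite /u' ltn_ord.
have LSI n : L2 (SI n).
  rewrite (_ : SI n = fun x => \sum_(i <- index_enum 'I_(m n))
      (fine (mu (A n i)) *: u' n i x)).
    by apply: L2_sum => i; exact: L2_scale.
  by apply/funext => x; apply: eq_bigr => i _; rewrite /u' ltn_ord.
have ipS n t : ip (S n t) phi = \sum_(i < m n) \1_(A n i) t * ip (u n i) phi.
  rewrite (_ : S n t = fun x => \sum_(i <- index_enum 'I_(m n)) (\1_(A n i) t *: u' n i x)).
    rewrite ip_suml//; last by move=> i; exact: L2_scale.
    by apply: eq_bigr => i _; rewrite ipZl// /u' ltn_ord.
  by apply/funext => x; apply: eq_bigr => i _; rewrite /u' ltn_ord.
have ipSI n : ip (SI n) phi = \sum_(i < m n) fine (mu (A n i)) * ip (u n i) phi.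
  rewrite (_ : SI n = fun x => \sum_(i <- index_enum 'I_(m n))
      (fine (mu (A n i)) *: u' n i x)).
    rewrite ip_suml//; last by move=> i; exact: L2_scale.
    by apply: eq_bigr => i _; rewrite ipZl// /u' ltn_ord.
  by apply/funext => x; apply: eq_bigr => i _; rewrite /u' ltn_ord.
have muI : (mu `[0%R, T] < +oo)%E.
  by rewrite lebesgue_measure_itv/= lte_fin T0 -EFinB ltry.
have iA n (i : 'I_(m n)) :
    mu.-integrable `[0, T] (EFin \o (fun t => \1_(A n i) t * ip (u n i) phi)).
  have [mA _ _] := HA n i (ltn_ord i).
  apply: measurable_bounded_integrable => //.
    exact: measurable_funM.
  exists `|ip (u n i) phi|; split; first exact: num_real.
  move=> M HM t _; rewrite /= normrM indicE; case: (_ \in _).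
    by rewrite normr1 mul1r ltW.
  by rewrite normr0 mul0r ltW// (le_lt_trans _ HM).
have iS n : mu.-integrable `[0, T] (EFin \o (fun t => ip (S n t) phi)).
  have := @integrable_sum _ _ _ mu _ mI _ (index_enum 'I_(m n)) xpredT
    (fun i t => (\1_(A n i) t * ip (u n i) phi)%:E) (fun i _ => iA n i).
  by apply: eq_integrable => // t _; rewrite /= ipS sumEFin.
have intS n : \int[mu]_(t in `[0, T]) ip (S n t) phi = ip (SI n) phi.
  rewrite ipSI; under eq_Rintegral do rewrite ipS.
  rewrite (Rintegral_sum _ mI (iA n)); apply: eq_bigr => i _.
  have [mA AT _] := HA n i (ltn_ord i).
  have iI : mu.-integrable `[0, T] (EFin \o (\1_(A n i) : R -> R)).
    apply: measurable_bounded_integrable => //.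
    exists 1; split; first exact: num_real.
    move=> M HM t _; rewrite /= indicE; case: (_ \in _).
      by rewrite normr1 ltW.
    by rewrite normr0 ltW// (lt_trans _ HM).
  rewrite RintegralZr//; congr (_ * _).
  rewrite /Rintegral (_ : (\int[mu]_(x in _) _)%E = mu (A n i `&` `[0, T]))//.
    by rewrite setIidl.
  exact: integral_indic.
pose K t x := expR (- (tau * t)) *: F t x.
have LK t : t \in `[0, T] -> L2 (K t) by move=> tT; apply/L2_scale/LF.
have cK := integrable_lap tau (C0_ip_continuous cF Lp).
have iK : mu.-integrable `[0, T] (EFin \o (fun t => ip (K t) phi)).
  by apply: eq_integrable cK => // t; rewrite inE => tT; rewrite /= /K ip_expRM//; exact: LF.
have lapE : lap tau (fun t => ip (F t) phi) = \int[mu]_(t in `[0, T]) ip (K t) phi.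
  by apply: eq_Rintegral => t; rewrite inE => tT; rewrite /K ip_expRM//; exact: LF.
apply/eqP; rewrite -subr_eq0 -normr_le0; apply/ler_addgt0Pr => e e0; rewrite add0r.
pose c := nrm phi + 1; have p0 := nrm_ge0 phi.
have c0 : 0 < c by rewrite ltr_wpDl.
(* Both errors, in the curve and in its integral, get multiplied by [nrm phi < c] and so stay below
   [e / 2]. *)
pose e' := e / 2 / c; have e'0 : 0 < e' by rewrite !divr_gt0.
have /fine_cvgP[fS /cvgr0Pnorm_le/(_ _ e'0) HS] := cS.
have /fine_cvgP[_ /cvgr0Pnorm_le/(_ _ e'0) HW] := cW.
have [n [fn Sn Wn]] : exists n, [/\
    (\int[mu]_(t in `[0%R, T]) L2dist (K t) (S n t))%E \is a fin_num,
    `|fine (\int[mu]_(t in `[0%R, T]) L2dist (K t) (S n t))%E| <= e' &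
    `|fine (L2dist W (SI n))| <= e'].
  near \oo => n; exists n; split; near: n => //.
rewrite lapE.
have -> : ip W phi - \int[mu]_(t in `[0, T]) ip (K t) phi =
    (ip W phi - ip (SI n) phi) + \int[mu]_(t in `[0, T]) (ip (S n t) phi - ip (K t) phi).
  by rewrite RintegralB// intS; ring.
apply: (le_trans (ler_normD _ _)); rewrite (splitr e); apply: lerD.
  rewrite -ipBl//; apply: (le_trans (ip_nrm (L2_sub LW (LSI n)) Lp)).
  move: Wn; rewrite /L2dist L2normE; last exact: L2_sub.
  rewrite /= ger0_norm ?nrm_ge0// => Wn.
  apply: (le_trans (ler_wpM2r p0 Wn)).
  by rewrite /e' mulrAC ler_pdivrMr// ler_wpM2l ?lerDl// divr_ge0// ltW.
have iB : mu.-integrable `[0, T] (EFin \o (fun t => ip (S n t) phi - ip (K t) phi)).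
  exact: (integrableB mI (iS n) iK).
apply: (le_trans (le_normr_Rintegral _ iB)) => //.
have iN := integrable_norm iB.
rewrite -lee_fin /Rintegral fineK; last exact: integrable_fin_num iN.
apply: (@le_trans _ _ (\int[mu]_(t in `[0%R, T]) ((nrm phi)%:E * L2dist (K t) (S n t)))%E).
  apply: ge0_le_integral => //.
  - exact: measurable_int iN.
  - by apply: measurable_funeM; exact: mS.
  - move=> t tT; rewrite /L2dist L2normE; last by apply: L2_sub => //; exact: LK.
    rewrite -EFinM lee_fin distrC -ipBl//; last exact: LK.
    by rewrite mulrC; apply: ip_nrm => //; apply: L2_sub => //; exact: LK.
rewrite ge0_integralZl//.
- rewrite -(fineK fn) -EFinM lee_fin.
  apply: (le_trans (ler_wpM2l p0 (le_trans (ler_norm _) Sn))).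
  by rewrite mulrC /e' mulrAC ler_pdivrMr// ler_wpM2l ?lerDl// divr_ge0// ltW.
- exact: mS.
- by move=> t _; rewrite /L2dist /L2norm Lnorm_ge0.
Unshelve. all: by end_near. Qed.

End curves.

(** * Decay of the transform of the source *)

Section H1_estimates.
Context {R : realType}.
Local Notation mu := (@lebesgue_measure R).
Local Notation R1 := (measurableTypeR R).
Variable T : R.

Lemma measure_itv_le (a b : R) : a <= b -> fine (mu `[a, b]) = b - a.
Proof.
move=> ab; rewrite lebesgue_measure_itv/= lte_fin; case: ifPn => [_|]//.
by rewrite -leNgt => ba /=; rewrite (_ : b = a) ?subrr//; apply/eqP; rewrite eq_le ba.
Qed.

Lemma normrM_young (l a b : R) : 0 < l -> `|a * b| <= l^-1 / 2 * a ^+ 2 + l / 2 * b ^+ 2.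
Proof.
move=> l0; have h (c : R) : c ^+ 2 = 1 -> 0 <= l^-1 / 2 * a ^+ 2 + l / 2 * b ^+ 2 - c * (a * b).
  move=> c1; rewrite (_ : _ - _ = l^-1 / 2 * (a - c * l * b) ^+ 2 + l / 2 * (1 - c ^+ 2) * b ^+ 2).
    by rewrite c1 subrr mulr0 mul0r addr0 mulr_ge0 ?sqr_ge0// divr_ge0// invr_ge0 ltW.
  by field; rewrite gt_eqF.
have := h 1 (expr1n _ _); have := h (-1); rewrite sqrrN expr1n => /(_ erefl).
move: (l^-1 / 2 * a ^+ 2) (l / 2 * b ^+ 2) (a * b) => A B P hm hp.
by rewrite ler_norml; apply/andP; split; lra.
Qed.

(** Its derivative is a bump of mass 1 at [s] minus one at [t], so testing the weak derivative
    against it compares averages of the function near the two points. *)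
Definition plateau n (s t x : R) : R :=
  step (n.+1%:R * (x - s)) - step (n.+1%:R * (x - t)).

Lemma is_derive_plateau n (s t x : R) :
  is_derive x 1 (plateau n s t) (bumpn n (x - s) - bumpn n (x - t)).
Proof. exact: (is_deriveB (is_derive_stepn n s x) (is_derive_stepn n t x)). Qed.

Lemma smooth1_plateau n (s t : R) : smooth1 (plateau n s t).
Proof.
apply: (smooth1_primitive (is_derive_plateau n s t)); apply: smooth_class_smooth1.
have h c : smooth_class (fun x : R => bumpn n (x - c)).
  have := smooth_aff 1 (- c) (smooth_bumpn (R := R) n).
  by congr smooth_class; apply/funext => x; rewrite mul1r.
have := smooth_add (h s) (smooth_scale (-1) (h t)).
by congr smooth_class; apply/funext => x; rewrite mulN1r.
Qed.

Lemma plateau_le1 n (s t x : R) : `|plateau n s t x| <= 1.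
Proof.
rewrite /plateau ler_norml; have := step_ge0 (n.+1%:R * (x - s)).
have := step_le1 (n.+1%:R * (x - s)); have := step_ge0 (n.+1%:R * (x - t)).
by have := step_le1 (n.+1%:R * (x - t)) => *; apply/andP; split; lra.
Qed.

Lemma plateau_out n (s t x : R) : s <= t ->
  x \notin `[s - n.+1%:R^-1, t + n.+1%:R^-1] -> plateau n s t x = 0.
Proof.
have n0 : 0 < n.+1%:R :> R by [].
move=> st; rewrite in_itv/= negb_and -!ltNge => /orP[xs|xt]; rewrite /plateau.
  have h c : s <= c -> n.+1%:R * (x - c) <= -1.
    move=> sc; rewrite -ler_pdivlMl// mulrN1 lerBlDr -lerBlDl opprK.
    by apply: le_trans sc; move: xs; rewrite ltrBrDr => /ltW; rewrite addrC.
  by rewrite !step_left ?subrr ?h.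
have h c : c <= t -> 1 <= n.+1%:R * (x - c).
  move=> ct; rewrite -ler_pdivrMl// mulr1 lerBrDl.
  by apply: le_trans (ltW xt); rewrite lerD2r.
by rewrite !step_right ?subrr ?h.
Qed.

Lemma test_fun1_plateau n (s t : R) : s <= t -> n.+1%:R^-1 < s -> n.+1%:R^-1 < T - t ->
  test_fun1 T (plateau n s t).
Proof.
move=> st ns nt; split; first exact: smooth1_plateau.
exists `[s - n.+1%:R^-1, t + n.+1%:R^-1]%classic; split.
- exact: segment_compact.
- move=> x /=; rewrite !in_itv/= => /andP[h1 h2]; apply/andP; split.
    by apply: lt_le_trans h1; rewrite subr_gt0.
  by apply: (le_lt_trans h2); rewrite -ltrBrDl.
- by move=> x /negP; exact: plateau_out.
Qed.

Lemma bump_average n (s e : R) (f : R -> R) : {within `[0, T], continuous f} ->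
  n.+1%:R^-1 < s -> n.+1%:R^-1 < T - s ->
  (forall x, `|x - s| < n.+1%:R^-1 -> `|f x - f s| <= e) ->
  mu.-integrable `]0, T[ (EFin \o (fun x => f x * bumpn n (x - s))) /\
  `|\int[mu]_(x in `]0, T[) (f x * bumpn n (x - s)) - f s| <= e.
Proof.
move=> cf ns nT fe.
have mD : measurable (`]0, T[%classic : set R1) by exact: measurable_itv.
have mDc : measurable (`[0, T]%classic : set R1) by exact: measurable_itv.
have cb : continuous (fun x : R => bumpn n (x - s)).
  move=> t; apply: (@continuous_comp _ _ _ (fun t => t - s) (bumpn n)).
    by apply: cvgB; [exact: cvg_id|exact: cvg_cst].
  exact/smooth1_continuous/smooth_class_smooth1/smooth_bumpn.
have i1 : mu.-integrable `]0, T[ (EFin \o (fun x => f x * bumpn n (x - s))).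
  apply: (@integrableS _ _ _ mu _ _ _ mDc mD); first exact: subset_itv_oo_cc.
  apply: continuous_compact_integrable; first exact: segment_compact.
  have cbs : {within `[0, T], continuous (fun x => bumpn n (x - s))}.
    exact: continuous_subspaceT.
  by move=> t; apply: (@cvgM _ _ (nbhs (t : subspace `[0, T]))); [exact: cf|exact: cbs].
have ib : mu.-integrable `]0, T[ (EFin \o (fun x => bumpn n (x - s))).
  apply: (@integrableS _ _ _ mu _ _ _ mDc mD); first exact: subset_itv_oo_cc.
  apply: continuous_compact_integrable; first exact: segment_compact.
  exact: continuous_subspaceT.
have b1 : \int[mu]_(x in `]0, T[) bumpn n (x - s) = 1.
  rewrite /Rintegral (_ : (\int[mu]_(x in `]0%R, T[) _)%E = 1%E)//.
  rewrite -(integral_bumpn n s) integral_mkcond; apply: eq_integral => x _.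
  rewrite patchE; case: ifPn => //; rewrite notin_setE/= in_itv/= => /negP.
  rewrite negb_and -!leNgt => /orP[x0|xT]; rewrite bumpn_out//.
    rewrite distrC; apply: le_trans (ler_norm _); rewrite (le_trans (ltW ns))//.
    by rewrite lerBrDl -lerBrDr subrr.
  apply: le_trans (ler_norm _); apply: (le_trans (ltW nT)).
  by rewrite lerB.
split => //.
have -> : f s = \int[mu]_(x in `]0, T[) (f s * bumpn n (x - s)).
  by rewrite RintegralZl// b1 mulr1.
have iZ : mu.-integrable `]0, T[ (EFin \o (fun x => f s * bumpn n (x - s))).
  exact: (integrableZl mD (f s) ib).
have iB : mu.-integrable `]0, T[ (EFin \o (fun x => f x * bumpn n (x - s) - f s * bumpn n (x - s))).
  exact: (integrableB mD i1 iZ).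
rewrite -RintegralB//.
apply: (le_trans (le_normr_Rintegral _ iB)) => //.
rewrite -[leRHS]mulr1 -b1 -RintegralZl//; apply: le_Rintegral => //.
- exact: integrable_norm iB.
- exact: (integrableZl mD e ib).
move=> x _; rewrite -mulrBl normrM (ger0_norm (bumpn_ge0 _ _)).
have [xs|xs] := ltP `|x - s| n.+1%:R^-1; last by rewrite bumpn_out// !mulr0.
by rewrite ler_wpM2r ?bumpn_ge0// fe.
Qed.

(* The weak derivative is tested against smooth plateaus approximating the indicator
   of [s, t]; Young's inequality with the free weight [l] stands in for
   Cauchy-Schwarz. *)
Lemma H1_holder (f : R -> R) : H1 T f -> exists2 G : R, 0 <= G &
  forall s t l : R, 0 < s -> s <= t -> t < T -> 0 < l ->
    `|f t - f s| <= (G / l + l * (t - s)) / 2.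
Proof.
move=> [cf _ [g /Lfun2P sg Hg]].
pose D : set R1 := `]0, T[%classic; pose gg := g \_ D.
have mD : measurable D by exact: measurable_itv.
have igg := sqint_integrable sg.
pose G := \int[mu]_x (gg x ^+ 2).
have G0 : 0 <= G by apply: Rintegral_ge0 => x _; exact: sqr_ge0.
exists G => // s t l s0 st tT l0.
have sT : s < T by exact: le_lt_trans tT.
have t0 : 0 < t by exact: lt_le_trans st.
have cfx x : 0 < x -> x < T -> f y @[y --> x] --> f x.
  move=> x0 xT; have T0 : 0 < T by exact: lt_trans xT.
  have [+ _ _] := (continuous_within_itvP _ T0).1 cf; apply.
  by rewrite in_itv/= x0.
(* The slack is [e] for each of the two averages, plus [l * e] because the support of the plateau
   exceeds [[s, t]] by less than [e] on either side. *)
suff key e : 0 < e -> `|f t - f s| <= (G / l + l * (t - s)) / 2 + e * (2 + l).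
  apply/ler_addgt0Pr => e e0.
  have c0 : 0 < 2 + l by rewrite addr_gt0.
  by have := key (e / (2 + l)) (divr_gt0 e0 c0); rewrite divfK// gt_eqF.
move=> e0.
have /cvgrPdist_le/(_ e e0)/nbhs_ballP[d1 /= d10 H1'] := cfx s s0 sT.
have /cvgrPdist_le/(_ e e0)/nbhs_ballP[d2 /= d20 H2'] := cfx t t0 tT.
(* The radii [d1], [d2] control the averages of [f], [s] and [T - t] keep the plateau supported
   inside the open interval, and [e] limits the excess of its support. *)
pose m := Num.min (Num.min d1 d2) (Num.min (Num.min s (T - t)) e).
have m0 : 0 < m by rewrite !lt_min d10 d20 s0 subr_gt0 tT e0.
have [n] : exists n : nat, n.+1%:R^-1 < m.
  by have := ltr_add_invr m0; move=> [N]; rewrite add0r => ?; exists N.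
rewrite !lt_min => /andP[/andP[nd1 nd2] /andP[/andP[ns nt] ne]].
have n0 : 0 < n.+1%:R^-1 :> R by rewrite invr_gt0.
have [||i1 a1] := @bump_average n s e f cf ns.
- by apply: (lt_le_trans nt); rewrite lerB.
- by move=> x xs; rewrite distrC; apply: H1'; rewrite /ball /= distrC (lt_trans xs).
have [||i2 a2] := @bump_average n t e f cf _ nt.
- exact: (lt_le_trans ns).
- by move=> x xs; rewrite distrC; apply: H2'; rewrite /ball /= distrC (lt_trans xs).
have := Hg _ (test_fun1_plateau st ns nt).
under eq_Rintegral do rewrite derive1E (@derive_val _ _ _ _ _ _ _ (is_derive_plateau n s t _)) mulrBr.
rewrite RintegralB// => E.
set pl := plateau n s t in E; pose pp := pl \_ D.
have cpl : continuous pl by exact/smooth1_continuous/smooth1_plateau.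
have mpp : measurable_fun setT (pp : R1 -> R).
  have mpl : measurable_fun setT (pl : R1 -> R) by exact: continuous_measurable_fun.
  by apply: (measurable_restrictT _ mD).1; exact: measurable_funS mpl.
pose ab : set R1 := `[s - n.+1%:R^-1, t + n.+1%:R^-1]%classic.
have mab : measurable ab by exact: measurable_itv.
have ab_le : s - n.+1%:R^-1 <= t + n.+1%:R^-1.
  by rewrite lerBlDr -addrA ler_wpDr// addr_ge0 ?ltW.
have pp_le x : pp x ^+ 2 <= \1_ab x.
  rewrite /pp patchE indicE; case: ifPn => _; last by rewrite expr0n/=.
  have [xab|xab] := boolP (x \in ab).
    rewrite -(real_normK (num_real _)) expr_le1//; exact: plateau_le1.
  rewrite /pl plateau_out ?expr0n//.
  by move: xab; rewrite notin_setE /ab /= => /negP.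
have iab : mu.-integrable setT (EFin \o (\1_ab : R1 -> R)) by exact: integrable_indic_itv.
have ip2 : mu.-integrable setT (EFin \o (fun x => pp x ^+ 2)).
  apply: (le_integrable _ _ _ iab) => //.
    by apply/measurable_EFinP; exact: measurable_funX.
  move=> x _; rewrite /= lee_fin ger0_norm ?sqr_ge0//.
  exact: le_trans (pp_le x) (ler_norm _).
have P2 : \int[mu]_x (pp x ^+ 2) <= t - s + n.+1%:R^-1 *+ 2.
  apply: (@le_trans _ _ (\int[mu]_x (\1_ab x))).
    by apply: le_Rintegral => // x _; exact: pp_le.
  rewrite /Rintegral integral_indic// setIT measure_itv_le// mulr2n.
  by rewrite le_eqVlt; apply/orP; left; apply/eqP; ring.
have sp : sqint mu pp.
  split => //; have /integrableP[_] := ip2; apply: le_lt_trans.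
  by apply: ge0_le_integral => //; rewrite ?lee_fin ?sqr_ge0 //;
    [move=> x _; rewrite lee_fin sqr_ge0|apply: measurable_EFin_sq|
     apply: measurableT_comp => //; apply: measurable_EFin_sq|
     move=> x _; rewrite /= lee_fin ler_norm].
have igp := sqintM_integrable sg sp.
have Egp : \int[mu]_(x in `]0, T[) (g x * pl x) = \int[mu]_x (gg x * pp x).
  rewrite Rintegral_mkcond; apply: eq_Rintegral => x _.
  by rewrite /gg /pp !patchE; case: ifPn; rewrite ?mulr0.
have B : `|\int[mu]_x (gg x * pp x)| <= (G / l + l * (t - s + n.+1%:R^-1 *+ 2)) / 2.
  apply: (le_trans (le_normr_Rintegral _ igp)) => //.
  have iR : mu.-integrable setT (EFin \o (fun x => l^-1 / 2 * gg x ^+ 2 + l / 2 * pp x ^+ 2)).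
    exact: (integrableD measurableT (integrableZl measurableT _ igg)
      (integrableZl measurableT _ ip2)).
  apply: (@le_trans _ _ (\int[mu]_x (l^-1 / 2 * gg x ^+ 2 + l / 2 * pp x ^+ 2))).
    apply: le_Rintegral => //; first exact: integrable_norm igp.
    by move=> x _; exact: normrM_young.
  rewrite RintegralD//; [|exact: (integrableZl measurableT _ igg)|
    exact: (integrableZl measurableT _ ip2)].
  rewrite !RintegralZl// -/G.
  have := ler_wpM2l (_ : 0 <= l / 2) P2; rewrite divr_ge0 ?(ltW l0)// => /(_ isT).
  move: (\int[mu]_x (pp x ^+ 2)) (t - s + n.+1%:R^-1 *+ 2) => P Q PQ.
  have -> : (G / l + l * Q) / 2 = l^-1 / 2 * G + l / 2 * Q by field; rewrite gt_eqF.
  by rewrite lerD2l.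
have : `|\int[mu]_(x in `]0, T[) (f x * bumpn n (x - s)) -
    \int[mu]_(x in `]0, T[) (f x * bumpn n (x - t))| <=
    (G / l + l * (t - s + n.+1%:R^-1 *+ 2)) / 2.
  by rewrite E normrN Egp.
move: a1 a2; set X := \int[mu]_(x in _) _; set Y := \int[mu]_(x in _) _.
rewrite mulr2n; have := ler_wpM2l (ltW l0) (ltW ne).
move: X Y (f s) (f t) n.+1%:R^-1 (G / l) (t - s) => X Y u v q Gl d lq.
rewrite !ler_norml => /andP[x1 x2] /andP[y1 y2] /andP[z1 z2].
rewrite mulrDr; rewrite !mulrDr in z1 z2.
rewrite [l * e]mulrC in lq.
by clear -lq x1 x2 y1 y2 z1 z2; move: (l * q) (l * d) (e * l) lq z1 z2 => lq ld el *;
  apply/andP; split; lra.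
Qed.

(** The limit [s -> 0] in [H1_holder], with the endpoint [T] reached by continuity. Minimising over
    [l] would give [sqrt (G t)]; the free weight is kept since it can be chosen independently of
    [t]. *)
Lemma H1_bound (f : R -> R) : 0 < T -> H1 T f -> f 0 = 0 -> exists2 G : R, 0 <= G &
  forall t l : R, t \in `[0, T] -> 0 < l -> `|f t| <= (G / l + l * t) / 2.
Proof.
move=> T0 Hf f0; have [G G0 HG] := H1_holder Hf; have [cf _ _] := Hf.
have [_ c0 cT] := (continuous_within_itvP _ T0).1 cf.
exists G => // t l tT l0.
have open_case x : 0 < x -> x < T -> `|f x| <= (G / l + l * x) / 2.
  move=> x0 xT; apply/ler_addgt0Pr => e e0.
  have /cvgrPdist_le/(_ e e0) H := c0.
  have [s [s0 sx fs]] : exists s, [/\ 0 < s, s < x & `|f 0 - f s| <= e].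
    near (0 : R)^'+ => s; exists s; split; near: s => //.
    - exact: nbhs_right_gt.
    - exact: nbhs_right_lt.
  have := HG s x l s0 (ltW sx) xT l0; rewrite f0 sub0r normrN in fs.
  have := ler_normD (f x - f s) (f s); rewrite subrK.
  have : l * (x - s) <= l * x by rewrite ler_wpM2l ?(ltW l0)// lerBlDr lerDl ltW.
  lra.
move: tT; rewrite in_itv/= => /andP[]; rewrite le_eqVlt => /predU1P[<- _|t0].
  by rewrite f0 normr0 mulr0 addr0 !divr_ge0// ltW.
rewrite le_eqVlt => /predU1P[->|tT]; last exact: open_case.
apply/ler_addgt0Pr => e e0.
have /cvgrPdist_le/(_ e e0) H := cT.
have [s [s0 sx fs]] : exists s, [/\ 0 < s, s < T & `|f T - f s| <= e].
  near T^'- => s; exists s; split; near: s => //.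
  - exact: nbhs_left_gt.
  - exact: nbhs_left_lt.
have := open_case s s0 sx; have := ler_normD (f T - f s) (f s); rewrite subrK.
have : l * s <= l * T by rewrite ler_wpM2l ?(ltW l0)// ltW.
lra.
Unshelve. all: by end_near. Qed.

Lemma integral_expRM_le (tau : R) : 0 < T -> 0 < tau ->
  \int[mu]_(t in `[0, T]) expR (- (tau * t)) <= tau^-1.
Proof.
move=> T0 tau0.
have dF (t : R) : is_derive t 1 (fun s : R => - tau^-1 * expR (- (tau * s))) (expR (- (tau * t))).
  apply: (is_derive_eq (is_deriveZ (- tau^-1) (is_derive_expRM tau t))).
  by rewrite -[_ *: _]/(_ * _) mulrA mulrNN mulVf ?mul1r// gt_eqF.
have cF : continuous (fun s : R => - tau^-1 * expR (- (tau * s))).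
  move=> t; apply: differentiable_continuous; apply/derivable1_diffP.
  exact: (@ex_derive _ _ _ _ _ _ _ (dF t)).
rewrite /Rintegral (@continuous_FTC2 _ _ (fun s : R => - tau^-1 * expR (- (tau * s))))//.
- rewrite /= mulr0 oppr0 expR0 mulr1 opprK mulNr gerDr lerNl oppr0.
  by rewrite mulr_ge0 ?expR_ge0// invr_ge0 ltW.
- by apply: continuous_subspaceT; exact: continuous_expRM.
- split.
  + by move=> t _; exact: (@ex_derive _ _ _ _ _ _ _ (dF t)).
  + exact/cvg_at_right_filter/cF.
  + exact/cvg_at_left_filter/cF.
- by move=> t _; rewrite derive1E; exact: (@derive_val _ _ _ _ _ _ _ (dF t)).
Qed.

(* [H1_bound] is used with the weight [l = sqrt tau]. *)
Lemma ftilde_bound (f : R -> R) : 0 < T -> H1 T f -> f 0 = 0 ->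
  exists2 C : R, 0 < C &
  forall tau : R, 0 < tau -> `|ftilde T f tau| <= C / Num.sqrt tau ^+ 3.
Proof.
move=> T0 Hf f0; have [G G0 HG] := H1_bound T0 Hf f0; have [cf _ _] := Hf.
(* With [tau = s ^+ 2], the two terms of the majorant below integrate to at most [G / (2 s tau)] and
   [2 s / tau ^+ 2], that is [G / 2] and 2 times [s ^- 3]. *)
exists (G / 2 + 2); first by rewrite ltr_wpDl// divr_ge0.
move=> tau tau0; pose s := Num.sqrt tau.
have s0 : 0 < s by rewrite sqrtr_gt0.
have s2 : s ^+ 2 = tau by rewrite sqr_sqrtr// ltW.
have mI : measurable (`[0, T]%classic : set R1) by exact: measurable_itv.
have ie (c : R) : mu.-integrable `[0, T] (EFin \o (fun t => expR (- (c * t)))).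
  apply: continuous_compact_integrable; first exact: segment_compact.
  by apply: continuous_subspaceT; exact: continuous_expRM.
have il := integrable_lap tau cf.
apply: (le_trans (le_normr_Rintegral _ il)) => //.
have iR : mu.-integrable `[0, T] (EFin \o (fun t =>
    G / s / 2 * expR (- (tau * t)) + s / tau * expR (- (tau / 2 * t)))).
  exact: (integrableD mI (integrableZl mI _ (ie tau)) (integrableZl mI _ (ie (tau / 2)))).
apply: (@le_trans _ _ (\int[mu]_(t in `[0, T])
    (G / s / 2 * expR (- (tau * t)) + s / tau * expR (- (tau / 2 * t))))).
  apply: le_Rintegral => //; first exact: integrable_norm il.
  move=> t tT; rewrite normrM (ger0_norm (expR_ge0 _)).
  have t0 : 0 <= t by move: tT; rewrite /= in_itv/= => /andP[].
  apply: (le_trans (ler_wpM2l (expR_ge0 _) (HG t s tT s0))).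
  have -> : expR (- (tau * t)) * ((G / s + s * t) / 2) =
      G / s / 2 * expR (- (tau * t)) + s / 2 * (t * expR (- (tau * t))) by field; rewrite gt_eqF.
  rewrite lerD2l.
  have E : expR (- (tau * t)) = expR (- (tau / 2 * t)) * expR (- (tau / 2 * t)).
    by rewrite -expRD; congr expR; field.
  (* Half of the exponential absorbs the factor [t]; the other half remains to be integrated. *)
  have y1 : t * expR (- (tau / 2 * t)) <= 2 / tau.
    rewrite expRN ler_pdivrMr ?expR_gt0//.
    have := expR_ge1Dx (tau / 2 * t) => h.
    have -> : t = 2 / tau * (tau / 2 * t) by field; rewrite gt_eqF.
    rewrite [in leRHS](_ : tau / 2 * (2 / tau * (tau / 2 * t)) = tau / 2 * t); last first.
      by field; rewrite gt_eqF.
    by rewrite ler_wpM2l ?divr_ge0 ?(ltW tau0)//; lra.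
  rewrite E.
  have -> : s / 2 * (t * (expR (- (tau / 2 * t)) * expR (- (tau / 2 * t)))) =
      (s / 2 * expR (- (tau / 2 * t))) * (t * expR (- (tau / 2 * t))) by ring.
  have -> : s / tau * expR (- (tau / 2 * t)) = (s / 2 * expR (- (tau / 2 * t))) * (2 / tau).
    by field; rewrite gt_eqF.
  by rewrite ler_wpM2l// mulr_ge0 ?expR_ge0// divr_ge0// ltW.
rewrite RintegralD//; [|exact: (integrableZl mI _ (ie tau))|
  exact: (integrableZl mI _ (ie (tau / 2)))].
rewrite !RintegralZl//.
have t20 : 0 < tau / 2 by rewrite divr_gt0.
have h1 := integral_expRM_le T0 tau0; have h2 := integral_expRM_le T0 t20.
apply: (@le_trans _ _ (G / s / 2 * tau^-1 + s / tau * (tau / 2)^-1)).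
  apply: lerD; apply: ler_wpM2l => //; first by rewrite !divr_ge0// ltW.
  by rewrite divr_ge0// ltW.
clear iR il h1 h2 t20 ie; rewrite -/s; move: s s0 s2 => s s0 <-.
by rewrite le_eqVlt; apply/orP; left; apply/eqP; field; rewrite gt_eqF.
Qed.

End H1_estimates.

(** * Maxwell systems after the Laplace transform *)

Section coefficients.
Context {R : realType}.
Local Notation R1 := (measurableTypeR R).
Local Notation X3 := (R1 * R1 * R1)%type.
Local Notation mu3 := (leb3 R).
Implicit Types (b c : R3 R -> R) (u v : vfield R).

Lemma ess_bounded_coef c : ess_bounded c -> bounded_coef c.
Proof.
move=> /andP[]; rewrite inE/= => mc; rewrite inE/= /finite_norm unlock /Lnorm => Hc.
(* The norm at exponent [+oo] is an essential supremum only when the whole space has positive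
   measure; otherwise every almost everywhere bound is trivial. *)
split => //; have [mT|mT] := boolP (0 < mu3 setT)%E; last first.
  exists 0; exists setT; split => //.
  by apply/eqP; rewrite eq_le measure_ge0 leNgt mT.
rewrite mT in Hc; have H := ess_sup_ge mu3 (abse \o (EFin \o c)).
exists (fine (ess_sup mu3 (abse \o (EFin \o c)))).
by apply: ae_imp H => x; move: Hc; case: (ess_sup _ _) => //= r _; rewrite lee_fin.
Qed.

Lemma ess_inf_gt0_lower c : ess_inf_gt0 c ->
  exists2 k, 0 < k & {ae mu3, forall x, k <= c x}.
Proof.
rewrite /ess_inf_gt0; have := ess_inf_le mu3 (EFin \o c).
case: (ess_inf _ _) => [r|+ _|_]//=.
- by move=> H; rewrite lte_fin => r0; exists r => //; apply: ae_imp H => x; rewrite lee_fin.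
- by move=> H; exists 1 => //; apply: ae_imp H.
Qed.

Lemma bounded_coef_cst (k : R) : bounded_coef (fun=> k).
Proof.
split; first exact: measurable_cst.
by exists `|k|; exact: (@aeW _ _ _ mu3).
Qed.

Lemma bounded_coefD b c : bounded_coef b -> bounded_coef c ->
  bounded_coef (fun x => b x + c x).
Proof.
move=> [mb [C1 H1]] [mc [C2 H2]]; split; first exact: measurable_funD.
exists (C1 + C2); apply: ae_imp (ae_and H1 H2) => x [h1 h2].
by apply: (le_trans (ler_normD _ _)); exact: lerD.
Qed.

Lemma bounded_coefM b c : bounded_coef b -> bounded_coef c ->
  bounded_coef (fun x => b x * c x).
Proof.
move=> [mb [C1 H1]] [mc [C2 H2]]; split; first exact: measurable_funM.
exists (C1 * C2); apply: ae_imp (ae_and H1 H2) => x [h1 h2].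
by rewrite normrM; apply: ler_pM.
Qed.

Lemma bounded_coefB b c : bounded_coef b -> bounded_coef c ->
  bounded_coef (fun x => b x - c x).
Proof.
move=> bb /(bounded_coefM (bounded_coef_cst (-1)))/(bounded_coefD bb).
by congr bounded_coef; apply/funext => x; rewrite mulN1r.
Qed.

Lemma bounded_coefV c (k : R) : 0 < k -> bounded_coef c -> {ae mu3, forall x, k <= c x} ->
  bounded_coef (fun x => (c x)^-1).
Proof.
move=> k0 [mc _] ck; split.
  (* Measurability of the inverse is reduced to that of a real power; squaring makes the base
     nonnegative, and the identity persists where [c] vanishes. *)
  have -> : (fun x => (c x)^-1) = (fun x => c x * (c x ^+ 2) `^ (-1)).
    apply/funext => x; rewrite powR_inv1 ?sqr_ge0//.
    have [->|c0] := eqVneq (c x) 0; first by rewrite invr0 mul0r.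
    by field.
  apply: measurable_funM => //.
  apply: (measurableT_comp (measurable_powR (-1))).
  exact: measurable_funX.
exists k^-1; apply: ae_imp ck => x kc; have c0 := lt_le_trans k0 kc.
by rewrite ger0_norm ?invr_ge0 ?(ltW c0)// lef_pV2.
Qed.

Lemma ae_Rintegral_ge0 (h : R3 R -> R) : mu3.-integrable setT (EFin \o h) ->
  {ae mu3, forall x, 0 <= h x} -> 0 <= \int[mu3]_x h x.
Proof.
move=> ih h0.
have -> : \int[mu3]_x h x = \int[mu3]_x `|h x|.
  rewrite /Rintegral; congr fine; apply: ae_eq_integral => //.
  - exact: measurable_int ih.
  - exact: measurable_int (integrable_norm ih).
  - by apply: ae_imp h0 => x hx _; rewrite ger0_norm.
by apply: Rintegral_ge0.
Qed.

Lemma ip_coef_ge (k : R) c u : bounded_coef c -> L2 u -> {ae mu3, forall x, k <= c x} ->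
  k * ip u u <= ip (fun x => c x *: u x) u.
Proof.
move=> bc Lu ck; rewrite -subr_ge0 -ipZl// -ipBl//; [|exact: L2_mul|exact: L2_scale].
apply: ae_Rintegral_ge0.
  by apply: integrable_dot => //; apply: L2_sub; [exact: L2_mul|exact: L2_scale].
apply: ae_imp ck => x cx; rewrite -scalerBl dotZl mulr_ge0 ?dot_ge0//.
by rewrite subr_ge0.
Qed.

(* [b |u|^2 - 2 c u.v + (c^2 / b) |v|^2 = b |u - (c / b) v|^2 >= 0] *)
Lemma ip_complete_square b c d u v :
  bounded_coef b -> bounded_coef c -> bounded_coef d -> L2 u -> L2 v ->
  {ae mu3, forall x, 0 < b x /\ b x * d x = c x ^+ 2} ->
  2 * ip (fun x => c x *: v x) u <=
  ip (fun x => b x *: u x) u + ip (fun x => d x *: v x) v.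
Proof.
move=> bb bc bd Lu Lv H.
have Lb := L2_mul bb Lu; have Lc := L2_mul bc Lv; have Ld := L2_mul bd Lv.
have i1 := integrable_dot Lb Lu; have i2 := integrable_dot Ld Lv.
have i3 := integrable_dot (L2_scale 2 Lc) Lu.
have iD : mu3.-integrable setT (EFin \o (fun x => dot (b x *: u x) (u x) + dot (d x *: v x) (v x))).
  exact: (integrableD measurableT i1 i2).
have iB : mu3.-integrable setT (EFin \o (fun x => dot (b x *: u x) (u x) + dot (d x *: v x) (v x)
    - dot (2 *: (c x *: v x)) (u x))).
  exact: (integrableB measurableT iD i3).
rewrite -subr_ge0 -ipZl// /ip -RintegralD// -RintegralB//.
apply: ae_Rintegral_ge0 => //; apply: ae_imp H => x [b0 bd2].
have := dot_ge0 (b x *: u x - c x *: v x).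
rewrite dotBl !dotBr !(dotZl, dotZr) (dotC (v x) (u x)).
move: (dot (u x) (u x)) (dot (v x) (v x)) (dot (u x) (v x)) => p q r.
rewrite (_ : _ - _ = b x * (b x * p + d x * q - 2 * (c x * r))) ?pmulr_rge0//.
by rewrite mulrBr mulrDr [b x * (d x * q)]mulrA bd2; ring.
Qed.

Lemma ip_coef_split b c u v : bounded_coef b -> bounded_coef c -> L2 u -> L2 v ->
  \int[mu3]_x (b x * enorm (u x) ^+ 2 + c x * enorm (v x) ^+ 2) =
  ip (fun x => b x *: u x) u + ip (fun x => c x *: v x) v.
Proof.
move=> bb bc Lu Lv; rewrite /ip -RintegralD//; first last.
- by apply: integrable_dot => //; exact: L2_mul.
- by apply: integrable_dot => //; exact: L2_mul.
by apply: eq_Rintegral => x _; rewrite !enorm_sq !dotZl.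
Qed.

Lemma L2_indic_eball (p : R3 R) (r : R) (a : 'rV[R]_3) : 0 < r ->
  L2 (fun x => \1_(eball p r) x *: a).
Proof.
move=> r0.
pose q (x : X3) := (x.1.1 - p.1.1) ^+ 2 + (x.1.2 - p.1.2) ^+ 2 + (x.2 - p.2) ^+ 2.
have mq : measurable_fun setT q.
  have m1 : measurable_fun setT (fst : X3 -> _) by exact: measurable_fst.
  apply: measurable_funD; [apply: measurable_funD|]; apply: measurable_funX;
    apply: measurable_funB => //.
  - exact: measurableT_comp.
  - exact: measurableT_comp.
have EB : eball p r = q @^-1` `]-oo, (r ^+ 2)[.
  apply/seteqP; split => x; rewrite /eball /= in_itv/= -/(q x).
    by rewrite -{1}(gtr0_norm r0) -sqrtr_sqr ltr_sqrt// exprn_gt0.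
  by rewrite -{2}(gtr0_norm r0) -sqrtr_sqr ltr_sqrt// exprn_gt0.
have mB : measurable (eball p r : set X3).
  by rewrite EB -[X in measurable X]setTI; apply: mq => //; exact: measurable_itv.
have [k kP] : exists k : nat, `|p.1.1| + `|p.1.2| + `|p.2| + r < k%:R.
  by eexists; exact: truncnS_gt.
have Bk : eball p r `<=` cube k.
  move=> x; rewrite EB /= in_itv/= => qx.
  have h (y z : R) : (y - z) ^+ 2 <= q x -> `|z| + r < k%:R -> y \in `]- k%:R, k%:R[.
    move=> yq zk; have : `|y - z| < r.
      by rewrite -ltr_sqr ?nnegrE ?(ltW r0)// real_normK ?num_real// (le_lt_trans yq).
    rewrite in_itv/= -ltr_norml => yz; apply: le_lt_trans zk.
    by have := ler_normD (y - z) z; rewrite subrK; lra.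
  have := normr_ge0 p.1.1; have := normr_ge0 p.1.2; have := normr_ge0 p.2.
  move=> n3 n2 n1.
  have s1 := sqr_ge0 (x.1.1 - p.1.1); have s2 := sqr_ge0 (x.1.2 - p.1.2).
  have s3 := sqr_ge0 (x.2 - p.2).
  split; [split|] => /=.
  - by apply: (h _ p.1.1); rewrite /q; lra.
  - by apply: (h _ p.1.2); rewrite /q; lra.
  - by apply: (h _ p.2); rewrite /q; lra.
have s1 : sqint mu3 (\1_(eball p r) : X3 -> R).
  split; first exact: measurable_indic.
  rewrite (_ : (\int[mu3]_x _)%E = mu3 (eball p r)).
    apply: le_lt_trans (measure_cube k).
    by apply: le_measure; rewrite ?inE//; exact: measurable_cube.
  rewrite -[in RHS](setIT (eball p r)) -integral_indic//; apply: eq_integral => x _.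
  by rewrite indicE; case: (_ \in _); rewrite ?expr1n ?expr0n.
apply/L2P => i; have := sqintZ (a ord0 i) s1.
by congr sqint; apply/funext => x; rewrite mxE mulrC.
Qed.

Lemma derive1_support (k : R -> R) (M s : R) : (forall s, M <= `|s| -> k s = 0) ->
  M < `|s| -> k^`()%classic s = 0.
Proof.
move=> k0 Ms; rewrite derive1E (@near_eq_derive _ _ _ k (fun=> 0)) ?derive_cst//.
have : \forall t \near s, M < `|t|.
  have /cvgr_gt/(_ _ Ms) := @norm_continuous R R^o s; exact.
by apply: filterS => t /ltW; exact: k0.
Qed.

Lemma sqint_tens (k : 'I_3 -> R -> R) (M : R) : (forall j, continuous (k j)) ->
  (forall j s, M <= `|s| -> k j s = 0) -> sqint mu3 (tens k).
Proof.
move=> ck kM; have ak : admissible_kernel k.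
  split => //; exists `|M| => // j s Ms; apply: kM.
  exact: le_trans (ler_norm _) Ms.
have := sqint_slice2 0 ak; congr sqint; apply/funext => x.
by rewrite subr0.
Qed.

(** Test fields and their curls must be square integrable before they can be paired with weak
    transforms. *)
Lemma L2_tens (k : 'I_3 -> R -> R) (M : R) (w : 'rV[R]_3) : (forall j, smooth1 (k j)) ->
  (forall j s, M <= `|s| -> k j s = 0) ->
  L2 (fun x => tens k x *: w) /\ L2 (fun x => cross (tens_grad k x) w).
Proof.
move=> sk kM; split.
  apply/L2P => i; have := sqintZ (w ord0 i) (sqint_tens (fun j => smooth1_continuous (sk j)) kM).
  by congr sqint; apply/funext => x; rewrite mxE mulrC.
have h i : sqint mu3 (tens (tens_upd k i)).
  (* The derivative of a factor is known to vanish only for [|s|] strictly larger than [M]. *)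
  apply: (@sqint_tens _ (M + 1)).
    by move=> j; apply: smooth1_continuous; exact: smooth1_tens_upd.
  move=> j s Ms; have Ms' : M < `|s| by apply: lt_le_trans Ms; rewrite ltrDl.
  rewrite /tens_upd; case: ifP => _; last by apply: kM; exact: ltW.
  exact: (derive1_support (kM j)).
apply/L2P => i.
have := sqintB (sqintZ (w ord0 (i + 2%:R)) (h (i + 1))) (sqintZ (w ord0 (i + 1)) (h (i + 2%:R))).
by congr sqint; apply/funext => x; rewrite !mxE ![w _ _ * _]mulrC.
Qed.

End coefficients.

(** * The transformed system and its energy estimate *)

Section transformed_system.
Context {R : realType}.
Variable T : R.
Local Notation mu3 := (leb3 R).
Implicit Types (eps mu sigma epst : R3 R -> R) (F u v g ET HT Xe Xm Ye Ym : vfield R).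

(** The Maxwell equations hold on the open time interval only; its endpoints do not affect the
    integral. *)
Lemma lap_ext_oo (tau : R) (g h : R -> R) : {within `[0, T], continuous g} ->
  {within `[0, T], continuous h} -> (forall t, t \in `]0, T[ -> g t = h t) ->
  lap T tau g = lap T tau h.
Proof.
move=> cg ch gh.
have oo k : {within `[0, T], continuous k} ->
    lap T tau k = \int[lebesgue_measure]_(t in `]0, T[) (expR (- (tau * t)) * k t).
  move=> /(integrable_lap tau) ik; rewrite /lap.
  have icc : measurable (`[0, T]%classic : set (measurableTypeR R)) by exact: measurable_itv.
  rewrite -Rintegral_itv_obnd_cbnd -?Rintegral_itv_bndo_bndc//; apply: (integrableS icc _ _ ik).
  - exact: measurable_itv.
  - exact: subset_itv_oo_cc.
  - exact: measurable_itv.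
  - exact: subset_itv_oc_cc.
by rewrite !oo//; apply: eq_Rintegral => t; rewrite inE => /gh ->.
Qed.

(** A test field does not depend on time, so the curl identity at each time can be integrated
    against the exponential. *)
Lemma wlap_wcurl (tau : R) (F cF : R -> vfield R) (W cW : vfield R) : C0_Hcurl T F cF ->
  wlap T tau F W -> wlap T tau cF cW -> wcurl W cW.
Proof.
move=> [_ _ HF] [LW hW] [LcW hcW]; split => // k w sk [M kM].
have [L1 L2_] := L2_tens w sk kM.
apply: (etrans (hW _ L2_)); apply: (etrans _ (esym (hcW _ L1))).
apply: lap_ext => t tT; have [_ _ h] := Hcurl_wcurl (HF t tT).
exact: (h k w sk (ex_intro _ M kM)).
Qed.

(* Laplace transform in time of a Maxwell system with source [g], up to time [T]:
   integration by parts leaves the boundary terms in the final fields [ET], [HT]. *)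
Definition transformed (tau : R) epst eps mu g ET HT Xe Xm :=
  wcurl Xm (fun x => tau *: (epst x *: Xe x) - g x + expR (- (tau * T)) *: (eps x *: ET x)) /\
  wcurl Xe (fun x => - (tau *: (mu x *: Xm x) + expR (- (tau * T)) *: (mu x *: HT x))).

Lemma within_continuousD (A : set R) (g h : R -> R) : {within A, continuous g} ->
  {within A, continuous h} -> {within A, continuous (fun t => g t + h t)}.
Proof.
by move=> cg ch t; apply: (@cvgD _ _ _ (nbhs (t : subspace A))); [exact: cg|exact: ch].
Qed.

Lemma within_continuousZ (A : set R) (c : R) (g : R -> R) : {within A, continuous g} ->
  {within A, continuous (fun t => c * g t)}.
Proof.
move=> cg t; apply: (@cvgM _ _ (nbhs (t : subspace A))); [exact: cvg_cst|exact: cg].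
Qed.

(** The transforms of the curls need no construction: the right-hand sides of the transformed
    equations are checked to be weak transforms of [cH] and [cE]. *)
Lemma maxwell_transformed (tau : R) eps mu sigma (f : R -> R) (chi : vfield R)
    (E H : R -> vfield R) (We Wm : vfield R) : 0 < T -> 0 < tau ->
  bounded_coef eps -> bounded_coef mu -> bounded_coef sigma ->
  {within `[0, T], continuous f} -> L2 chi ->
  maxwell_solution T eps mu sigma (fun t x => f t *: chi x) E H ->
  wlap T tau E We -> wlap T tau H Wm ->
  transformed tau (fun x => eps x + sigma x / tau) eps mu
    (fun x => ftilde T f tau *: chi x) (E T) (H T) We Wm.
Proof.
move=> T0 tau0 beps bmu bsigma cf Lchi.
move=> [dE [dH [cE [cH [[CE CH] [HE HH] ampere faraday [E0 H0]]]]]] lWe lWm.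
have [LWe hWe] := lWe; have [LWm hWm] := lWm.
have [c0E cdE _] := CE; have [c0H cdH _] := CH.
have [LE _] := c0E; have [LdE _] := cdE; have [LH _] := c0H; have [LdH _] := cdH.
have [_ c0cE _] := HE; have [_ c0cH _] := HH.
have [LcE _] := c0cE; have [LcH _] := c0cH.
have in0 : 0 \in `[0, T] by rewrite in_itv/= lexx ltW.
have inT : T \in `[0, T] by rewrite in_itv/= lexx ltW.
have oocc t : t \in `]0, T[ -> t \in `[0, T].
  by rewrite !in_itv/= => /andP[/ltW -> /ltW ->].
have ip0 (u phi : vfield R) : L2 u -> L2 phi -> {ae mu3, forall x, u x = 0} -> ip u phi = 0.
  move=> Lu Lp u0; rewrite (ae_ip Lu L2_0 Lp u0) /ip.
  by under eq_Rintegral do rewrite dot0l; rewrite Rintegral_cst// mul0r.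
split.
  apply: (wlap_wcurl HH lWm).
  have bt : bounded_coef (fun x => eps x + sigma x / tau).
    by apply: bounded_coefD => //; apply: bounded_coefM => //; exact: bounded_coef_cst.
  have L1 := L2_scale tau (L2_mul bt LWe).
  have L2_ := L2_scale (ftilde T f tau) Lchi.
  have L3 := L2_scale (expR (- (tau * T))) (L2_mul beps (LE T inT)).
  split; first exact: (L2_add (L2_sub L1 L2_) L3).
  move=> phi Lp; have Le := L2_mul beps Lp; have Ls := L2_mul bsigma Lp.
  rewrite ipDl ?ipBl//; last exact: L2_sub.
  rewrite !ipZl//; [|exact: L2_mul (LE T inT)|exact: L2_mul].
  have -> : ip (fun x => (eps x + sigma x / tau) *: We x) phi =
      ip We (fun x => eps x *: phi x) + tau^-1 * ip We (fun x => sigma x *: phi x).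
    rewrite ip_mulC [ip We (fun x => eps x *: phi x)]ipC.
    rewrite [ip We (fun x => sigma x *: phi x)]ipC -ipZl// -ipDl//; last exact: L2_scale.
    by rewrite ipC; congr ip; apply/funext => x; rewrite scalerDl scalerA mulrC.
  rewrite [ip (fun x => eps x *: E T x) phi]ip_mulC.
  (* The equation for the electric field replaces the curl. The coefficients are moved onto [phi],
     so that integration by parts concerns pairings with a field fixed in time. *)
  rewrite (@lap_ext_oo tau (fun t => ip (cH t) phi)
    (fun t => (ip (dE t) (fun x => eps x *: phi x) + ip (E t) (fun x => sigma x *: phi x))
      + (- ip chi phi) * f t)).
  - have k1 := C0_ip_continuous cdE Le; have k2 := C0_ip_continuous c0E Ls.
    rewrite lapD; [|exact: within_continuousD|exact: within_continuousZ].
    rewrite lapD// lapZ// (lap_derive _ T0 CE Le) -!hWe// -/(ftilde T f tau).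
    rewrite (ip0 _ _ (LE 0 in0) Le E0) subr0 /lap -/(ftilde T f tau).
    by field; rewrite gt_eqF.
  - exact: C0_ip_continuous.
  - apply: within_continuousD; last exact: within_continuousZ.
    by apply: within_continuousD; exact: C0_ip_continuous.
  - move=> t tT; have tT' := oocc _ tT.
    have M1 := L2_mul beps (LdE t tT'); have M2 := L2_mul bsigma (LE t tT').
    have M3 := L2_scale (f t) Lchi.
    rewrite (@ae_ip _ _ (fun x => eps x *: dE t x + sigma x *: E t x - f t *: chi x))//.
    + rewrite ipBl// ?ipDl// ?ipZl//; last exact: L2_add.
      by rewrite !ip_mulC mulNr mulrC.
    + exact: LcH.
    + by apply: L2_sub => //; exact: L2_add.
    + apply: ae_imp (ampere t tT) => x /eqP; rewrite subr_eq => /eqP ->.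
      by rewrite addrAC [_ + cH t x - _]addrAC addrK addrAC addNr add0r.
apply: (wlap_wcurl HE lWe).
have L1 := L2_scale tau (L2_mul bmu LWm).
have L2_ := L2_scale (expR (- (tau * T))) (L2_mul bmu (LH T inT)).
split; first exact: (L2_opp (L2_add L1 L2_)).
move=> phi Lp; have Le := L2_mul bmu Lp.
rewrite ipNl//; last exact: L2_add.
rewrite ipDl// !ipZl//; [|exact: L2_mul (LH T inT)|exact: L2_mul].
rewrite !ip_mulC.
rewrite (@lap_ext_oo tau (fun t => ip (cE t) phi)
  (fun t => - 1 * ip (dH t) (fun x => mu x *: phi x))).
- rewrite lapZ; last exact: C0_ip_continuous.
  rewrite (lap_derive _ T0 CH Le) -hWm// (ip0 _ _ (LH 0 in0) Le H0).
  by ring.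
- exact: C0_ip_continuous.
- by apply: within_continuousZ; exact: C0_ip_continuous.
- move=> t tT; have tT' := oocc _ tT; have M1 := L2_mul bmu (LdH t tT').
  rewrite (@ae_ip _ _ (fun x => - (mu x *: dH t x)))//.
  + by rewrite ipNl// ip_mulC mulN1r.
  + exact: LcE.
  + exact: L2_opp.
  + by apply: ae_imp (faraday t tT) => x /eqP; rewrite addrC addr_eq0 => /eqP.
Qed.

(** This is the identity [P(X, Y)]: the equation for [curl Xm] paired with [Ye], against that for
    [curl Ye] paired with [Xm]. Hence the electric coefficient comes from [X] and the magnetic one
    from [Y]. *)
Lemma transformed_pair (tau : R) epstx epsx mux epsty epsy muy g ETx HTx Xe Xm ETy HTy Ye Ym :
  bounded_coef epstx -> bounded_coef muy -> L2 g ->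
  L2 (fun x => epsx x *: ETx x) -> L2 (fun x => muy x *: HTy x) ->
  transformed tau epstx epsx mux g ETx HTx Xe Xm ->
  transformed tau epsty epsy muy g ETy HTy Ye Ym ->
  ip g Ye = tau * (ip (fun x => epstx x *: Xe x) Ye + ip (fun x => muy x *: Ym x) Xm)
    + expR (- (tau * T)) * (ip (fun x => epsx x *: ETx x) Ye + ip (fun x => muy x *: HTy x) Xm).
Proof.
move=> bx by_ Lg LE LH [cX1 [LXe _ _]] [[LYm _ _] cY2].
have := wcurl_sym cX1 cY2; have [LXm _ _] := cX1; have [LYe _ _] := cY2.
have L1 := L2_mul bx LXe; have L2_ := L2_mul by_ LYm.
have M1 := L2_scale tau L1; have M2 := L2_scale (expR (- (tau * T))) LE.
have M3 := L2_scale tau L2_; have M4 := L2_scale (expR (- (tau * T))) LH.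
rewrite ipDl ?ipBl//; last exact: L2_sub.
rewrite (ipC Xm) ipNl//; last exact: L2_add.
rewrite ipDl// !ipZl// => h.
by rewrite !mulrDr; move: h; move: (tau * _) (tau * _) (expR _ * _) (expR _ * _) => *; lra.
Qed.

(** Since [(p + q) ^+ 2 <= 2 (p ^+ 2 + q ^+ 2)], one factor [p + q] can be divided out. *)
Lemma le_of_sum_sq (p q c d : R) : 0 <= p -> 0 <= q -> 0 < c -> 0 <= d ->
  c * (p ^+ 2 + q ^+ 2) <= d * (p + q) -> p + q <= 2 * d / c.
Proof.
move=> p0 q0 c0 d0 H; rewrite ler_pdivlMr//.
have [s0|] := ltP 0 (p + q); last first.
  move=> s0; have -> : p + q = 0 by lra.
  by rewrite mul0r mulr_ge0.
rewrite -(ler_pM2r s0); apply: (@le_trans _ _ (2 * (c * (p ^+ 2 + q ^+ 2)))); last by lra.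
have : 0 <= c * (p - q) ^+ 2 by rewrite mulr_ge0 ?sqr_ge0// ltW.
by rewrite sqrrB; lra.
Qed.

(** In [P(X, X)] the coefficients bound the quadratic part below by [tau * k] times the squared
    norms, while the source and the final fields enter linearly, with weight at most [G + e * N]. *)
Lemma transformed_bound (tau k G N : R) epst eps mu g ET HT Xe Xm :
  0 < tau -> 0 < k -> bounded_coef epst -> bounded_coef mu -> L2 g ->
  L2 (fun x => eps x *: ET x) -> L2 (fun x => mu x *: HT x) ->
  {ae mu3, forall x, k <= epst x} -> {ae mu3, forall x, k <= mu x} ->
  nrm g <= G -> nrm (fun x => eps x *: ET x) <= N -> nrm (fun x => mu x *: HT x) <= N ->
  transformed tau epst eps mu g ET HT Xe Xm ->
  nrm Xe + nrm Xm <= 2 * (G + expR (- (tau * T)) * N) / (tau * k).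
Proof.
move=> tau0 k0 be bm Lg LE LH ek mk gG EN HN tX.
have := transformed_pair be bm Lg LE LH tX tX.
have [[LXm _ _] [LXe _ _]] := tX.
have h1 := ip_coef_ge be LXe ek; have h2 := ip_coef_ge bm LXm mk.
have /ler_normlP[_ n1] := ip_nrm Lg LXe.
have /ler_normlP[n2 _] := ip_nrm LE LXe.
have /ler_normlP[n3 _] := ip_nrm LH LXm.
have e0 := expR_ge0 (- (tau * T)).
have G0 := le_trans (nrm_ge0 _) gG; have N0 := le_trans (nrm_ge0 _) EN.
rewrite -!nrm_sq in h1 h2; have p0 := nrm_ge0 Xe; have q0 := nrm_ge0 Xm.
have m1 := ler_wpM2r p0 gG; have m2 := ler_wpM2r p0 EN; have m3 := ler_wpM2r q0 HN.
move: (expR _) e0 => e e0 H.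
apply: le_of_sum_sq => //; first exact: mulr_gt0.
  by rewrite addr_ge0// mulr_ge0.
have h := ler_wpM2l (ltW tau0) (lerD h1 h2).
have h' : - (N * nrm Xe + N * nrm Xm) <=
    ip (fun x => eps x *: ET x) Xe + ip (fun x => mu x *: HT x) Xm.
  by clear -n2 n3 m2 m3; lra.
have {}h' := ler_wpM2l e0 h'.
have Gq : 0 <= G * nrm Xm by rewrite mulr_ge0.
rewrite -mulrDr mulrA in h; apply: (le_trans h).
rewrite !mulrDl !mulrDr; move: H h'; rewrite !mulrDr mulrN mulrDr !mulrA.
by clear -n1 m1 Gq; move: (e * _ * _) (e * _ * _) (tau * _) (tau * _) (e * _) (e * _) => *; lra.
Qed.

Lemma mulr_invB (b c : R) : b != 0 -> c / b * (c - b) = c / b * c - c.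
Proof. by move=> b0; field. Qed.

(** The linear bookkeeping common to both bounds: [a] stands for the cross terms, [b] and [c] for
    the energies of background and perturbed fields, the last six letters for boundary terms. The 8
    counts these, the two cross ones being doubled twofold: 4 + 2 + 2. *)
Lemma le_square_combination (t e n a1 a2 b1 b2 c1 c2 d m x1 x2 y1 y2 z1 z2 : R) :
  0 <= t -> 0 <= e -> 2 * a1 <= c1 + b1 + d -> 2 * a2 <= c2 + m ->
  x1 <= n -> x2 <= n -> - y1 <= n -> - y2 <= n -> - z1 <= n -> - z2 <= n ->
  2 * (t * (a1 + a2) + e * (x1 + x2)) - (t * (b1 + b2) + e * (y1 + y2))
    - (t * (c1 + c2) + e * (z1 + z2)) <= t * (d + (m - b2)) + e * (n *+ 8).
Proof.
move=> t0 e0 h1 h2 r1 r2 r3 r4 r5 r6.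
rewrite (_ : _ - _ - _ = t * (2 * (a1 + a2) - (b1 + b2) - (c1 + c2))
  + e * (2 * (x1 + x2) - (y1 + y2) - (z1 + z2))); last by ring.
apply: lerD; apply: ler_wpM2l => //; first lra.
by rewrite -mulr_natr; lra.
Qed.

(** * Comparison of the two transformed systems *)

Section two_systems.
Variables (tau k N S : R) (epst eps mu epst0 eps0 mu0 : R3 R -> R).
Variables (g ET HT E0T H0T We Wm Ve Vm : vfield R).
Hypotheses (tau0 : 0 < tau) (k0 : 0 < k).
Hypotheses (be : bounded_coef epst) (bm : bounded_coef mu).
Hypotheses (be0 : bounded_coef epst0) (bm0 : bounded_coef mu0) (Lg : L2 g).
Hypotheses (LE : L2 (fun x => eps x *: ET x)) (LH : L2 (fun x => mu x *: HT x)).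
Hypotheses (LE0 : L2 (fun x => eps0 x *: E0T x)) (LH0 : L2 (fun x => mu0 x *: H0T x)).
Hypotheses (ek : {ae mu3, forall x, k <= epst x}) (mk : {ae mu3, forall x, k <= mu x}).
Hypotheses (nE : nrm (fun x => eps x *: ET x) <= N) (nH : nrm (fun x => mu x *: HT x) <= N).
Hypotheses (nE0 : nrm (fun x => eps0 x *: E0T x) <= N).
Hypotheses (nH0 : nrm (fun x => mu0 x *: H0T x) <= N).
Hypotheses (sW : nrm We + nrm Wm <= S) (sV : nrm Ve + nrm Vm <= S).
Hypotheses (tW : transformed tau epst eps mu g ET HT We Wm).
Hypotheses (tV : transformed tau epst0 eps0 mu0 g E0T H0T Ve Vm).

Let e := expR (- (tau * T)).
Let LWe : L2 We. Proof. by have [_ []] := tW. Qed.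
Let LWm : L2 Wm. Proof. by have [[]] := tW. Qed.
Let LVe : L2 Ve. Proof. by have [_ []] := tV. Qed.
Let LVm : L2 Vm. Proof. by have [[]] := tV. Qed.

Let err u v : L2 u -> L2 v -> nrm u <= N -> nrm v <= S -> `|ip u v| <= N * S.
Proof.
move=> Lu Lv uN vS; apply: (le_trans (ip_nrm Lu Lv)).
by apply: ler_pM => //; exact: nrm_ge0.
Qed.

Let sWe : nrm We <= S. Proof. by apply: le_trans sW; rewrite lerDl nrm_ge0. Qed.
Let sWm : nrm Wm <= S. Proof. by apply: le_trans sW; rewrite lerDr nrm_ge0. Qed.
Let sVe : nrm Ve <= S. Proof. by apply: le_trans sV; rewrite lerDl nrm_ge0. Qed.
Let sVm : nrm Vm <= S. Proof. by apply: le_trans sV; rewrite lerDr nrm_ge0. Qed.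

Let bounded_ratio b c : bounded_coef b -> bounded_coef c -> {ae mu3, forall x, k <= b x} ->
  bounded_coef (fun x => c x / b x).
Proof. by move=> bb bc bk; apply: bounded_coefM => //; exact: bounded_coefV bk. Qed.

Let square b u v : bounded_coef b -> L2 u -> L2 v -> {ae mu3, forall x, k <= b x} ->
  2 * ip (fun x => b x *: v x) u <= ip (fun x => b x *: u x) u + ip (fun x => b x *: v x) v.
Proof.
move=> bb Lu Lv bk; apply: ip_complete_square => //.
by apply: ae_imp bk => x kx; rewrite (lt_le_trans k0 kx).
Qed.

(** Completing the square leaves [c ^+ 2 / b], which is [c + c / b * (c - b)]; this is the origin of
    the quotients of coefficients in the two bounds. *)
Let square_ratio b c u v : bounded_coef b -> bounded_coef c -> L2 u -> L2 v ->
  {ae mu3, forall x, k <= b x} ->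
  2 * ip (fun x => c x *: v x) u <= ip (fun x => b x *: u x) u + ip (fun x => c x *: v x) v
    + ip (fun x => (c x / b x * (c x - b x)) *: v x) v.
Proof.
move=> bb bc Lu Lv bk; have br := bounded_ratio bb bc bk.
have brc := bounded_coefM br bc; have brB := bounded_coefM br (bounded_coefB bc bb).
rewrite -addrA -ipDl//; [|exact: L2_mul..].
rewrite [X in _ <= _ + X](@ae_ip _ _ (fun x => (c x / b x * c x) *: v x))//.
- apply: ip_complete_square => //; apply: ae_imp bk => x kx.
  have b0 := lt_le_trans k0 kx; split => //.
  by field; rewrite gt_eqF.
- by apply: L2_add; exact: L2_mul.
- exact: L2_mul.
- apply: ae_imp bk => x kx; have b0 := lt_le_trans k0 kx.
  by rewrite -scalerDl mulr_invB ?gt_eqF// addrC subrK.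
Qed.

(** In [P(V, W)] the electric cross term carries [epst0] and the magnetic one [mu], whereas the
    squares in [P(W, W)] carry [epst] and [mu]. Only the electric coefficients mismatch, so only
    that part acquires a quotient. *)
Lemma indicator_upper : ip g We - ip g Ve <=
  tau * (\int[mu3]_x (epst0 x / epst x * (epst0 x - epst x) * enorm (Ve x) ^+ 2
    + (mu x - mu0 x) * enorm (Vm x) ^+ 2)) + e * (N * S *+ 8).
Proof.
have br := bounded_coefM (bounded_ratio be be0 ek) (bounded_coefB be0 be).
rewrite (ip_coef_split br (bounded_coefB bm bm0))//.
have pVW := transformed_pair be0 bm Lg LE0 LH tV tW.
have pV := transformed_pair be0 bm0 Lg LE0 LH0 tV tV.
have pW := transformed_pair be bm Lg LE LH tW tW.
have q1 := square_ratio be be0 LWe LVe ek.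
have q2 := square bm LWm LVm mk.
have /ler_normlP[_ r1] := err LE0 LWe nE0 sWe.
have /ler_normlP[_ r2] := err LH LVm nH sVm.
have /ler_normlP[r3 _] := err LE0 LVe nE0 sVe.
have /ler_normlP[r4 _] := err LH0 LVm nH0 sVm.
have /ler_normlP[r5 _] := err LE LWe nE sWe.
have /ler_normlP[r6 _] := err LH LWm nH sWm.
have -> : ip (fun x => (mu x - mu0 x) *: Vm x) Vm =
    ip (fun x => mu x *: Vm x) Vm - ip (fun x => mu0 x *: Vm x) Vm.
  rewrite -ipBl//; [|exact: L2_mul..].
  by congr ip; apply/funext => x; rewrite scalerBl.
have -> : ip g We - ip g Ve = 2 * ip g We - ip g Ve - ip g We by ring.
rewrite {1}pVW {1}pV {1}pW.
apply: le_square_combination => //; first exact: ltW.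
by rewrite ip_mulC ipC.
Qed.

(** In [P(W, V)] the electric cross term carries [epst], matching [P(W, W)], and the magnetic one
    [mu0]; the quotient now appears in the magnetic part. *)
Lemma indicator_lower : ip g We - ip g Ve >=
  tau * (\int[mu3]_x ((epst0 x - epst x) * enorm (Ve x) ^+ 2
    + mu0 x / mu x * (mu x - mu0 x) * enorm (Vm x) ^+ 2)) - e * (N * S *+ 8).
Proof.
have bB := bounded_coefM (bounded_ratio bm bm0 mk) (bounded_coefB bm bm0).
have bB' := bounded_coefM (bounded_ratio bm bm0 mk) (bounded_coefB bm0 bm).
rewrite (ip_coef_split (bounded_coefB be0 be) bB)//.
have pWV := transformed_pair be bm0 Lg LE LH0 tW tV.
have pV := transformed_pair be0 bm0 Lg LE0 LH0 tV tV.
have pW := transformed_pair be bm Lg LE LH tW tW.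
have q1 := square be LWe LVe ek.
have q2 := square_ratio bm bm0 LWm LVm mk.
have /ler_normlP[_ r1] := err LH0 LWm nH0 sWm.
have /ler_normlP[_ r2] := err LE LVe nE sVe.
have /ler_normlP[r3 _] := err LH0 LVm nH0 sVm.
have /ler_normlP[r4 _] := err LE0 LVe nE0 sVe.
have /ler_normlP[r5 _] := err LH LWm nH sWm.
have /ler_normlP[r6 _] := err LE LWe nE sWe.
have -> : ip (fun x => (epst0 x - epst x) *: Ve x) Ve =
    ip (fun x => epst0 x *: Ve x) Ve - ip (fun x => epst x *: Ve x) Ve.
  rewrite -ipBl//; [|exact: L2_mul..].
  by congr ip; apply/funext => x; rewrite scalerBl.
have -> : ip (fun x => (mu0 x / mu x * (mu x - mu0 x)) *: Vm x) Vm =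
    - ip (fun x => (mu0 x / mu x * (mu0 x - mu x)) *: Vm x) Vm.
  rewrite -ipNl//; last exact: L2_mul.
  by congr ip; apply/funext => x; rewrite -scaleNr -mulrN opprB.
have -> : ip g We - ip g Ve = - (2 * ip g Ve - ip g Ve - ip g We) by ring.
rewrite {1}pWV {1}pV {1}pW lerNr opprB.
have q1' : 2 * ip (fun x => epst x *: We x) Ve <=
    ip (fun x => epst x *: We x) We + ip (fun x => epst x *: Ve x) Ve.
  by rewrite ip_mulC ipC.
(* Magnetic and electric terms trade places relative to [indicator_upper]: the mismatched pair, now
   the magnetic one, must occupy the first slot. *)
have := @le_square_combination _ _ _ _ _ _ (ip (fun x => epst0 x *: Ve x) Ve)
  _ _ _ _ _ _ _ _ _ _ (ltW tau0) (expR_ge0 (- (tau * T))) q2 q1' r1 r2 r3 r4 r5 r6.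
rewrite -/e; set L := (X in X <= _); set L' := (X in _ -> X <= _).
have -> : L' = L by rewrite /L /L'; ring.
by move=> h; apply: (le_trans h); rewrite le_eqVlt; apply/orP; left; apply/eqP; ring.
Qed.

End two_systems.
Lemma remainderE (tau : R) : 0 < tau ->
  remainder T tau = expR (- (tau * T)) / Num.sqrt tau ^+ 5.
Proof.
move=> tau0; rewrite /remainder powRN [5%:R / _]mulrC powRrM powR12_sqrt ?(ltW tau0)//.
by rewrite powR_mulrn ?sqrtr_ge0// mulrC.
Qed.

(** Quadratic decay of [expR (- (tau * T))] is enough for the final fields to be no larger than the
    source, of order [tau^(-3/2)], in the energy estimate. *)
Lemma expRN_le (x : R) : 0 < x -> expR (- x) <= 2 / x ^+ 2.
Proof.
move=> x0; rewrite expRN -[leRHS]invf_div lef_pV2 ?posrE ?expR_gt0//; last first.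
  by rewrite divr_gt0// exprn_gt0.
by apply: le_trans (expR_ge1Dxn 1 (ltW x0)); rewrite lerDr.
Qed.

Lemma nrmZ (c : R) u : L2 u -> nrm (fun x => c *: u x) = `|c| * nrm u.
Proof.
move=> Lu; rewrite /nrm ipZl ?(ipC u) ?ipZl//; last exact: L2_scale.
by rewrite mulrA -expr2 sqrtrM ?sqr_ge0// sqrtr_sqr.
Qed.

End transformed_system.

(** * Uniform constants and conclusion *)

Theorem theorem1p1 (R : realType) (T : R)
  (eps mu sigma eps0 mu0 sigma0 : R3 R -> R)
  (D : set (R3 R)) (p : R3 R) (eta : R) (a : 'rV[R]_3) (f : R -> R)
  (E H E0 H0 : R -> vfield R) (We Ve Vm : R -> vfield R)
  (T_gt0 : 0 < T)
  (coefs : admissible_coefs eps mu sigma)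
  (coefs0 : admissible_coefs eps0 mu0 sigma0)
  (D_nonempty : D !=set0) (D_bounded : bounded_set D) (D_open : open D)
  (D_ext_connected : connected (~` closure D))
  (coefs_outside : {ae leb3 R, forall x, ~ D x ->
     [/\ eps x = eps0 x, mu x = mu0 x & sigma x = sigma0 x]})
  (eta_gt0 : 0 < eta)
  (B_away : closure (eball p eta) `&` closure D = set0)
  (a_unit : enorm a = 1)
  (f_H1 : H1 T f) (f_0 : f 0 = 0)
  (EH_sol :
     maxwell_solution T eps mu sigma (current f (eball p eta) a) E H)
  (EH0_sol :
     maxwell_solution T eps0 mu0 sigma0 (current f (eball p eta) a) E0 H0)
  (We_def : forall tau : R, 0 < tau -> laplaceT T E tau (We tau))
  (Ve_def : forall tau : R, 0 < tau -> laplaceT T E0 tau (Ve tau))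
  (Vm_def : forall tau : R, 0 < tau -> laplaceT T H0 tau (Vm tau)) :
  let I := indicator T f (eball p eta) a We Ve in
  let epst (tau : R) (x : R3 R) := eps x + sigma x / tau in
  let epst0 (tau : R) (x : R3 R) := eps0 x + sigma0 x / tau in
  (exists C tau0 : R, [/\ 0 < C, 0 < tau0 & forall tau : R, tau0 <= tau ->
     I tau <=
       tau * (\int[leb3 R]_x
         (epst0 tau x / epst tau x * (epst0 tau x - epst tau x)
            * enorm (Ve tau x) ^+ 2
          + (mu x - mu0 x) * enorm (Vm tau x) ^+ 2))
       + C * remainder T tau]) /\
  (exists C tau0 : R, [/\ 0 < C, 0 < tau0 & forall tau : R, tau0 <= tau ->
     I tau >=
       tau * (\int[leb3 R]_x
         ((epst0 tau x - epst tau x) * enorm (Ve tau x) ^+ 2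
          + mu0 x / mu x * (mu x - mu0 x) * enorm (Vm tau x) ^+ 2))
       - C * remainder T tau]).
Proof.
move=> I epst epst0.
have [/ess_bounded_coef be /ess_bounded_coef bm /ess_bounded_coef bs [] ] := coefs.
move=> /ess_inf_gt0_lower[k1 k10 ek1] /ess_inf_gt0_lower[k2 k20 mk2] sge.
have [/ess_bounded_coef be0 /ess_bounded_coef bm0 /ess_bounded_coef bs0 [] ] := coefs0.
move=> /ess_inf_gt0_lower[k3 k30 ek3] /ess_inf_gt0_lower[k4 k40 mk4] sge0.
pose k := Num.min (Num.min k1 k2) (Num.min k3 k4).
have k0 : 0 < k by rewrite !lt_min k10 k20 k30 k40.
have [kk1 kk2 kk3 kk4] : [/\ k <= k1, k <= k2, k <= k3 & k <= k4].
  by rewrite !ge_min !lexx ?orbT.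
have mk : {ae leb3 R, forall x, k <= mu x}.
  by apply: ae_imp mk2 => x; exact: le_trans.
have mk0 : {ae leb3 R, forall x, k <= mu0 x}.
  by apply: ae_imp mk4 => x; exact: le_trans.
pose chi : vfield R := fun x => \1_(eball p eta) x *: a.
have Lchi : L2 chi by exact: L2_indic_eball.
have cur : current f (eball p eta) a = fun t x => f t *: chi x.
  by apply/funext => t; apply/funext => x; rewrite /chi scalerA.
rewrite cur in EH_sol EH0_sol.
have [_ [dH [_ [_ [[[cE _ _] C1H] _ _ _ _]]]]] := EH_sol.
have [_ [_ [_ [_ [[[cE0 _ _] [cH0 _ _]] _ _ _ _]]]]] := EH0_sol.
have [cH _ _] := C1H; have [cf _ _] := f_H1.
have inT : T \in `[0, T] by rewrite in_itv/= lexx ltW.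
have LE := L2_mul be (cE.1 T inT); have LH := L2_mul bm (cH.1 T inT).
have LE0 := L2_mul be0 (cE0.1 T inT); have LH0 := L2_mul bm0 (cH0.1 T inT).
have [Cf Cf0 HCf] := ftilde_bound T_gt0 f_H1 f_0.
(* A sum rather than a maximum: it dominates all four weighted final fields and does not depend on
   [tau]. *)
pose N := nrm (fun x => eps x *: E T x) + nrm (fun x => mu x *: H T x)
  + (nrm (fun x => eps0 x *: E0 T x) + nrm (fun x => mu0 x *: H0 T x)).
have nn := @nrm_ge0 R.
have N0 : 0 <= N by rewrite !addr_ge0.
have nE : nrm (fun x => eps x *: E T x) <= N by rewrite /N -addrA lerDl !addr_ge0.
have nH : nrm (fun x => mu x *: H T x) <= N.
  by rewrite /N [_ + nrm (fun x => mu x *: _)]addrC -addrA lerDl !addr_ge0.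
have nE0 : nrm (fun x => eps0 x *: E0 T x) <= N by rewrite /N addrCA lerDl !addr_ge0.
have nH0 : nrm (fun x => mu0 x *: H0 T x) <= N by rewrite /N addrA lerDr !addr_ge0.
(* This is what [transformed_bound] yields once [Num.sqrt tau ^- 3] is taken out of the source and
   the exponential, and [Num.sqrt tau ^- 2] out of [tau^-1]. *)
pose S0 := 2 * (Cf * nrm chi + 2 / T ^+ 2 * N) / k.
have S00 : 0 <= S0.
  rewrite !mulr_ge0 ?invr_ge0 ?(ltW k0)// addr_ge0 ?mulr_ge0 ?(ltW Cf0)//.
  by rewrite invr_ge0 exprn_ge0 ?ltW.
pose g tau : vfield R := fun x => ftilde T f tau *: chi x.
have Lg tau : L2 (g tau) by exact: L2_scale.
have IE tau : 0 < tau -> I tau = ip (g tau) (We tau) - ip (g tau) (Ve tau).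
  move=> tau0; have [LWe _] := We_def tau tau0; have [LVe _] := Ve_def tau tau0.
  by rewrite -ipBr//; apply: eq_Rintegral => x _; rewrite /g /chi scalerA.
have bounds tau : 1 <= tau -> exists Wm,
  [/\ bounded_coef (epst tau) /\ bounded_coef (epst0 tau),
      {ae leb3 R, forall x, k <= epst tau x},
      transformed T tau (epst tau) eps mu (g tau) (E T) (H T) (We tau) Wm /\
      transformed T tau (epst0 tau) eps0 mu0 (g tau) (E0 T) (H0 T) (Ve tau) (Vm tau),
      nrm (We tau) + nrm Wm <= S0 / Num.sqrt tau ^+ 5 &
      nrm (Ve tau) + nrm (Vm tau) <= S0 / Num.sqrt tau ^+ 5].
  move=> tau1; have tau0 : 0 < tau by exact: lt_le_trans tau1.
  (* The magnetic field of the perturbed system is transformed here, separately for each [tau]. *)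
  have [Wm lWm] := wlap_exists T_gt0 tau0 C1H.
  have tW := maxwell_transformed T_gt0 tau0 be bm bs cf Lchi EH_sol
    (laplaceT_wlap T_gt0 cE (We_def tau tau0)) lWm.
  have tV := maxwell_transformed T_gt0 tau0 be0 bm0 bs0 cf Lchi EH0_sol
    (laplaceT_wlap T_gt0 cE0 (Ve_def tau tau0)) (laplaceT_wlap T_gt0 cH0 (Vm_def tau tau0)).
  have bt : bounded_coef (epst tau).
    by apply: bounded_coefD => //; apply: bounded_coefM => //; exact: bounded_coef_cst.
  have bt0 : bounded_coef (epst0 tau).
    by apply: bounded_coefD => //; apply: bounded_coefM => //; exact: bounded_coef_cst.
  have tk : {ae leb3 R, forall x, k <= epst tau x}.
    apply: ae_imp (ae_and ek1 sge) => x [kx sx].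
    by rewrite ler_wpDr ?(le_trans kk1)// divr_ge0// ltW.
  have tk0 : {ae leb3 R, forall x, k <= epst0 tau x}.
    apply: ae_imp (ae_and ek3 sge0) => x [kx sx].
    by rewrite ler_wpDr ?(le_trans kk3)// divr_ge0// ltW.
  have gle : nrm (g tau) <= Cf * nrm chi / Num.sqrt tau ^+ 3.
    by rewrite nrmZ// mulrAC ler_wpM2r// HCf.
  have s1 : 1 <= Num.sqrt tau by rewrite -sqrtr1 ler_wsqrtr.
  (* The decay [tau ^- 2] is weakened, using [tau >= 1], to the order of the source, so that both
     combine into one constant. *)
  have ele : expR (- (tau * T)) <= 2 / T ^+ 2 / Num.sqrt tau ^+ 3.
    apply: (le_trans (expRN_le (mulr_gt0 tau0 T_gt0))).
    rewrite exprMn [tau ^+ 2 * _]mulrC invfM mulrA ler_wpM2l//.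
      by rewrite divr_ge0// exprn_ge0// ltW.
    rewrite lef_pV2 ?posrE ?exprn_gt0 ?sqrtr_gt0//.
    rewrite -[in leRHS](sqr_sqrtr (ltW tau0)) -exprM.
    by rewrite ler_weXn2l.
  have sle u v : nrm u + nrm v <=
      2 * (Cf * nrm chi / Num.sqrt tau ^+ 3 + expR (- (tau * T)) * N) / (tau * k) ->
      nrm u + nrm v <= S0 / Num.sqrt tau ^+ 5.
    move=> h; apply: (le_trans h).
    have -> : S0 / Num.sqrt tau ^+ 5 = 2 * (Cf * nrm chi / Num.sqrt tau ^+ 3 +
        2 / T ^+ 2 / Num.sqrt tau ^+ 3 * N) / (tau * k).
      rewrite /S0 -[in tau * k](sqr_sqrtr (ltW tau0)).
      have sn : Num.sqrt tau != 0 by rewrite gt_eqF// sqrtr_gt0.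
      have kn : k != 0 by rewrite gt_eqF.
      have Tn : T != 0 by rewrite gt_eqF.
      by move: (Num.sqrt tau) sn => s sn; field; rewrite sn kn Tn.
    rewrite ler_wpM2r ?invr_ge0 ?mulr_ge0 ?(ltW tau0) ?(ltW k0)//.
    by rewrite ler_wpM2l// lerD2l ler_wpM2r.
  exists Wm; split => //.
  - apply: sle; apply: (transformed_bound tau0 k0 bt bm _ LE LH tk mk gle nE nH tW).
    exact: Lg.
  - apply: sle; apply: (transformed_bound tau0 k0 bt0 bm0 _ LE0 LH0 tk0 mk0 gle nE0 nH0 tV).
    exact: Lg.
have rem tau : 1 <= tau -> expR (- (tau * T)) * (N * (S0 / Num.sqrt tau ^+ 5) *+ 8) <=
    (N * S0 * 8 + 1) * remainder T tau.
  move=> tau1; have tau0 : 0 < tau by exact: lt_le_trans tau1.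
  rewrite remainderE//; have : 0 <= expR (- (tau * T)) / Num.sqrt tau ^+ 5.
    by rewrite divr_ge0 ?expR_ge0 ?exprn_ge0 ?sqrtr_ge0.
  rewrite -mulr_natr.
  by move: (expR _) (_ ^+ 5)^-1 => x y; lra.
(* The added 1 makes the constant positive even if [N] or [S0] is 0. *)
have C0 : 0 < N * S0 * 8 + 1 by rewrite ltr_wpDl// mulr_ge0// mulr_ge0.
split; exists (N * S0 * 8 + 1), 1; split => // tau tau1.
  have tau0 : 0 < tau by exact: lt_le_trans tau1.
  have [Wm [[bt bt0] tk [tW tV] sW sV]] := bounds tau tau1; rewrite IE//.
  have := indicator_upper tau0 k0 bt bm bt0 bm0 (Lg tau) LE LH LE0 LH0 tk mk
    nE nH nE0 nH0 sW sV tW tV.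
  by move=> h; apply: (le_trans h); rewrite lerD2l rem.
have tau0 : 0 < tau by exact: lt_le_trans tau1.
have [Wm [[bt bt0] tk [tW tV] sW sV]] := bounds tau tau1; rewrite IE//.
have := indicator_lower tau0 k0 bt bm bt0 bm0 (Lg tau) LE LH LE0 LH0 tk mk
  nE nH nE0 nH0 sW sV tW tV.
by move=> h; apply: le_trans h; rewrite lerD2l lerN2 rem.
Qed.
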